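(* Let $f:\mathbb{R}^n\to\mathbb{R}$ and $x_0\in\mathbb{R}^n$. Suppose that the level set $\mathcal{L}_f(x_0)=\{x : f(x)\le f(x_0)\}$ is compact, and that $f$ is twice uniformly Lipschitz continuously differentiable on an open neighborhood of $\mathcal{L}_f(x_0)$ that includes the trial points generated by the Damped Newton-CG algorithm (described in the context) started at $x_0$, with $L_H$ a Lipschitz constant of $\nabla^2 f$ on this neighborhood. Let $f_{\mathrm{low}}$ and $U_H>0$ be such that $f(x)\ge f_{\mathrm{low}}$ and $\|\nabla^2f(x)\|\le U_H$ for $x\in\mathcal{L}_f(x_0)$. Let $\epsilon_g>0$, $\epsilon_H\in(0,1)$, $\theta,\zeta\in(0,1)$, $\eta>0$ be the parameters of the algorithm. Suppose further that the Minimum Eigenvalue Oracle satisfies the following, for a specified failure probability $\delta$ with $0\le\delta\ll1$: for every iteration $k$ at which Damped Newton-CG calls the oracle, with probability $1-\delta$ the oracle either certifies that $\nabla^2f(x_k)\succeq-\epsilon_HI$ or finds a vector of curvature smaller than $-\epsilon_H/2$ in at most $N_{\mathrm{meo}}:=\min\{n,1+\lceil \mathcal{C}_{\mathrm{meo}}\epsilon_H^{-1/2}\rceil\}$ Hessian-vector products, where $\mathcal{C}_{\mathrm{meo}}$ depends at most logarithmically on $\delta$ and $\epsilon_H$. Define $$c_{sol} = \frac{\eta}{6}\min\left\{ \left[ \frac{4}{\sqrt{(4+\zeta)^2+8 L_H}+4+\zeta}\right]^3, \left[ \frac{3\theta^2 (1-\zeta) }{L_H+\eta}\right]^3\right\},\qquad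 c_{nc} = \frac{\eta}{6}\min\left\{1,\frac{27\theta^3}{(L_H+\eta)^3}\right\},$$ $$\bar{K}_2 :=\left\lceil \frac{3(f(x_0)-f_{\mathrm{low}})}{\min\{c_{sol},c_{nc}/8\}}\max\{\epsilon_g^{-3}\epsilon_H^3, \epsilon_H^{-3}\} \right\rceil + 2 .$$ Suppose that the values of $M$ used or calculated at each instance of Capped CG satisfy $M\le U_H$. Then with probability at least $(1-\delta)^{\bar K_2}$, the Damped Newton-CG algorithm terminates at a point $x$ satisfying $\|\nabla f(x)\|\le\epsilon_g$ and $\lambda_{\min}(\nabla^2f(x))\ge-\epsilon_H$ after at most $$\left(\max\{2\min\{n,J(U_H,\epsilon_H,\zeta)\}+2,\;N_{\mathrm{meo}}\}\right)\bar K_2$$ Hessian-vector products and/or gradient evaluations, where $J(\cdot,\cdot,\cdot)$ is defined in the context. (With probability at most $1-(1-\delta)^{\bar K_2}$, it terminates incorrectly with this complexity at a point $x$ for which $\|\nabla f(x)\|\le\epsilon_g$ but $\lambda_{\min}(\nabla^2f(x))<-\epsilon_H$.) For $n$ sufficiently large, and assuming that $\delta<1/\bar K_2$, the bound is $\tilde{\mathcal O}\left(\max\{\epsilon_g^{-3}\epsilon_H^{5/2},\epsilon_H^{-7/2}\}\right)$, with probability at least $1-\bar K_2\delta$.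
   Context: $\|\cdot\|$ is the Euclidean norm (or induced matrix norm); $\lambda_{\min}$ is the smallest eigenvalue; $\mathrm{sgn}(0)=1$. $\tilde{\mathcal O}$ denotes $\mathcal O$ with logarithmic terms omitted, with the dependence on $\epsilon_g,\epsilon_H$ shown. Definition of $J$. For $M\ge0$, $\epsilon,\zeta\in(0,1)$, let $\kappa=\frac{M+2\epsilon}{\epsilon}$, $\hat\zeta=\frac{\zeta}{3\kappa}$, $\tau=\frac{\sqrt\kappa}{\sqrt\kappa+1}$, $T=\frac{4\kappa^4}{(1-\sqrt\tau)^2}$. Then $J(M,\epsilon,\zeta)$ is the smallest integer $J$ such that $\sqrt T\,\tau^{J/2}\le\hat\zeta$. Capped CG. Inputs: symmetric $H\in\mathbb{R}^{n\times n}$, $g\ne 0$, damping $\epsilon\in(0,1)$, accuracy $\zeta\in(0,1)$, optional scalar $M\ge 0$ (set to $0$ if not provided). Let $\bar H=H+2\epsilon I$. At any time, $\kappa=\frac{M+2\epsilon}{\epsilon}$, $\hat\zeta=\frac{\zeta}{3\kappa}$, $\tau=\frac{\sqrt\kappa}{\sqrt\kappa+1}$, $T=\frac{4\kappa^4}{(1-\sqrt\tau)^2}$ are computed from the current $M$. ''Update $M$ with $u$'' means: if $\|Hu\|>M\|u\|$, replace $M$ by $\|Hu\|/\|u\|$ and recompute $\kappa,\hat\zeta,\tau,T$. Start with $y_0=0$, $r_0=g$, $p_0=-g$, $j=0$. If $p_0^\top\bar Hp_0<\epsilon\|p_0\|^2$, return $d=p_0$ with d_type=NC; otherwise update $M$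 with $p_0$. Then repeat: set $\alpha_j=r_j^\top r_j/p_j^\top\bar Hp_j$, $y_{j+1}=y_j+\alpha_jp_j$, $r_{j+1}=r_j+\alpha_j\bar Hp_j$, $\beta_{j+1}=r_{j+1}^\top r_{j+1}/r_j^\top r_j$, $p_{j+1}=-r_{j+1}+\beta_{j+1}p_j$; increase $j$ by $1$; update $M$ with $p_j$, then with $y_j$, then with $r_j$; then apply the tests in order: (1) if $y_j^\top\bar Hy_j<\epsilon\|y_j\|^2$, return $d=y_j$, d_type=NC; (2) else if $\|r_j\|\le\hat\zeta\|r_0\|$, return $d=y_j$, d_type=SOL; (3) else if $p_j^\top\bar Hp_j<\epsilon\|p_j\|^2$, return $d=p_j$, d_type=NC; (4) else if $\|r_j\|>\sqrt T\tau^{j/2}\|r_0\|$, compute $\alpha_j=r_j^\top r_j/p_j^\top\bar Hp_j$ and $y_{j+1}=y_j+\alpha_jp_j$, find $i\in\{0,\dots,j-1\}$ with $(y_{j+1}-y_i)^\top\bar H(y_{j+1}-y_i)<\epsilon\|y_{j+1}-y_i\|^2$, and return $d=y_{j+1}-y_i$, d_type=NC. Cost convention: each iteration uses one matrix-vector product $Hp_j$ (the products of $H$ with $y_j$ and $r_j$ are obtained from these by vector operations), and $Hp_0$ costs one product; the iterates $y_i$ may be either stored, or regenerated by re-running the recurrence when needed in test (4). Minimum Eigenvalue Oracle. Inputs: symmetric $H$, tolerance $\epsilon>0$, optional bound $M$ on $\|H\|$. Output: either $\lambda\le-\epsilon/2$ and a vector $v$ with $\|v\|=1$, $v^\top Hv=\lambda$;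 or a certificate that $\lambda_{\min}(H)\ge-\epsilon$, which is false with probability (at most) $\delta$. In the algorithm below, the failure probability at each call is understood conditionally on everything that happened before that call. Damped Newton-CG. Inputs: $\epsilon_g>0$, $\epsilon_H\in(0,1)$, $\theta\in(0,1)$, $\zeta\in(0,1)$, $\eta>0$, starting point $x_0$, optional upper bound $M>0$ on the Hessian norm. For $k=0,1,2,\dots$: - If $\|\nabla f(x_k)\|>\epsilon_g$: call Capped CG with $H=\nabla^2f(x_k)$, $\epsilon=\epsilon_H$, $g=\nabla f(x_k)$, accuracy $\zeta$ (and $M$ if provided) to get $d$, d_type. If d_type=NC, set $d_k=-\mathrm{sgn}(d^\top g)\frac{|d^\top\nabla^2f(x_k)d|}{\|d\|^2}\frac{d}{\|d\|}$; if d_type=SOL, set $d_k=d$. - Otherwise call the Minimum Eigenvalue Oracle with $H=\nabla^2f(x_k)$, $\epsilon=\epsilon_H$ (and $M$ if provided). If it certifies $\lambda_{\min}(\nabla^2f(x_k))\ge-\epsilon_H$, terminate; else, with $v$ its output and $g=\nabla f(x_k)$, set $d_k=-\mathrm{sgn}(v^\top g)\frac{|v^\top\nabla^2f(x_k)v|}{\|v\|^2}v$. - Line search: $\alpha_k=\theta^{j_k}$ with $j_k$ the smallest nonnegative integer such that $f(x_k+\alpha_kd_k)<f(x_k)-\frac{\eta}{6}\alpha_k^3\|d_k\|^3$; set $x_{k+1}=x_k+\alpha_kd_k$. *)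

(* Defs.v *)
(* R^n is the type of column vectors over an arbitrary realType R. *)
From HB Require Import structures.
From mathcomp Require Import all_boot all_order all_algebra.
From mathcomp Require Import all_classical all_reals all_analysis.

Set Implicit Arguments.
Unset Strict Implicit.
Unset Printing Implicit Defensive.

Import Order.TTheory GRing.Theory Num.Theory numFieldNormedType.Exports.
Local Open Scope classical_set_scope.
Local Open Scope ring_scope.

(* The library norm `|x| on 'cV[R]_n is the sup norm; it is used only through
   the topology it induces. All metric quantities use enorm and opnorm. *)
Definition dot (R : realType) (n : nat) (u v : 'cV[R]_n) : R :=
  (u^T *m v) 0 0.

Definition quad (R : realType) (n : nat) (A : 'M[R]_n) (u : 'cV[R]_n) : R :=
  (u^T *m A *m u) 0 0.

Definition enorm (R : realType) (n : nat) (u : 'cV[R]_n) : R :=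
  Num.sqrt (dot u u).

Definition opnorm (R : realType) (n : nat) (A : 'M[R]_n) : R :=
  sup [set enorm (A *m u) | u in [set u : 'cV[R]_n | enorm u <= 1]].

(* For symmetric A and 0 < n the set is finite and nonempty, so that the
   infimum is the smallest eigenvalue. *)
Definition lambda_min (R : realType) (n : nat) (A : 'M[R]_n) : R :=
  inf [set a : R | eigenvalue A a].

Definition psd (R : realType) (n : nat) (A : 'M[R]_n) : Prop :=
  forall v : 'cV[R]_n, 0 <= quad A v.

Definition grad (R : realType) (n : nat) (f : 'cV[R]_n -> R)
    (x : 'cV[R]_n) : 'cV[R]_n :=
  \col_(i < n) 'D_(delta_mx i 0 : 'cV[R]_n) f x.

Definition hess (R : realType) (n : nat) (f : 'cV[R]_n -> R)
    (x : 'cV[R]_n) : 'M[R]_n :=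
  \matrix_(i < n, j < n)
    'D_(delta_mx j 0 : 'cV[R]_n) (fun y : 'cV[R]_n => grad f y i 0) x.

(* sgn 0 = 1, unlike Num.sg *)
Definition sgn1 (R : realType) (a : R) : R := if a < 0 then -1 else 1.

Section CappedCGConstants.
Context (R : realType).
Implicit Types M eps zeta : R.

Definition kappa M eps : R := (M + 2 * eps) / eps.

Definition zeta_hat M eps zeta : R := zeta / (3 * kappa M eps).

Definition tau M eps : R :=
  Num.sqrt (kappa M eps) / (Num.sqrt (kappa M eps) + 1).

Definition capT M eps : R :=
  4 * kappa M eps ^+ 4 / (1 - Num.sqrt (tau M eps)) ^+ 2.

Definition J_cond M eps zeta (j : nat) : Prop :=
  Num.sqrt (capT M eps) * tau M eps `^ (j%:R / 2) <= zeta_hat M eps zeta.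

(* The smallest integer satisfying the condition is positive, because
   zeta_hat < 1 <= sqrt T and 0 < tau < 1; it can thus be sought in nat. *)
Definition J_cap M eps zeta : nat :=
  xget 0%N [set j | J_cond M eps zeta j /\
                    forall i, J_cond M eps zeta i -> (j <= i)%N].

End CappedCGConstants.

Section CappedCG.
Context (R : realType) (n : nat).
Implicit Types (H A : 'M[R]_n) (g u d : 'cV[R]_n).

Record cg_state := CGState {
  cg_y : 'cV[R]_n;
  cg_r : 'cV[R]_n;
  cg_p : 'cV[R]_n }.

Definition cg_step A (s : cg_state) : cg_state :=
  let alpha := dot (cg_r s) (cg_r s) / quad A (cg_p s) in
  let y := cg_y s + alpha *: cg_p s in
  let r := cg_r s + alpha *: (A *m cg_p s) in
  let beta := dot r r / dot (cg_r s) (cg_r s) in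
  CGState y r (- r + beta *: cg_p s).

Definition damped H (eps : R) : 'M[R]_n := H + (2 * eps)%:M.

Definition cg H g (eps : R) (j : nat) : cg_state :=
  iter j (cg_step (damped H eps)) (CGState 0 g (- g)).

Definition M_update H (M : R) u : R :=
  if M * enorm u < enorm (H *m u) then enorm (H *m u) / enorm u else M.

(* The value of M when the tests of iteration j are applied (for j = 0, when
   the loop is entered), starting from the value M0. *)
Fixpoint cg_M H g (eps M0 : R) (j : nat) : R :=
  if j is j'.+1 then
    let s := cg H g eps j in
    M_update H
      (M_update H (M_update H (cg_M H g eps M0 j') (cg_p s)) (cg_y s)) (cg_r s)
  else M_update H M0 (cg_p (cg H g eps 0)).

Definition neg_curv H (eps : R) u : Prop :=
  quad (damped H eps) u < eps * enorm u ^+ 2.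

Definition small_residual H g (eps zeta M0 : R) (j : nat) : Prop :=
  enorm (cg_r (cg H g eps j)) <=
    zeta_hat (cg_M H g eps M0 j) eps zeta * enorm g.

Definition slow_residual H g (eps M0 : R) (j : nat) : Prop :=
  let M := cg_M H g eps M0 j in
  Num.sqrt (capT M eps) * tau M eps `^ (j%:R / 2) * enorm g <
    enorm (cg_r (cg H g eps j)).

Definition cg_continues H g (eps zeta M0 : R) (j : nat) : Prop :=
  [/\ ~ neg_curv H eps (cg_y (cg H g eps j)),
      ~ small_residual H g eps zeta M0 j,
      ~ neg_curv H eps (cg_p (cg H g eps j)) &
      ~ slow_residual H g eps M0 j].

Definition cg_enters H g (eps : R) : Prop :=
  ~ neg_curv H eps (cg_p (cg H g eps 0)).

Definition cg_reaches H g (eps zeta M0 : R) (j : nat) : Prop :=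
  [/\ (0 < j)%N, cg_enters H g eps &
      forall i, (0 < i < j)%N -> cg_continues H g eps zeta M0 i].

(* An update never decreases M, so the value at the end of each batch of
   updates dominates the intermediate ones. *)
Definition cg_M_value H g (eps zeta M0 M : R) : Prop :=
  [\/ M = M0,
      cg_enters H g eps /\ M = cg_M H g eps M0 0 |
      exists2 j, cg_reaches H g eps zeta M0 j & M = cg_M H g eps M0 j].

Inductive cg_type := SOL | NC.

(* capped_cg H g eps zeta M0 d t h: the procedure may return d with d_type = t
   after h matrix-vector products. On return in iteration j the products of H
   with p_0, ..., p_j have been formed. In the last case [extra] counts the
   products spent on regenerating the y_i: none if they were stored, at most
   those with p_0, ..., p_(j-1) if the recurrence is re-run. *)
Inductive capped_cg H g (eps zeta M0 : R) : 'cV[R]_n -> cg_type -> nat -> Prop :=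
| capped_cg_p0 :
    neg_curv H eps (cg_p (cg H g eps 0)) ->
    capped_cg H g eps zeta M0 (cg_p (cg H g eps 0)) NC 1
| capped_cg_y j :
    cg_reaches H g eps zeta M0 j ->
    neg_curv H eps (cg_y (cg H g eps j)) ->
    capped_cg H g eps zeta M0 (cg_y (cg H g eps j)) NC j.+1
| capped_cg_sol j :
    cg_reaches H g eps zeta M0 j ->
    ~ neg_curv H eps (cg_y (cg H g eps j)) ->
    small_residual H g eps zeta M0 j ->
    capped_cg H g eps zeta M0 (cg_y (cg H g eps j)) SOL j.+1
| capped_cg_p j :
    cg_reaches H g eps zeta M0 j ->
    ~ neg_curv H eps (cg_y (cg H g eps j)) ->
    ~ small_residual H g eps zeta M0 j ->
    neg_curv H eps (cg_p (cg H g eps j)) ->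
    capped_cg H g eps zeta M0 (cg_p (cg H g eps j)) NC j.+1
| capped_cg_slow j i extra :
    cg_reaches H g eps zeta M0 j ->
    ~ neg_curv H eps (cg_y (cg H g eps j)) ->
    ~ small_residual H g eps zeta M0 j ->
    ~ neg_curv H eps (cg_p (cg H g eps j)) ->
    slow_residual H g eps M0 j ->
    (i < j)%N ->
    neg_curv H eps (cg_y (cg H g eps j.+1) - cg_y (cg H g eps i)) ->
    (extra <= j)%N ->
    capped_cg H g eps zeta M0
      (cg_y (cg H g eps j.+1) - cg_y (cg H g eps i)) NC (j.+1 + extra).

End CappedCG.

Record dncg_params (R : realType) := DNCGParams {
  par_epsg : R;
  par_epsH : R;
  par_theta : R;
  par_zeta : R;
  par_eta : R;
  par_M : option R }.

Definition start_M (R : realType) (pr : dncg_params R) : R :=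
  odflt 0 (par_M pr).

Section DampedNewtonCG.
Context (R : realType) (n : nat).
Implicit Types (pr : dncg_params R) (f : 'cV[R]_n -> R).
Implicit Types (H : 'M[R]_n) (x g d v y : 'cV[R]_n).

(* Result of the first part of an iteration: a search direction, a certificate
   of the oracle, or a call of Capped CG that never returns. *)
Inductive decision := Move of 'cV[R]_n | Certify | Hang.

(* Stuck: a call of Capped CG or a line search never returns. *)
Inductive state := Running of 'cV[R]_n | Stopped of 'cV[R]_n | Stuck.

Definition nc_direction H g d : 'cV[R]_n :=
  (- (sgn1 (dot d g) * (`|quad H d| / enorm d ^+ 2))) *: ((enorm d)^-1 *: d).

Definition eig_direction H g v : 'cV[R]_n :=
  (- (sgn1 (dot v g) * (`|quad H v| / enorm v ^+ 2))) *: v.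

Definition calls_cg pr f x : Prop := par_epsg pr < enorm (grad f x).

Definition calls_oracle pr f x : Prop := enorm (grad f x) <= par_epsg pr.

Definition cg_call pr f x : 'cV[R]_n -> cg_type -> nat -> Prop :=
  capped_cg (hess f x) (grad f x) (par_epsH pr) (par_zeta pr) (start_M pr).

(* decides pr f x c h: the first part of an iteration at x may result in c
   after h Hessian-vector products. The oracle may certify rightly or wrongly;
   a vector that it returns always has the required curvature. *)
Inductive decides pr f x : decision -> nat -> Prop :=
| decides_sol d h :
    calls_cg pr f x -> cg_call pr f x d SOL h -> decides pr f x (Move d) h
| decides_nc d h :
    calls_cg pr f x -> cg_call pr f x d NC h ->
    decides pr f x (Move (nc_direction (hess f x) (grad f x) d)) h
| decides_hang h :
    calls_cg pr f x -> (forall d t h', ~ cg_call pr f x d t h') ->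
    decides pr f x Hang h
| decides_eig v h :
    calls_oracle pr f x -> enorm v = 1 ->
    quad (hess f x) v <= - (par_epsH pr / 2) ->
    decides pr f x (Move (eig_direction (hess f x) (grad f x) v)) h
| decides_certify h :
    calls_oracle pr f x -> decides pr f x Certify h.

Definition trial pr x d (j : nat) : 'cV[R]_n := x + par_theta pr ^+ j *: d.

Definition accepts pr f x d (j : nat) : Prop :=
  f (trial pr x d j) <
    f x - par_eta pr / 6 * (par_theta pr ^+ j) ^+ 3 * enorm d ^+ 3.

(* trial j is evaluated iff all previous trials have been rejected *)
Definition is_trial pr f x d y : Prop :=
  exists2 j, (forall i, (i < j)%N -> ~ accepts pr f x d i) & y = trial pr x d j.

Inductive successor pr f x : decision -> state -> Prop :=
| successor_step d j :
    accepts pr f x d j -> (forall i, (i < j)%N -> ~ accepts pr f x d i) ->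
    successor pr f x (Move d) (Running (trial pr x d j))
| successor_nostep d :
    (forall j, ~ accepts pr f x d j) -> successor pr f x (Move d) Stuck
| successor_stop : successor pr f x Certify (Stopped x)
| successor_hang : successor pr f x Hang Stuck.

(* The history of one execution: state at the start of iteration k, decision
   and number of Hessian-vector products in iteration k (the latter two are
   meaningful only if the state is Running). *)
Record history := History {
  state_at : nat -> state;
  decision_at : nat -> decision;
  hvp_at : nat -> nat }.

Definition is_execution pr f x0 (w : history) : Prop :=
  state_at w 0 = Running x0 /\
  forall k, match state_at w k with
    | Running x => decides pr f x (decision_at w k) (hvp_at w k) /\
                   successor pr f x (decision_at w k) (state_at w k.+1)
    | s => state_at w k.+1 = s
    end.

(* Every iteration, including the last one, evaluates one gradient. *)
Definition terminates_within (B : nat) (Q : 'cV[R]_n -> Prop) (w : history) :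
    Prop :=
  exists K x, [/\ state_at w K = Stopped x,
    forall k, (k < K)%N -> exists y, state_at w k = Running y,
    (\sum_(k < K) (hvp_at w k + 1) <= B)%N & Q x].

Definition correct_point pr f x : Prop :=
  enorm (grad f x) <= par_epsg pr /\ - par_epsH pr <= lambda_min (hess f x).

Definition incorrect_point pr f x : Prop :=
  enorm (grad f x) <= par_epsg pr /\ lambda_min (hess f x) < - par_epsH pr.

Definition oracle_called pr f (w : history) (k : nat) : Prop :=
  exists2 x, state_at w k = Running x & calls_oracle pr f x.

(* The call in iteration k uses at most N products and its answer is right: a
   vector is always right, so only a certificate has to be checked. *)
Definition oracle_succeeds pr f (N : nat) (w : history) (k : nat) : Prop :=
  (hvp_at w k <= N)%N /\
  forall x, state_at w k = Running x -> decision_at w k = Certify ->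
    psd (hess f x + (par_epsH pr)%:M).

(* G k is the sigma-algebra of the events that are determined before the
   decision of iteration k; the G k form a filtration to which the random
   execution is adapted (iterates being Borel random vectors). *)
Record adapted disp (T : measurableType disp) (G : nat -> set (set T))
    (run : T -> history) : Prop := Adapted {
  adapted_sigma : forall k, sigma_algebra setT (G k);
  adapted_measurable : forall k A, G k A -> measurable A;
  adapted_mono : forall k, G k `<=` G k.+1;
  adapted_running : forall k (U : set 'cV[R]_n), open U ->
    G k [set t | exists2 x, state_at (run t) k = Running x & U x];
  adapted_stopped : forall k (U : set 'cV[R]_n), open U ->
    G k [set t | exists2 x, state_at (run t) k = Stopped x & U x];
  adapted_hvp : forall k m, G k.+1 [set t | hvp_at (run t) k = m] }.

(* Conditionally on G k, a call in iteration k succeeds with probability at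
   least 1 - delta: conditional probability given a sigma-algebra, spelled out
   on the events of that sigma-algebra. *)
Definition oracle_reliable pr f (N : nat) (delta : R) disp (T : measurableType disp)
    (P : probability T R) (G : nat -> set (set T)) (run : T -> history) : Prop :=
  forall k A, G k A -> A `<=` [set t | oracle_called pr f (run t) k] ->
    ((1 - delta)%:E * P A <=
       P (A `&` [set t | oracle_succeeds pr f N (run t) k]))%E.

End DampedNewtonCG.

Section Complexity.
Context (R : realType).

Definition c_sol (theta zeta eta LH : R) : R :=
  eta / 6 *
  Num.min
    ((4 / (Num.sqrt ((4 + zeta) ^+ 2 + 8 * LH) + 4 + zeta)) ^+ 3)
    ((3 * theta ^+ 2 * (1 - zeta) / (LH + eta)) ^+ 3).

Definition c_nc (theta eta LH : R) : R :=
  eta / 6 * Num.min 1 (27 * theta ^+ 3 / (LH + eta) ^+ 3).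

(* gap = f x0 - f_low >= 0, so that the absolute value of the ceiling is the
   ceiling itself. *)
Definition K2_bar (theta zeta eta LH gap epsg epsH : R) : nat :=
  (absz (Num.ceil (3 * gap / Num.min (c_sol theta zeta eta LH)
                                      (c_nc theta eta LH / 8)
                   * Num.max (epsg ^- 3 * epsH ^+ 3) (epsH ^- 3))%R) + 2)%N.

(* C = C_meo is nonnegative *)
Definition N_meo (n : nat) (C epsH : R) : nat :=
  minn n (1 + absz (Num.ceil (C * epsH `^ (- 2^-1))%R))%N.

Definition work_bound (n : nat)
    (theta zeta eta LH UH gap C epsg epsH : R) : nat :=
  (maxn (2 * minn n (J_cap UH epsH zeta) + 2) (N_meo n C epsH)
   * K2_bar theta zeta eta LH gap epsg epsH)%N.

(* Arguments of C: delta and eps_H. Since ln 0 = 0, for delta = 0 this bounds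
   the dependence on eps_H only. *)
Definition at_most_logarithmic (C : R -> R -> R) : Prop :=
  exists a : R, forall delta epsH : R, 0 <= delta < 1 -> 0 < epsH < 1 ->
    0 <= C delta epsH <= a * (1 + `|ln delta|) * (1 + `|ln epsH|).

(* B n epsg epsH delta = O~(h epsg epsH) for n sufficiently large: the constant
   and the power of the logarithmic factor depend neither on n nor on
   (epsg, epsH, delta), which range over the domain D; the threshold for n may
   depend on (epsg, epsH, delta). *)
Definition soft_O_large_n (D : R -> R -> R -> Prop)
    (B : nat -> R -> R -> R -> nat) (h : R -> R -> R) : Prop :=
  exists (C : R) (p : nat), forall epsg epsH delta, D epsg epsH delta ->
    exists n0, forall n, (n0 <= n)%N ->
      (B n epsg epsH delta)%:R <=
        C * (1 + `|ln epsg| + `|ln epsH| + `|ln delta|) ^+ p * h epsg epsH.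

End Complexity.

(* Main.v *)
Require Import Defs.
From HB Require Import structures.
From mathcomp Require Import all_boot all_order all_algebra.
From mathcomp Require Import all_classical all_reals all_analysis.
From mathcomp Require Import ring lra zify.

Set Implicit Arguments.
Unset Strict Implicit.
Unset Printing Implicit Defensive.

Import Order.TTheory GRing.Theory Num.Theory numFieldNormedType.Exports.
Local Open Scope classical_set_scope.
Local Open Scope ring_scope.

(** Why the theorem holds.

    Capped CG.  As long as no test stops it, the iterates are those of
    conjugate gradients for the damped matrix A = H + 2 eps, with nonzero
    orthogonal residuals, so that at most n iterations are possible.  At
    iteration J (UH, eps, zeta) the thresholds of the two tests on the residual
    have crossed, since J is monotone in M, so that J bounds the number of
    iterations as well (cg_reaches_le_J).  The only way in which the procedure
    could get stuck is the last test, when no index i with small curvature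
    exists.  In this case the quadratic model is strongly convex from each y i
    towards z = y (j+1), and an estimate-sequence argument as in accelerated
    gradient methods shows that the residual has decreased geometrically,
    contrary to the test (cg_residual_decrease, slow_residual_index).

    Decrease in one iteration.  The Hessian is Lipschitz only on N, which need
    not contain the segment to a trial point.  However, as long as the cubic
    Taylor model predicts no increase, the segment cannot leave the level set,
    hence not N either (segment_stays, model_upper_bound).  A rejected trial
    therefore has a long step length.  Steps along directions of negative
    curvature decrease f by at least c_nc times the cube of the curvature.  Steps
    with d_type SOL decrease f by at least
    c_sol * min (epsg / epsH, epsH) ^ 3, unless the gradient at the new point
    is small (sol_decrease); this exception is followed by a call of the oracle,
    which stops or decreases f.  At least every other iteration thus achieves a
    full decrease.  If there have been q of them, at most 2 q + 2 iterations are
    performed, whereas K2 >= 3 q + 2; the difference also pays for the gradients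
    evaluated in the iterations that call the oracle (execution_terminates).

    Probability.  An execution in which the first K2 calls of the oracle succeed
    ends at a correct point.  The success of call k is an event of G (k+1): a
    wrong certificate shows up as a stop at a point of the set where hess f + epsH
    is not positive semidefinite, and this set is open in N.  Iterating the
    bound on the conditional probability of success yields (1 - delta) ^ K2
    (successes_probability).  That positive semidefiniteness expresses the
    condition on the smallest eigenvalue requires symmetry of the Hessian, which
    follows from its continuity (hess_sym, lambda_min_psd).

    Asymptotics.  As kappa is of order 1 / epsH, J is of order
    sqrt kappa * ln kappa, that is epsH ^ (-1/2) up to a logarithm, as is the
    cost of the oracle; K2 is of order
    max (epsg ^ -3 * epsH ^ 3, epsH ^ -3) (work_bound_soft_O). *)

(** * Euclidean geometry of column vectors *)

Section Euclid.
Context (R : realType).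
Implicit Types (n : nat).

Lemma dotE n (u v : 'cV[R]_n) : dot u v = \sum_i u i 0 * v i 0.
Proof. by rewrite /dot !mxE; apply: eq_bigr => i _; rewrite !mxE. Qed.

Lemma dotC n (u v : 'cV[R]_n) : dot u v = dot v u.
Proof. by rewrite !dotE; apply: eq_bigr => i _; rewrite mulrC. Qed.

Lemma dotDr n (u v w : 'cV[R]_n) : dot u (v + w) = dot u v + dot u w.
Proof. by rewrite /dot mulmxDr mxE. Qed.

Lemma dotDl n (u v w : 'cV[R]_n) : dot (v + w) u = dot v u + dot w u.
Proof. by rewrite dotC dotDr !(dotC u). Qed.

Lemma dotZr n a (u v : 'cV[R]_n) : dot u (a *: v) = a * dot u v.
Proof. by rewrite /dot -scalemxAr mxE. Qed.

Lemma dotZl n a (u v : 'cV[R]_n) : dot (a *: u) v = a * dot u v.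
Proof. by rewrite dotC dotZr dotC. Qed.

Lemma dotNr n (u v : 'cV[R]_n) : dot u (- v) = - dot u v.
Proof. by rewrite -scaleN1r dotZr mulN1r. Qed.

Lemma dotNl n (u v : 'cV[R]_n) : dot (- u) v = - dot u v.
Proof. by rewrite dotC dotNr dotC. Qed.

Lemma dot0r n (u : 'cV[R]_n) : dot u 0 = 0.
Proof. by rewrite /dot mulmx0 mxE. Qed.

Lemma dot0l n (u : 'cV[R]_n) : dot 0 u = 0.
Proof. by rewrite dotC dot0r. Qed.

Definition dot_lin := (dotDr, dotDl, dotNr, dotNl, dotZr, dotZl).

Lemma dot_ge0 n (u : 'cV[R]_n) : 0 <= dot u u.
Proof. by rewrite dotE sumr_ge0 // => i _; rewrite -expr2 sqr_ge0. Qed.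

Lemma dot_eq0 n (u : 'cV[R]_n) : (dot u u == 0) = (u == 0).
Proof.
apply/eqP/eqP => [|->]; last exact: dot0r.
rewrite dotE => /eqP; rewrite psumr_eq0; last by move=> i _; rewrite -expr2 sqr_ge0.
move=> /allP h; apply/colP => i; rewrite mxE.
by have := h i (mem_index_enum i); rewrite /= mulf_eq0 orbb => /eqP.
Qed.

Lemma dot_gt0 n (u : 'cV[R]_n) : (0 < dot u u) = (u != 0).
Proof. by rewrite lt_def dot_eq0 dot_ge0 andbT. Qed.

Lemma dot_delta n (u : 'cV[R]_n) i : dot (delta_mx i 0) u = u i 0.
Proof.
rewrite dotE (bigD1 i) //= big1 ?addr0 ?mxE ?eqxx ?mul1r // => j ji.
by rewrite mxE (negbTE ji) mul0r.
Qed.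

Lemma dot_mulmxT n (A : 'M[R]_n) (u v : 'cV[R]_n) :
  dot u (A *m v) = dot (A^T *m u) v.
Proof. by rewrite /dot trmx_mul trmxK mulmxA. Qed.

Lemma dot_sym n (A : 'M[R]_n) (u v : 'cV[R]_n) :
  A^T = A -> dot u (A *m v) = dot v (A *m u).
Proof. by move=> hA; rewrite dot_mulmxT hA dotC. Qed.

Lemma quadE n (A : 'M[R]_n) (u : 'cV[R]_n) : quad A u = dot u (A *m u).
Proof. by rewrite /quad /dot mulmxA. Qed.

Lemma quadZ n (A : 'M[R]_n) a (u : 'cV[R]_n) : quad A (a *: u) = a ^+ 2 * quad A u.
Proof. by rewrite !quadE -scalemxAr !dot_lin mulrA expr2. Qed.

Lemma quad_addM n (A B : 'M[R]_n) (u : 'cV[R]_n) :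
  quad (A + B) u = quad A u + quad B u.
Proof. by rewrite !quadE mulmxDl dotDr. Qed.

Lemma quad_subM n (A B : 'M[R]_n) (u : 'cV[R]_n) :
  quad (A - B) u = quad A u - quad B u.
Proof. by rewrite !quadE mulmxBl dotDr dotNr. Qed.

Lemma quad_scalar n a (u : 'cV[R]_n) : quad a%:M u = a * dot u u.
Proof. by rewrite quadE mul_scalar_mx dotZr. Qed.

Lemma enorm_sqr n (u : 'cV[R]_n) : enorm u ^+ 2 = dot u u.
Proof. by rewrite /enorm sqr_sqrtr ?dot_ge0. Qed.

Lemma enorm_ge0 n (u : 'cV[R]_n) : 0 <= enorm u.
Proof. exact: sqrtr_ge0. Qed.
Hint Resolve enorm_ge0 : core.

Lemma enorm_eq0 n (u : 'cV[R]_n) : (enorm u == 0) = (u == 0).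
Proof. by rewrite -dot_eq0 -enorm_sqr expf_eq0. Qed.

Lemma enorm_gt0 n (u : 'cV[R]_n) : (0 < enorm u) = (u != 0).
Proof. by rewrite lt_def enorm_eq0 enorm_ge0 andbT. Qed.

Lemma enorm0 n : enorm (0 : 'cV[R]_n) = 0.
Proof. by apply/eqP; rewrite enorm_eq0. Qed.

Lemma enormZ n a (u : 'cV[R]_n) : enorm (a *: u) = `|a| * enorm u.
Proof. by rewrite /enorm !dot_lin mulrA -expr2 sqrtrM ?sqr_ge0 // sqrtr_sqr. Qed.

Lemma enormN n (u : 'cV[R]_n) : enorm (- u) = enorm u.
Proof. by rewrite /enorm dotNl dotNr opprK. Qed.

Lemma enorm_le n (u : 'cV[R]_n) c : 0 <= c -> dot u u <= c ^+ 2 -> enorm u <= c.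
Proof. by move=> c0; rewrite -enorm_sqr ler_sqr ?nnegrE. Qed.

Lemma dot_le_enorm n (u v : 'cV[R]_n) : dot u v <= enorm u * enorm v.
Proof.
have [->|u0] := eqVneq u 0; first by rewrite dot0l enorm0 mul0r.
have [->|v0] := eqVneq v 0; first by rewrite dot0r enorm0 mulr0.
have a0 : 0 < enorm u by rewrite enorm_gt0.
have b0 : 0 < enorm v by rewrite enorm_gt0.
have := dot_ge0 ((enorm u)^-1 *: u - (enorm v)^-1 *: v).
rewrite !dot_lin (dotC v u) -!enorm_sqr.
set x := enorm u in a0 *; set y := enorm v in b0 *; set D := dot u v.
have -> : x^-1 * (x^-1 * x ^+ 2) + - (x^-1 * (y^-1 * D)) +
  (- (y^-1 * (x^-1 * D)) - - (y^-1 * (y^-1 * y ^+ 2))) = 2 - 2 * (D / (x * y)).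
  by field; rewrite !gt_eqF.
by move=> h; rewrite -[leRHS]mul1r -ler_pdivrMr ?mulr_gt0 //; lra.
Qed.

Lemma dot_abs_le n (u v : 'cV[R]_n) : `|dot u v| <= enorm u * enorm v.
Proof.
by rewrite ler_norml dot_le_enorm andbT lerNl -dotNl -(enormN u) dot_le_enorm.
Qed.

Lemma enormD n (u v : 'cV[R]_n) : enorm (u + v) <= enorm u + enorm v.
Proof.
apply: enorm_le; first by rewrite addr_ge0.
rewrite !dot_lin (dotC v u) sqrrD !enorm_sqr.
have := dot_le_enorm u v; lra.
Qed.

Lemma enorm_mulmx_bounded n (A : 'M[R]_n) :
  exists2 c, 0 <= c & forall u, enorm (A *m u) <= c * enorm u.
Proof.
exists (Num.sqrt (\sum_i enorm (row i A)^T ^+ 2)); first exact: sqrtr_ge0.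
move=> u; apply: enorm_le; first by rewrite mulr_ge0 ?sqrtr_ge0.
rewrite exprMn sqr_sqrtr; last by apply: sumr_ge0 => i _; rewrite sqr_ge0.
rewrite dotE mulr_suml; apply: ler_sum => i _.
have -> : (A *m u) i 0 = dot (row i A)^T u.
  by rewrite dotE !mxE; apply: eq_bigr => j _; rewrite !mxE.
rewrite -expr2 -exprMn -real_normK ?num_real // ler_pXn2r ?nnegrE ?mulr_ge0 //.
exact: dot_abs_le.
Qed.

Lemma opnorm_ub n (A : 'M[R]_n) (u : 'cV[R]_n) :
  enorm (A *m u) <= opnorm A * enorm u.
Proof.
have [->|u0] := eqVneq u 0; first by rewrite mulmx0 enorm0 mulr0.
have a0 : 0 < enorm u by rewrite enorm_gt0.
rewrite -ler_pdivrMr //.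
have [c c0 hc] := enorm_mulmx_bounded A.
apply: ub_le_sup.
  exists c => _ [v /= v1 <-]; apply: (le_trans (hc v)).
  by rewrite -[leRHS]mulr1 ler_wpM2l.
exists ((enorm u)^-1 *: u) => /=.
  by rewrite enormZ gtr0_norm ?invr_gt0 // mulVf ?gt_eqF.
by rewrite -scalemxAr enormZ gtr0_norm ?invr_gt0 // mulrC.
Qed.

Lemma opnorm_ge0 n (A : 'M[R]_n) : (0 < n)%N -> 0 <= opnorm A.
Proof.
case: n A => // n A _.
have := opnorm_ub A (delta_mx ord0 0).
have a0 : 0 < enorm (delta_mx ord0 0 : 'cV[R]_n.+1).
  rewrite enorm_gt0; apply/eqP => /matrixP /(_ ord0 0).
  by rewrite !mxE !eqxx /= => /eqP; rewrite oner_eq0.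
by move=> h; rewrite -(pmulr_lge0 _ a0) (le_trans _ h).
Qed.

End Euclid.
#[global] Hint Resolve enorm_ge0 : core.

(** * Conjugate gradients *)

Section ConjugateGradients.
Context (R : realType) (n : nat) (A : 'M[R]_n) (g : 'cV[R]_n).
Context (y r p : nat -> 'cV[R]_n).

(** Stated for abstract sequences, so that the iteration is never unfolded. *)
Definition cg_recurrence :=
  [/\ y 0%N = 0, r 0%N = g, p 0%N = - g &
      forall j, let alpha := dot (r j) (r j) / quad A (p j) in
        [/\ y j.+1 = y j + alpha *: p j, r j.+1 = r j + alpha *: (A *m p j) &
            p j.+1 = - r j.+1 + (dot (r j.+1) (r j.+1) / dot (r j) (r j)) *: p j]].

Hypotheses (Asym : A^T = A) (rec : cg_recurrence).

Let alpha j := dot (r j) (r j) / quad A (p j).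
Let beta j := dot (r j.+1) (r j.+1) / dot (r j) (r j).

Let y0 : y 0%N = 0. Proof. by case: rec. Qed.
Let r0 : r 0%N = g. Proof. by case: rec. Qed.
Let p0 : p 0%N = - g. Proof. by case: rec. Qed.
Let yS j : y j.+1 = y j + alpha j *: p j. Proof. by case: rec => _ _ _ /(_ j)[]. Qed.
Let rS j : r j.+1 = r j + alpha j *: (A *m p j).
Proof. by case: rec => _ _ _ /(_ j)[]. Qed.
Let pS j : p j.+1 = - r j.+1 + beta j *: p j.
Proof. by case: rec => _ _ _ /(_ j)[]. Qed.

Lemma cg_residualE j : r j = A *m y j + g.
Proof.
elim: j => [|j IH]; first by rewrite r0 y0 mulmx0 add0r.
by rewrite rS yS IH mulmxDr -scalemxAr addrAC.
Qed.

(** Nonzero residuals and positive curvatures make all step lengths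
    well defined. *)
Definition cg_regular m :=
  forall i, (i < m)%N -> r i != 0 /\ 0 < quad A (p i).

(** The step length makes the new residual orthogonal to p j; as A p i is a
    multiple of r i.+1 - r i, orthogonality of the residuals in turn gives
    conjugacy of the directions. *)
Lemma cg_conjugate m : cg_regular m -> forall j, (j <= m)%N ->
  [/\ forall i, (i < j)%N -> dot (p i) (r j) = 0,
      forall i, (i < j)%N -> dot (r i) (r j) = 0,
      forall i, (i < j)%N -> dot (p i) (A *m p j) = 0 &
      dot (p j) (r j) = - dot (r j) (r j)].
Proof.
move=> reg; elim=> [_|j IH jm].
  by split=> //; rewrite p0 r0 dotNl.
have {IH}[IHpr IHrr IHpp IHj] := IH (ltnW jm).
have [rj0 pj0] := reg j jm.
have rr0 : 0 < dot (r j) (r j) by rewrite dot_gt0.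
have aj0 : alpha j != 0 by rewrite /alpha mulf_neq0 ?invr_eq0 ?gt_eqF.
have pr i : (i < j.+1)%N -> dot (p i) (r j.+1) = 0.
  rewrite ltnS leq_eqVlt => /orP[/eqP ->|ij].
    by rewrite rS dotDr dotZr -quadE IHj /alpha divfK ?gt_eqF // addNr.
  by rewrite rS dotDr dotZr IHpr // IHpp // mulr0 addr0.
have rr i : (i < j.+1)%N -> dot (r i) (r j.+1) = 0.
  case: i => [|i] ij.
    have -> : r 0%N = - p 0%N by rewrite r0 p0 opprK.
    by rewrite dotNl pr // oppr0.
  have -> : r i.+1 = beta i *: p i - p i.+1 by rewrite pS opprD opprK addrCA subrr addr0.
  by rewrite dotDl dotNl dotZl !pr ?mulr0 ?subr0 // ltnW.
have Apr i : alpha i * dot (p i) (A *m r j.+1) = dot (r i.+1) (r j.+1) - dot (r i) (r j.+1).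
  by rewrite dot_sym ?Asym // dotC (rS i) dotDl dotZl addrAC subrr add0r.
have pp i : (i < j.+1)%N -> dot (p i) (A *m p j.+1) = 0.
  rewrite pS mulmxDr mulmxN -scalemxAr dotDr dotNr dotZr.
  rewrite ltnS leq_eqVlt => /orP[/eqP ->|ij].
    apply/eqP; rewrite addrC subr_eq0; apply/eqP.
    apply: (mulfI aj0); rewrite Apr (rr j) // subr0 -quadE /alpha /beta.
    by field; rewrite !gt_eqF.
  have ai0 : alpha i != 0.
    have [ri0 pi0] := reg i (ltn_trans ij jm).
    by rewrite /alpha mulf_neq0 ?invr_eq0 ?gt_eqF // dot_gt0.
  rewrite (IHpp i ij) mulr0 addr0; apply/eqP; rewrite oppr_eq0; apply/eqP.
  by apply: (mulfI ai0); rewrite Apr !rr ?subrr ?mulr0 // ltnW.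
split=> //.
by rewrite pS dotDl dotZl dotNl pr // mulr0 addr0.
Qed.

Lemma cg_iterate_residual m : cg_regular m -> forall i j, (i <= j)%N -> (j <= m)%N ->
  dot (y i) (r j) = 0.
Proof.
move=> reg; elim=> [|i IH] j ij jm; first by rewrite y0 dot0l.
rewrite yS dotDl dotZl IH ?(ltnW ij) //.
by have [pr _ _ _] := cg_conjugate reg jm; rewrite pr // mulr0 addr0.
Qed.

(** The residual is the sum of - p j and a multiple of the previous direction,
    which is conjugate to p j and only adds curvature. *)
Lemma cg_direction_curvature m : cg_regular m -> forall j, (j <= m)%N ->
  quad A (p j) <= quad A (r j).
Proof.
move=> reg [|j] jm.
  by rewrite p0 r0 !quadE mulmxN !dot_lin opprK.
have [_ _ pp _] := cg_conjugate reg jm.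
have -> : r j.+1 = beta j *: p j - p j.+1 by rewrite pS opprD opprK addrCA subrr addr0.
have [_ pj] := reg j jm.
rewrite [leRHS]quadE mulmxDr mulmxN -scalemxAr !dot_lin.
rewrite (dot_sym (p j.+1) (p j)) ?Asym // pp // -!quadE.
have : 0 <= beta j * (beta j * quad A (p j)).
  by rewrite mulrA -expr2 mulr_ge0 ?sqr_ge0 // ltW.
lra.
Qed.

(** The quadratic model that the iterates minimize over growing subspaces. *)
Definition cg_model (z : 'cV[R]_n) := quad A z / 2 + dot g z.

Let q := cg_model.

Lemma cg_model_expand j z :
  q z = q (y j) + dot (r j) (z - y j) + quad A (z - y j) / 2.
Proof.
suff shift w e : q (w + e) = q w + dot (A *m w + g) e + quad A e / 2.
  by rewrite cg_residualE -shift addrCA subrr addr0.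
rewrite /q /cg_model !quadE mulmxDr !dot_lin (dot_sym e w) //.
by rewrite (dotC (A *m w)) [dot e (A *m w)]dot_sym //; lra.
Qed.

Lemma cg_model_decrease m : cg_regular m -> forall j, (j < m)%N ->
  q (y j) - q (y j.+1) = dot (r j) (r j) ^+ 2 / quad A (p j) / 2.
Proof.
move=> reg j jm; have [_ _ _ pr] := cg_conjugate reg (ltnW jm).
have [_ pj] := reg j jm.
rewrite (cg_model_expand j (y j.+1)) yS.
have -> : y j + alpha j *: p j - y j = alpha j *: p j by rewrite addrAC subrr add0r.
rewrite dotZr quadZ dotC pr /alpha; field.
by rewrite gt_eqF.
Qed.

(** The estimate-sequence argument: if the model is strongly convex in the
    direction of z from each of the first iterates, the lower quadratic models
    of these iterates can be averaged into one whose minimum dominates q (y i)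
    and whose value at z exceeds q z by at most a geometrically decreasing
    amount. This model has minimum c and minimizer v. Conjugacy makes v
    orthogonal to all later residuals, so that the cross terms of the general
    theory vanish. *)
Lemma cg_estimate_sequence m (eps K th : R) z :
  cg_regular m -> 0 < eps -> 0 < th < 1 -> K * th ^+ 2 <= 1 -> 0 < K ->
  (forall i, (i < m)%N -> quad A (r i) <= K * eps * dot (r i) (r i)) ->
  (forall i, (i < m)%N -> eps * dot (z - y i) (z - y i) <= quad A (z - y i)) ->
  forall i, (i <= m)%N -> exists v c,
    [/\ c + eps / 2 * dot (z - v) (z - v) <=
          q z + (1 - th) ^+ i * (q 0 - q z + eps / 2 * dot z z),
        q (y i) <= c &
        forall k, (i <= k)%N -> (k <= m)%N -> dot v (r k) = 0].
Proof.
move=> reg e0 /andP[th0 th1] Kth K0 hK hz.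
elim=> [_|i IH im].
  exists 0, (q 0); split=> [||k _ _]; last by rewrite dot0l.
    by rewrite subr0 expr0 mul1r; lra.
  by rewrite y0.
have {IH}[v [c [hv hc ho]]] := IH (ltnW im).
have [_ rr _ _] := cg_conjugate reg (ltnW im).
have yr := cg_iterate_residual reg.
exists ((1 - th) *: v + th *: y i - (th / eps) *: r i).
exists ((1 - th) * c + th * q (y i) - th ^+ 2 / (2 * eps) * dot (r i) (r i) +
  th * (1 - th) * (eps / 2) * dot (v - y i) (v - y i)).
split.
- have hzi := hz i im; have hq := cg_model_expand i z.
  rewrite [(1 - th) ^+ i.+1]exprS.
  set X := _ ^+ i * _ in hv *.
  have hX : (1 - th) * (c + eps / 2 * dot (z - v) (z - v)) <= (1 - th) * (q z + X).
    by rewrite ler_wpM2l // subr_ge0 ltW.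
  have hY : th * (q (y i) + dot (r i) (z - y i) + eps / 2 * dot (z - y i) (z - y i)) <= th * q z.
    by rewrite (ler_wpM2l (ltW th0)) //; lra.
  have -> : (1 - th) * (1 - th) ^+ i * (q 0 - q z + eps / 2 * dot z z) = (1 - th) * X.
    by rewrite /X mulrA.
  apply: le_trans (_ : (1 - th) * (q z + X) + th * q z <= _); last by lra.
  apply: le_trans (lerD hX hY).
  have vr := ho i (leqnn _) (ltnW im); have yri := yr i i (leqnn _) (ltnW im).
  rewrite !dot_lin ?(dotC (r i) v, dotC (r i) (y i), vr, yri).
  rewrite ?(dotC v z, dotC (y i) z, dotC (y i) v, dotC (r i) z).
  rewrite le_eqVlt; apply/orP; left; apply/eqP; field.
  by rewrite gt_eqF.
- have hd := cg_model_decrease reg im.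
  have [ri0 pi0] := reg i im.
  have hp := cg_direction_curvature reg (ltnW im).
  have hr := hK i im.
  have rr0 : 0 < dot (r i) (r i) by rewrite dot_gt0.
  have h1 : th ^+ 2 / (2 * eps) * dot (r i) (r i) <= q (y i) - q (y i.+1).
    rewrite hd; apply: le_trans (_ : dot (r i) (r i) / (K * eps) / 2 <= _).
      have -> : dot (r i) (r i) / (K * eps) / 2 = K^-1 / (2 * eps) * dot (r i) (r i).
        by field; rewrite !gt_eqF.
      rewrite ler_pM2r // ler_pM2r ?invr_gt0 ?mulr_gt0 //.
      by rewrite -[leRHS]mul1r ler_pdivlMr // mulrC.
    rewrite ler_pM2r ?invr_gt0 // expr2 -mulrA ler_pM2l //.
    rewrite ler_pdivlMr // mulrC ler_pdivrMr ?mulr_gt0 // mulrC.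
    exact: le_trans hp hr.
  have h2 : 0 <= th * (1 - th) * (eps / 2) * dot (v - y i) (v - y i).
    by rewrite !mulr_ge0 ?dot_ge0 ?subr_ge0 // ltW.
  have h3 : (1 - th) * q (y i) <= (1 - th) * c.
    by rewrite ler_wpM2l // subr_ge0 ltW.
  lra.
- move=> k ik km; have [_ rrk _ _] := cg_conjugate reg km.
  rewrite !dot_lin ho ?(ltnW ik) // yr ?(ltnW ik) // rrk //.
  lra.
Qed.

(** The gap q (y j) - q (y j.+1) is at least dot (r j) (r j) / (2 K eps), and the
    estimate sequence shows that it has decreased geometrically; strong
    convexity between y 0 = 0 and y j.+1 bounds the initial gap by
    dot g g / eps. *)
Lemma cg_residual_decrease j (eps K th : R) :
  cg_regular j.+1 -> (0 < j)%N -> 0 < eps -> 0 < th < 1 -> K * th ^+ 2 <= 1 -> 0 < K ->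
  (forall i, (i <= j)%N -> quad A (r i) <= K * eps * dot (r i) (r i)) ->
  (forall i, (i < j)%N ->
    eps * dot (y j.+1 - y i) (y j.+1 - y i) <= quad A (y j.+1 - y i)) ->
  dot (r j) (r j) <= 2 * K * (1 - th) ^+ j * dot g g.
Proof.
move=> reg j0 e0 th01 Kth K0 hK; set z := y j.+1 => hz.
have regj : cg_regular j by move=> i ij; apply: reg; rewrite ltnW.
have [v [c [hv hc _]]] := cg_estimate_sequence regj e0 th01 Kth K0
  (fun i ij => hK i (ltnW ij)) hz (leqnn j).
have hd := cg_model_decrease reg (ltnSn j).
have [rj0 pj0] := reg j (ltnSn j).
have rr0 : 0 < dot (r j) (r j) by rewrite dot_gt0.
have hp := cg_direction_curvature reg (leqnSn j).
have hr := hK j (leqnn j).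
have h1 : dot (r j) (r j) / (K * eps) / 2 <= q (y j) - q z.
  rewrite hd ler_pM2r ?invr_gt0 // expr2 -mulrA ler_pM2l //.
  rewrite ler_pdivlMr // mulrC ler_pdivrMr ?mulr_gt0 // mulrC.
  exact: le_trans hp hr.
have hzA : quad A z = - dot g z.
  have := cg_iterate_residual reg (leqnn j.+1) (leqnn _).
  rewrite -/z cg_residualE -/z dotDr -quadE (dotC z); lra.
have hz0 : eps * dot z z <= quad A z by have := hz 0%N j0; rewrite y0 subr0.
have hq0 : q 0 - q z = quad A z / 2.
  by rewrite /q /cg_model hzA dot0r quadE mulmx0 dot0r; lra.
have zz0 := dot_ge0 z.
have hzg : quad A z <= dot g g / eps.
  rewrite ler_pdivlMr //.
  have := dot_ge0 (g + eps *: z).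
  rewrite !dot_lin (dotC z g).
  have -> : dot g z = - quad A z by rewrite hzA opprK.
  have : eps * (eps * dot z z) <= eps * quad A z by rewrite ler_pM2l.
  lra.
have th1 : 0 <= (1 - th) ^+ j by rewrite exprn_ge0 // subr_ge0 ltW //; case/andP: th01.
have h2 : dot (r j) (r j) / (K * eps) / 2 <= (1 - th) ^+ j * (dot g g / eps).
  apply: le_trans h1 _.
  apply: le_trans (_ : (1 - th) ^+ j * (q 0 - q z + eps / 2 * dot z z) <= _).
    have := dot_ge0 (z - v).
    have : 0 <= eps / 2 by rewrite divr_ge0 // ltW.
    move=> e2 zv; have := mulr_ge0 e2 zv; lra.
  by rewrite ler_wpM2l // hq0; lra.
have : dot (r j) (r j) / (K * eps) / 2 * (2 * K * eps) <=
   (1 - th) ^+ j * (dot g g / eps) * (2 * K * eps).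
  by rewrite ler_pM2r // !mulr_gt0.
have -> : dot (r j) (r j) / (K * eps) / 2 * (2 * K * eps) = dot (r j) (r j).
  by field; rewrite !gt_eqF.
have -> // : (1 - th) ^+ j * (dot g g / eps) * (2 * K * eps) = 2 * K * (1 - th) ^+ j * dot g g.
by field; rewrite gt_eqF.
Qed.

End ConjugateGradients.

(** Nonzero pairwise orthogonal vectors are the rows of a matrix with
    invertible Gram matrix. *)
Lemma orthogonal_size (R : realType) (n m : nat) (v : nat -> 'cV[R]_n) :
  (forall i, (i < m)%N -> v i != 0) ->
  (forall i j, (i < j)%N -> (j < m)%N -> dot (v i) (v j) = 0) -> (m <= n)%N.
Proof.
move=> v0 vo.
pose B : 'M[R]_(m, n) := \matrix_(i, j) v i j 0.
have BB : B *m B^T = diag_mx (\row_i dot (v i) (v i)).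
  apply/matrixP => i j; rewrite !mxE.
  have -> : \sum_k B i k * B^T k j = dot (v i) (v j).
    by rewrite dotE; apply: eq_bigr => k _; rewrite !mxE.
  have [->|ij] := eqVneq i j; first by rewrite mulr1n.
  rewrite mulr0n; case: (ltngtP i j) => // [h|h|/val_inj h].
  - by rewrite vo.
  - by rewrite dotC vo.
  - by rewrite h eqxx in ij.
have : \rank (B *m B^T) = m.
  apply: mxrank_unit; rewrite BB unitmxE det_diag unitfE.
  by apply/prodf_neq0 => i _; rewrite mxE dot_eq0 v0.
by move=> <-; rewrite (leq_trans (mxrankM_maxl _ _)) // rank_leq_col.
Qed.

(** * The constants of Capped CG *)

Section Constants.
Context (R : realType).
Implicit Types (M eps zeta : R).

Lemma kappaM M eps : 0 < eps -> kappa M eps * eps = M + 2 * eps.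
Proof. by move=> e0; rewrite /kappa divfK ?gt_eqF. Qed.

Lemma kappa_ge2 M eps : 0 < eps -> 0 <= M -> 2 <= kappa M eps.
Proof. by move=> e0 M0; rewrite /kappa ler_pdivlMr //; lra. Qed.

Lemma kappa_mono M M' eps : 0 < eps -> M <= M' -> kappa M eps <= kappa M' eps.
Proof. by move=> e0 MM; rewrite /kappa ler_pM2r ?invr_gt0 //; lra. Qed.

Lemma sqrt_kappa_gt0 M eps : 0 < eps -> 0 <= M -> 0 < Num.sqrt (kappa M eps).
Proof. by move=> e0 M0; rewrite sqrtr_gt0 (lt_le_trans _ (kappa_ge2 e0 M0)). Qed.

Lemma one_sub_tau M eps : 0 < eps -> 0 <= M ->
  1 - tau M eps = (Num.sqrt (kappa M eps) + 1)^-1.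
Proof.
move=> e0 M0; have s0 := sqrt_kappa_gt0 e0 M0; rewrite /tau.
by field; rewrite gt_eqF // addr_gt0.
Qed.

Lemma tau_gt0 M eps : 0 < eps -> 0 <= M -> 0 < tau M eps.
Proof.
by move=> e0 M0; have s0 := sqrt_kappa_gt0 e0 M0; rewrite divr_gt0 // addr_gt0.
Qed.

Lemma tau_lt1 M eps : 0 < eps -> 0 <= M -> tau M eps < 1.
Proof.
move=> e0 M0; have s0 := sqrt_kappa_gt0 e0 M0.
by rewrite -subr_gt0 one_sub_tau // invr_gt0 addr_gt0.
Qed.

Lemma tau_mono M M' eps : 0 < eps -> 0 <= M -> M <= M' -> tau M eps <= tau M' eps.
Proof.
move=> e0 M0 MM; have M'0 := le_trans M0 MM.
have s0 := sqrt_kappa_gt0 e0 M0; have s0' := sqrt_kappa_gt0 e0 M'0.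
rewrite -lerN2 -(lerD2l 1) !one_sub_tau // lef_pV2 ?posrE ?addr_gt0 // lerD2r.
by rewrite ler_wsqrtr // kappa_mono.
Qed.

Lemma sqrt_tau_lt1 M eps : 0 < eps -> 0 <= M -> 0 < 1 - Num.sqrt (tau M eps).
Proof.
move=> e0 M0; rewrite subr_gt0 -[ltRHS](@sqrtr1 R) ltr_sqrt //.
exact: tau_lt1.
Qed.

Lemma capT_gt0 M eps : 0 < eps -> 0 <= M -> 0 < capT M eps.
Proof.
move=> e0 M0; have k2 := kappa_ge2 e0 M0.
have k0 : 0 < kappa M eps by exact: lt_le_trans k2.
apply: divr_gt0; last by apply: exprn_gt0; exact: sqrt_tau_lt1.
by apply: mulr_gt0 => //; exact: exprn_gt0.
Qed.

Lemma capT_ge_kappa M eps : 0 < eps -> 0 <= M -> 2 * kappa M eps <= capT M eps.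
Proof.
move=> e0 M0; have k2 := kappa_ge2 e0 M0; have s0 := sqrt_tau_lt1 e0 M0.
have s1 : 1 - Num.sqrt (tau M eps) <= 1 by rewrite gerBl sqrtr_ge0.
apply: (@le_trans _ _ (4 * kappa M eps ^+ 4)).
  have : kappa M eps <= kappa M eps ^+ 4 by rewrite ler_eXnr //; lra.
  lra.
rewrite /capT ler_peMr //; first by rewrite mulr_ge0 // exprn_even_ge0.
by rewrite invf_ge1 ?exprn_gt0 // expr_le1 // ltW.
Qed.

Lemma capT_mono M M' eps : 0 < eps -> 0 <= M -> M <= M' -> capT M eps <= capT M' eps.
Proof.
move=> e0 M0 MM; have M'0 := le_trans M0 MM.
have k2 := kappa_ge2 e0 M0; have k2' := kappa_ge2 e0 M'0.
have s0 := sqrt_tau_lt1 e0 M0; have s0' := sqrt_tau_lt1 e0 M'0.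
have kk := kappa_mono e0 MM.
rewrite /capT; apply: ler_pM.
- by rewrite mulr_ge0 // exprn_even_ge0.
- by rewrite invr_ge0 exprn_ge0 // ltW.
- by rewrite ler_pM2l // lerXn2r // nnegrE; lra.
- rewrite lef_pV2 ?posrE ?exprn_gt0 // lerXn2r ?nnegrE ?(ltW s0) ?(ltW s0') //.
  by rewrite lerD2l lerN2 ler_wsqrtr // tau_mono.
Qed.

Lemma zeta_hat_gt0 M eps zeta : 0 < eps -> 0 <= M -> 0 < zeta -> 0 < zeta_hat M eps zeta.
Proof.
move=> e0 M0 z0; have k2 := kappa_ge2 e0 M0.
by rewrite divr_gt0 // mulr_gt0 //; lra.
Qed.

Lemma zeta_hat_mono M M' eps zeta : 0 < eps -> 0 <= M -> M <= M' -> 0 < zeta ->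
  zeta_hat M' eps zeta <= zeta_hat M eps zeta.
Proof.
move=> e0 M0 MM z0; have M'0 := le_trans M0 MM.
have k2 := kappa_ge2 e0 M0; have k2' := kappa_ge2 e0 M'0.
have kk := kappa_mono e0 MM.
rewrite /zeta_hat ler_pM2l // lef_pV2 ?posrE; lra.
Qed.

(** This turns a bound on M into a bound on the number of iterations. *)
Lemma J_cond_mono M M' eps zeta j : 0 < eps -> 0 <= M -> M <= M' -> 0 < zeta ->
  J_cond M' eps zeta j -> J_cond M eps zeta j.
Proof.
move=> e0 M0 MM z0; have M'0 := le_trans M0 MM; rewrite /J_cond => h.
apply: le_trans (zeta_hat_mono e0 M0 MM z0); apply: le_trans h.
apply: ler_pM; rewrite ?sqrtr_ge0 ?powR_ge0 ?ler_wsqrtr ?capT_mono //.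
apply: ge0_ler_powR; last exact: tau_mono.
- by rewrite divr_ge0.
- by rewrite nnegrE ltW // tau_gt0.
- by rewrite nnegrE ltW // tau_gt0.
Qed.

Lemma zeta_hat_lt1 M eps zeta : 0 < eps -> 0 <= M -> 0 < zeta < 1 ->
  zeta_hat M eps zeta < 1.
Proof.
move=> e0 M0 z01; have k2 := kappa_ge2 e0 M0.
by rewrite /zeta_hat ltr_pdivrMr; lra.
Qed.

Lemma J_cond_gt0 M eps zeta j : 0 < eps -> 0 <= M -> 0 < zeta < 1 ->
  J_cond M eps zeta j -> (0 < j)%N.
Proof.
move=> e0 M0 z01; case: j => // /=; rewrite /J_cond mul0r powRr0 mulr1.
have zl := zeta_hat_lt1 e0 M0 z01.
have T1 : 1 <= Num.sqrt (capT M eps).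
  rewrite -[leLHS](@sqrtr1 R) ler_wsqrtr //.
  have := capT_ge_kappa e0 M0; have := kappa_ge2 e0 M0; lra.
move=> h; lra.
Qed.

(** From ln tau <= tau - 1 = - 1 / (sqrt kappa + 1). *)
Lemma J_cond_large M eps zeta j : 0 < eps -> 0 <= M -> 0 < zeta ->
  2 * (Num.sqrt (kappa M eps) + 1) *
    ln (Num.sqrt (capT M eps) / zeta_hat M eps zeta) <= j%:R ->
  J_cond M eps zeta j.
Proof.
move=> e0 M0 z0.
have z'0 := zeta_hat_gt0 e0 M0 z0.
have sT0 : 0 < Num.sqrt (capT M eps) by rewrite sqrtr_gt0 capT_gt0.
have q0 := divr_gt0 sT0 z'0.
have t0 := tau_gt0 e0 M0; have s0 := sqrt_kappa_gt0 e0 M0.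
have lt : ln (tau M eps) <= - (Num.sqrt (kappa M eps) + 1)^-1.
  rewrite -one_sub_tau //.
  have := @le_ln1Dx R (tau M eps - 1); rewrite addrCA subrr addr0 opprB.
  by apply; lra.
have s1 : 0 < Num.sqrt (kappa M eps) + 1 by rewrite addr_gt0.
move: lt s1; set s := _ + 1; set l := ln (Num.sqrt (capT _ _) / _) => lt s1 h.
rewrite /J_cond -ler_pdivlMl //.
have -> : (Num.sqrt (capT M eps))^-1 * zeta_hat M eps zeta = expR (- l).
  by rewrite [LHS]mulrC /l expRN lnK ?posrE ?q0 // invf_div.
rewrite /powR gt_eqF // ler_expR.
apply: (@le_trans _ _ (j%:R / 2 * - s^-1)).
  by rewrite ler_wpM2l // divr_ge0.
rewrite mulrN lerN2 ler_pdivlMr // ler_pdivlMr //.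
by rewrite -mulrA mulrC in h; rewrite mulrAC mulrC mulrA [_ * 2]mulrC mulrC; lra.
Qed.

Lemma J_cap_spec M eps zeta : 0 < eps -> 0 <= M -> 0 < zeta ->
  J_cond M eps zeta (J_cap M eps zeta) /\
  forall i, J_cond M eps zeta i -> (J_cap M eps zeta <= i)%N.
Proof.
move=> e0 M0 z0.
suff : exists j, J_cond M eps zeta j /\ forall i, J_cond M eps zeta i -> (j <= i)%N.
  by move=> /(xgetPex 0%N).
have ex : exists j, `[< J_cond M eps zeta j >].
  set x := 2 * (Num.sqrt (kappa M eps) + 1) *
    ln (Num.sqrt (capT M eps) / zeta_hat M eps zeta).
  exists (absz (Num.ceil `|x|)); apply/asboolP/J_cond_large => //; rewrite -/x.
  rewrite natr_absz ger0_norm; last by rewrite ceil_ge0 (lt_le_trans _ (normr_ge0 _)) // ltrN10.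
  exact: le_trans (ler_norm _) (ceil_ge _).
case: (ex_minnP ex) => j /asboolP hj hmin; exists j; split=> // i hi.
by apply: hmin; apply/asboolP.
Qed.

End Constants.

(** * Capped CG *)

Section MUpdate.
Context (R : realType) (n : nat) (H : 'M[R]_n).
Implicit Types (M : R) (u : 'cV[R]_n).

Lemma M_update_ge M u : M <= M_update H M u.
Proof.
rewrite /M_update; case: ifP => // h.
have [u0|u0] := eqVneq u 0; first by rewrite u0 mulmx0 enorm0 mulr0 ltxx in h.
by rewrite ler_pdivlMr ?enorm_gt0 // ltW.
Qed.

Lemma M_update_bound M u : enorm (H *m u) <= M_update H M u * enorm u.
Proof.
rewrite /M_update; case: ifPn => [h|]; last by rewrite -leNgt.
have [->|u0] := eqVneq u 0; first by rewrite mulmx0 enorm0 mulr0.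
by rewrite divfK ?gt_eqF ?enorm_gt0.
Qed.

Lemma M_update_bound_le M M' u : M_update H M u <= M' ->
  enorm (H *m u) <= M' * enorm u.
Proof.
by move=> h; apply: le_trans (M_update_bound M u) _; rewrite ler_wpM2r ?enorm_ge0.
Qed.

End MUpdate.

Section CappedCG.
Context (R : realType) (n : nat) (H : 'M[R]_n) (g : 'cV[R]_n) (eps zeta M0 : R).
Hypotheses (Hsym : H^T = H) (g0 : g != 0) (eps0 : 0 < eps) (zeta01 : 0 < zeta < 1).
Hypothesis (M00 : 0 <= M0).

Let A := damped H eps.
Let y j := cg_y (cg H g eps j).
Let r j := cg_r (cg H g eps j).
Let p j := cg_p (cg H g eps j).
Let M j := cg_M H g eps M0 j.
Let reaches := cg_reaches H g eps zeta M0.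

Lemma damped_sym : A^T = A.
Proof. by rewrite /A /damped raddfD /= Hsym tr_scalar_mx. Qed.

Lemma cg_is_recurrence : cg_recurrence A g y r p.
Proof. by []. Qed.

Lemma cg_M_leS j : M j <= M j.+1.
Proof.
rewrite /M /=; do 2 apply: le_trans (M_update_ge _ _ _).
exact: M_update_ge.
Qed.

Lemma cg_M_le i j : (i <= j)%N -> M i <= M j.
Proof.
elim: j => [|j IH]; first by rewrite leqn0 => /eqP ->.
rewrite leq_eqVlt => /orP[/eqP -> //|]; rewrite ltnS => /IH h.
exact: le_trans h (cg_M_leS j).
Qed.

Lemma cg_M_ge0 j : 0 <= M j.
Proof.
apply: le_trans (cg_M_le (leq0n j)); apply: le_trans M00 _.
exact: M_update_ge.
Qed.

Lemma cg_M_r i j : (i <= j)%N -> enorm (H *m r i) <= M j * enorm (r i).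
Proof.
move=> /cg_M_le; case: i => [|i].
  have -> : r 0%N = - p 0%N by rewrite /r /p /= opprK.
  by rewrite mulmxN enormN enormN; exact: (@M_update_bound_le _ _ _ M0).
exact: (@M_update_bound_le _ _ _
  (M_update H (M_update H (M i) (p i.+1)) (y i.+1))).
Qed.

Lemma cg_M_y j : enorm (H *m y j.+1) <= M j.+1 * enorm (y j.+1).
Proof.
apply: (@M_update_bound_le _ _ _ (M_update H (M j) (p j.+1))).
exact: M_update_ge.
Qed.

Lemma quad_damped_le K u : enorm (H *m u) <= K * enorm u ->
  quad A u <= kappa K eps * eps * dot u u.
Proof.
move=> hu; rewrite kappaM // /A /damped quad_addM quad_scalar [(K + _) * _]mulrDl lerD2r.
rewrite quadE -enorm_sqr expr2 mulrA [leRHS]mulrC.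
by apply: le_trans (dot_le_enorm _ _) _; rewrite ler_wpM2l ?enorm_ge0.
Qed.

Lemma neg_curvN u : ~ neg_curv H eps u <-> eps * dot u u <= quad A u.
Proof.
rewrite /neg_curv enorm_sqr -/A; split=> [/negP|h]; first by rewrite -leNgt.
by apply/negP; rewrite -leNgt.
Qed.

Let pos_curv u : u != 0 -> ~ neg_curv H eps u -> 0 < quad A u.
Proof.
move=> u0 /neg_curvN; apply: lt_le_trans.
by rewrite mulr_gt0 // dot_gt0.
Qed.

Let p_neq0 j : cg_regular A r p j -> r j != 0 -> p j != 0.
Proof.
move=> reg rj; have [_ _ _ pr] := cg_conjugate damped_sym cg_is_recurrence reg (leqnn j).
apply: contra_neq rj => pj; apply/eqP; rewrite -dot_eq0; apply/eqP.
by move: pr; rewrite pj dot0l => /esym/eqP; rewrite oppr_eq0 => /eqP.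
Qed.

Lemma not_small_residual j : ~ small_residual H g eps zeta M0 j -> r j != 0.
Proof.
move=> /negP; rewrite -ltNge => h; rewrite -enorm_gt0; apply: le_lt_trans h.
rewrite mulr_ge0 ?enorm_ge0 // ltW // zeta_hat_gt0 ?cg_M_ge0 //.
by case/andP: zeta01.
Qed.

Lemma cg_reaches_regular j : reaches j -> cg_regular A r p j.
Proof.
move=> [_ ent cont].
suff h m : (m <= j)%N -> cg_regular A r p m by exact: h.
elim: m => [//|m IH] mj.
have reg := IH (ltnW mj); move=> i; rewrite ltnS leq_eqVlt => /orP[/eqP ->|]; last exact: reg.
case: m mj reg {IH} => [_ _|m mj reg].
  by split=> //; apply: pos_curv; rewrite // oppr_eq0.
have [_ /not_small_residual rm pm _] := cont m.+1 mj.
by split=> //; apply: pos_curv => //; apply: p_neq0.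
Qed.

Lemma cg_reaches_regularS j : reaches j -> r j != 0 -> ~ neg_curv H eps (p j) ->
  cg_regular A r p j.+1.
Proof.
move=> /cg_reaches_regular reg rj pj i; rewrite ltnS leq_eqVlt => /orP[/eqP ->|]; last exact: reg.
by split=> //; apply: pos_curv => //; exact: p_neq0.
Qed.

(** The residuals of the previous iterations are nonzero and orthogonal. *)
Lemma cg_reaches_le_dim j : reaches j -> (j <= n)%N.
Proof.
move=> /cg_reaches_regular reg; apply: (@orthogonal_size _ _ _ r).
  by move=> i /reg [].
move=> i k ik kj.
have [_ rr _ _] := cg_conjugate damped_sym cg_is_recurrence reg (ltnW kj).
exact: rr.
Qed.

(** At iteration J the thresholds of the two tests on the residual have crossed,
    so that one of the tests applies. *)
Lemma cg_reaches_le_J UH j : (forall i, reaches i -> M i <= UH) ->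
  reaches j -> (j <= J_cap UH eps zeta)%N.
Proof.
move=> hM [j0 ent cont]; rewrite leqNgt; apply/negP => Jj.
have reach0 i : (0 < i <= j)%N -> reaches i.
  by case/andP=> i0 ij; split=> // k /andP[k0 ki]; apply: cont; rewrite k0 (leq_trans ki).
have UH0 : 0 <= UH.
  by apply: le_trans (hM j _); [exact: cg_M_ge0 | apply: reach0; rewrite j0 leqnn].
have z0 : 0 < zeta by case/andP: zeta01.
have [hJ _] := J_cap_spec eps0 UH0 z0.
have J0 := J_cond_gt0 eps0 UH0 zeta01 hJ.
move: hJ J0 Jj; set J := J_cap _ _ _ => hJ J0 Jj.
have MJ : M J <= UH by apply/hM/reach0; rewrite J0 ltnW.
have /negP := J_cond_mono eps0 (cg_M_ge0 J) MJ z0 hJ; apply.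
have [_ /negP small _ /negP slow] : cg_continues H g eps zeta M0 J.
  by apply: cont; rewrite J0.
rewrite -ltNge in small; rewrite -leNgt in slow.
by have := lt_le_trans small slow; rewrite ltr_pM2r ?enorm_gt0 // ltNge => /negP.
Qed.

(** Otherwise cg_residual_decrease with th = 1 - tau applies: K th ^ 2 <= 1
    holds because th = 1 / (sqrt kappa + 1), and 2 kappa <= T. *)
Lemma slow_residual_index j : reaches j -> r j != 0 -> ~ neg_curv H eps (p j) ->
  slow_residual H g eps M0 j ->
  exists2 i, (i < j)%N & neg_curv H eps (y j.+1 - y i).
Proof.
move=> hj rj pj slow; apply: contrapT => no.
have reg := cg_reaches_regularS hj rj pj.
have M0j := cg_M_ge0 j; have s0 := sqrt_kappa_gt0 eps0 M0j.
have k2 := kappa_ge2 eps0 M0j.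
set K := kappa (M j) eps in s0 k2; set th := 1 - tau (M j) eps.
have th01 : 0 < th < 1.
  by rewrite /th subr_gt0 tau_lt1 //= gtrBl tau_gt0.
have Kth : K * th ^+ 2 <= 1.
  rewrite /th one_sub_tau // exprVn ler_pdivrMr ?exprn_gt0 ?addr_gt0 //.
  rewrite mul1r -{1}(@sqr_sqrtr _ K); last lra.
  by rewrite lerXn2r ?nnegrE ?ler_wpDr ?addr_ge0 // ltW.
have K0 : 0 < K by lra.
have j0 : (0 < j)%N by case: hj.
have hK i : (i <= j)%N -> quad A (r i) <= K * eps * dot (r i) (r i).
  by move=> ij; apply/quad_damped_le/cg_M_r.
have hz i : (i < j)%N -> eps * dot (y j.+1 - y i) (y j.+1 - y i) <= quad A (y j.+1 - y i).
  by move=> ij; apply/neg_curvN => h; apply: no; exists i.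
have := cg_residual_decrease damped_sym cg_is_recurrence reg j0 eps0 th01 Kth K0 hK hz.
apply/negP; rewrite -ltNge -!enorm_sqr /th opprB addrCA subrr addr0.
set e := enorm g; set t := tau (M j) eps.
have t0 : 0 <= t by rewrite ltW // tau_gt0.
apply: (@le_lt_trans _ _ ((Num.sqrt (capT (M j) eps) * t `^ (j%:R / 2) * e) ^+ 2)).
  rewrite [leRHS]exprMn [(Num.sqrt _ * _) ^+ 2]exprMn (@sqr_sqrtr _ (capT _ _)).
    2: by rewrite ltW // capT_gt0.
  rewrite -[in leRHS](powR_mulrn _ (powR_ge0 _ _)) -powRrM divfK ?pnatr_eq0 // powR_mulrn //.
  rewrite ler_wpM2r ?sqr_ge0 // ler_wpM2r ?exprn_ge0 //.
  exact: capT_ge_kappa.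
rewrite ltrXn2r ?nnegrE ?mulr_ge0 ?sqrtr_ge0 ?powR_ge0 //; exact: slow.
Qed.

(** The factor 2 is for regenerating the iterates in the last test. *)
Lemma capped_cg_cost UH d t h : (0 < n)%N -> (forall i, reaches i -> M i <= UH) -> 0 <= UH ->
  capped_cg H g eps zeta M0 d t h -> (h <= 2 * minn n (J_cap UH eps zeta) + 1)%N.
Proof.
move=> n0 hM UH0.
have bound j : reaches j -> (j <= minn n (J_cap UH eps zeta))%N.
  by move=> hj; rewrite leq_min cg_reaches_le_dim ?(cg_reaches_le_J hM).
case=> [_|j|j|j|j i extra]; first by rewrite leq_addl.
- by move=> /bound hj _; lia.
- by move=> /bound hj _ _; lia.
- by move=> /bound hj _ _ _; lia.
- by move=> /bound hj _ _ _ _ _ _ he; lia.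
Qed.

Lemma capped_cg_NC d h : capped_cg H g eps zeta M0 d NC h -> neg_curv H eps d.
Proof.
move E : NC => t hc; case: hc E => // j.
Qed.

(** The value of M has been updated with the returned iterate, whence
    norm g <= norm r + kappa eps norm d; the definition of zeta_hat
    then gives the bound on the residual r. *)
Lemma capped_cg_SOL d h : capped_cg H g eps zeta M0 d SOL h ->
  [/\ d != 0, dot g d = - quad A d, eps * dot d d <= quad A d &
      enorm (A *m d + g) <= zeta / 2 * eps * enorm d].
Proof.
move E : SOL => t hc; case: hc E => // {d t h} j hj /neg_curvN yj small _.
have reg := cg_reaches_regular hj.
have yr := cg_iterate_residual damped_sym cg_is_recurrence reg (leqnn j) (leqnn j).
have rE := cg_residualE cg_is_recurrence j.
rewrite -/(y j) -/(r j) in yj small *; rewrite -rE.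
have [z0 z1] := andP zeta01.
have M0j := cg_M_ge0 j; have k2 := kappa_ge2 eps0 M0j.
have e0 : 0 < enorm g by rewrite enorm_gt0.
have zh1 := zeta_hat_lt1 eps0 M0j zeta01.
have gy : dot g (y j) = - quad A (y j).
  by move: yr; rewrite rE dotDr -quadE (dotC (y j) g); lra.
have small' : enorm (r j) <= zeta_hat (M j) eps zeta * enorm g by exact: small.
split=> //.
  apply/eqP => y0; move: small'; rewrite rE y0 mulmx0 add0r leNgt => /negP; apply.
  by rewrite gtr_pMl.
have hAy : enorm (A *m y j) <= kappa (M j) eps * eps * enorm (y j).
  rewrite kappaM // /A /damped mulmxDl mul_scalar_mx [(_ + 2 * eps) * _]mulrDl.
  apply: le_trans (enormD _ _) _; apply: lerD.
    by case: (j) hj => [[]//|i _]; exact: cg_M_y.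
  by rewrite enormZ gtr0_norm // mulr_gt0.
have hg : enorm g <= enorm (r j) + kappa (M j) eps * eps * enorm (y j).
  have -> : g = r j - A *m y j by rewrite rE addrAC subrr add0r.
  by apply: le_trans (enormD _ _) _; rewrite enormN lerD2l.
set K := kappa (M j) eps in k2 hAy hg; set u := enorm (y j) in hg *.
set x := enorm (r j) in hg small' *.
have hx : x * (3 * K) <= zeta * (x + K * eps * u).
  have K0 : 0 < 3 * K by lra.
  rewrite -ler_pdivlMr // mulrAC; apply: le_trans small' _.
  rewrite ler_wpM2l ?enorm_ge0 // ltW //; exact: zeta_hat_gt0.
have x0 : 0 <= x by exact: enorm_ge0.
have h1 : zeta * x <= x by rewrite ler_piMl // ltW.
have h2 : 0 <= x * (K - 2) by rewrite mulr_ge0 //; lra.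
have h3 : K * (5 / 2 * x) <= K * (zeta * eps * u) by nra.
have : 5 / 2 * x <= zeta * eps * u by rewrite -(ler_pM2l (_ : 0 < K)) //; lra.
have : 0 <= x by exact: enorm_ge0.
lra.
Qed.

(** Otherwise the loop would be entered more than n times. *)
Lemma capped_cg_returns : exists d t h, capped_cg H g eps zeta M0 d t h.
Proof.
apply: contrapT => no.
have ent : cg_enters H g eps.
  by move=> h; apply: no; do 3 eexists; exact: capped_cg_p0 h.
have cont j : reaches j -> cg_continues H g eps zeta M0 j.
  move=> hj.
  have c1 : ~ neg_curv H eps (y j).
    by move=> h; apply: no; do 3 eexists; exact: capped_cg_y hj h.
  have c2 : ~ small_residual H g eps zeta M0 j.
    by move=> h; apply: no; do 3 eexists; exact: capped_cg_sol hj c1 h.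
  have c3 : ~ neg_curv H eps (p j).
    by move=> h; apply: no; do 3 eexists; exact: capped_cg_p hj c1 c2 h.
  split=> // slow.
  have [i ij h] := slow_residual_index hj (not_small_residual c2) c3 slow.
  by apply: no; do 3 eexists; exact: capped_cg_slow hj c1 c2 c3 slow ij h (leq0n j).
have all j : reaches j.+1.
  elim: j => [|j IH]; split=> //; first by case.
  move=> i /andP[i0]; rewrite ltnS leq_eqVlt => /orP[/eqP ->|ij]; first exact: cont.
  by have [_ _ c] := IH; apply: c; rewrite i0.
by have := cg_reaches_le_dim (all n); rewrite ltnn.
Qed.

End CappedCG.

(** * Differential calculus along segments *)

Lemma small_step (R : realType) (a c e : R) : 0 < a -> 0 <= c -> 0 < e ->
  exists k, [/\ 0 < k, k <= a & k * c < e].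
Proof.
move=> a0 c0 e0; have q0 : 0 < c + 1 by rewrite ltr_wpDl.
exists (Num.min a (e / (c + 1) / 2)); split; last 2 first.
- by rewrite ge_min lexx.
- have h : Num.min a (e / (c + 1) / 2) <= e / (c + 1) / 2 by rewrite ge_min lexx orbT.
  apply: (@le_lt_trans _ _ (e / (c + 1) / 2 * (c + 1))).
    by apply: ler_pM => //; [rewrite le_min (ltW a0) !divr_ge0 ?(ltW e0) ?(ltW q0) | lra].
  by rewrite mulrAC divfK ?gt_eqF //; lra.
- by rewrite lt_min a0 divr_gt0 // divr_gt0.
Qed.

Section Topology.
Context (R : realType) (n : nat).
Implicit Types (A : set 'cV[R]_n) (x w : 'cV[R]_n).

Lemma enorm_entry w i : `|w i 0| <= enorm w.
Proof.
rewrite -dot_delta; apply: le_trans (dot_abs_le _ _) _.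
have -> : enorm (delta_mx i 0 : 'cV[R]_n) = 1.
  by rewrite /enorm dot_delta mxE !eqxx sqrtr1.
by rewrite mul1r.
Qed.

Lemma open_enorm A x : open A -> A x ->
  exists2 e : R, 0 < e & forall w, enorm w < e -> A (x + w).
Proof.
rewrite openE => /[apply] /nbhs_ballP[e /= e0 he]; exists e => // w we.
apply: he; split=> // i j; rewrite ord1 /ball /= mxE opprD addrA subrr add0r normrN.
exact: le_lt_trans (enorm_entry w i) we.
Qed.

Lemma enorm_open A :
  (forall x : 'cV[R]_n, A x -> exists2 e : R, 0 < e & forall w, enorm w < e -> A (x + w)) -> open A.
Proof.
move=> h; rewrite openE => x /h[e e0 he]; apply/nbhs_ballP.
have e'0 : 0 < e / n.+1%:R by rewrite divr_gt0.
exists (e / n.+1%:R) => //= y xy.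
have -> : y = x + (y - x) by rewrite addrCA subrr addr0.
apply: he; apply: (@le_lt_trans _ _ (Num.sqrt (n%:R * (e / n.+1%:R) ^+ 2))).
  have -> : n%:R * (e / n.+1%:R) ^+ 2 = \sum_(i < n) (e / n.+1%:R) ^+ 2.
    by rewrite sumr_const card_ord mulr_natl.
  rewrite ler_wsqrtr // dotE.
  apply: ler_sum => i _; rewrite -expr2 -real_normK ?num_real //.
  have := xy.2 i 0; rewrite /ball /= distrC !mxE => /ltW hh.
  by rewrite lerXn2r ?nnegrE ?normr_ge0 ?(ltW e'0).
rewrite -[ltRHS]ger0_norm ?(ltW e0) // -sqrtr_sqr ltr_sqrt ?exprn_gt0 //.
rewrite exprMn exprVn mulrA mulrC mulrA -[ltRHS]mul1r ltr_pM2r ?exprn_gt0 //.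
rewrite mulrC ltr_pdivrMr ?exprn_gt0 // mul1r -natrX ltr_nat.
by rewrite (@leq_ltn_trans (n ^ 2)) ?ltn_exp2r // -mulnn; nia.
Qed.

(** The times up to which the segment stays in C have a supremum; the point
    reached is in C, because C is closed, and the segment continues in N, because
    N is open, which by hypothesis entails that it continues in C. *)
Lemma segment_stays (C N : set 'cV[R]_n) x (d : 'cV[R]_n) (b : R) :
  closed C -> open N -> C `<=` N -> C x ->
  (forall s, 0 <= s <= b -> (forall t : R, 0 <= t <= s -> N (x + t *: d)) ->
     C (x + s *: d)) ->
  forall s, 0 <= s <= b -> C (x + s *: d).
Proof.
move=> cC oN CN Cx ext s /andP[s0 sb].
pose S := [set s | 0 <= s <= b /\ forall t, 0 <= t <= s -> C (x + t *: d)].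
have b0 := le_trans s0 sb.
have S0 : S 0.
  split; first by rewrite lexx.
  move=> t /andP[t0 t1]; have -> : t = 0 by lra.
  by rewrite scale0r addr0.
have bS : has_ubound S by exists b => u [/andP[]].
set g := sup S.
have g0 : 0 <= g by apply: ub_le_sup.
have gb : g <= b by apply: ge_sup; [exists 0 | move=> u [/andP[]]].
have below t : 0 <= t < g -> C (x + t *: d).
  move=> /andP[t0 tg].
  have [u [ub hu] tu] : exists2 u, S u & t < u by apply: sup_gt => //; exists 0.
  by apply: hu; rewrite t0 ltW.
have Cg : C (x + g *: d).
  apply: contrapT => nC.
  have [e e0 he] := open_enorm (closed_openC cC) nC.
  have [g1|g1] := eqVneq g 0; first by apply: nC; rewrite g1 scale0r addr0.
  have gp : 0 < g by rewrite lt_def g1.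
  have [k [k0 kg ke]] := small_step gp (enorm_ge0 d) e0.
  have /he : enorm (- k *: d) < e.
    by rewrite enormZ normrN gtr0_norm.
  rewrite -addrA -scalerDl; apply; apply: below.
  by rewrite subr_ge0 kg /= gtrBl.
have Sg t : 0 <= t <= g -> C (x + t *: d).
  move=> /andP[t0]; rewrite le_eqVlt => /orP[/eqP -> //|tg].
  by apply: below; rewrite t0.
have [gb'|gb'] := eqVneq g b; first by apply: Sg; rewrite s0 gb'.
have gltb : g < b by rewrite lt_def eq_sym gb'.
have [e e0 he] := open_enorm oN (CN _ Cg).
have bg0 : 0 < b - g by rewrite subr_gt0.
have [k [k0 kb ke]] := small_step bg0 (enorm_ge0 d) e0.
have Nk t : 0 <= t <= g + k -> N (x + t *: d).
  move=> /andP[t0 tk]; have [tg|tg] := leP t g.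
    by apply/CN/Sg; rewrite t0.
  have -> : t = g + (t - g) by lra.
  rewrite scalerDl addrA; apply: he; rewrite enormZ gtr0_norm ?subr_gt0 //.
  by apply: le_lt_trans ke; rewrite ler_wpM2r ?enorm_ge0 //; lra.
have : S (g + k).
  split; first by apply/andP; split; lra.
  move=> t /andP[t0 tk]; apply: ext; first by apply/andP; split; lra.
  by move=> u /andP[u0 ut]; apply: Nk; apply/andP; split; lra.
move=> /(ub_le_sup bS); rewrite -/g => h; exfalso; lra.
Qed.

End Topology.

Lemma deriv_le0 (R : realType) (h dh : R -> R) (b : R) : 0 <= b ->
  (forall t : R, 0 <= t <= b -> is_derive t 1 h (dh t)) ->
  (forall t : R, 0 <= t <= b -> dh t <= 0) -> h b <= h 0.
Proof.
move=> b0 der neg.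
have [| |c] := @MVT_segment R h dh 0 b b0.
- by move=> t; rewrite in_itv /= => /andP[t0 tb]; apply: der; rewrite !ltW.
- apply: continuous_in_subspaceT => t; rewrite inE /= in_itv /= => /der ht.
  by apply: differentiable_continuous; apply/derivable1_diffP; exact: ex_derive.
- rewrite in_itv /= subr0 => /neg cneg hb.
  by rewrite -subr_le0 hb mulr_le0_ge0.
Qed.

(** The difference with the primitive of the bound is nonincreasing. *)
Lemma deriv_quadratic_le (R : realType) (h dh : R -> R) (a b c s : R) : 0 <= s ->
  (forall t : R, 0 <= t <= s -> is_derive t 1 h (dh t)) ->
  (forall t : R, 0 <= t <= s -> dh t <= a + b * t + c * t ^+ 2) ->
  h s <= h 0 + a * s + b / 2 * s ^+ 2 + c / 3 * s ^+ 3.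
Proof.
move=> s0 der le.
pose P : {poly R} := a *: 'X + (b / 2) *: 'X^2 + (c / 3) *: 'X^3.
have PE t : P.[t] = a * t + b / 2 * t ^+ 2 + c / 3 * t ^+ 3 by rewrite !hornerE.
have P'E t : P^`().[t] = a + b * t + c * t ^+ 2.
  by rewrite /P !derivD !derivZ derivX !derivXn /= !hornerE /=; field.
have dP (t : R) : is_derive t (1 : R) (horner P) P^`().[t] by exact: is_derive_poly.
have := @deriv_le0 R (h - horner P) (fun t => dh t - P^`().[t]) s s0.
have -> : (h - horner P) s = h s - P.[s] by [].
have P0 : P.[0] = 0 by rewrite PE; ring.
have -> : (h - horner P) 0 = h 0 by rewrite -[RHS]subr0 -[X in _ = _ - X]P0.
move=> hh; suff : h s - P.[s] <= h 0 by rewrite PE; lra.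
apply: hh => t tb.
  by apply: is_deriveB; exact: der.
by rewrite P'E subr_le0 le.
Qed.

Section Lines.
Context (R : realType) (n : nat).
Implicit Types (x d u : 'cV[R]_n) (t s : R).

Lemma is_derive_line (h : 'cV[R]_n -> R) x d t : derivable h (x + t *: d) d ->
  is_derive t 1 (fun s => h (x + s *: d)) ('D_d h (x + t *: d)).
Proof.
move=> hd.
have E : (fun k : R => k^-1 *: (h (x + (k *: 1 + t) *: d) - h (x + t *: d))) =
         (fun k : R => k^-1 *: (h (k *: d + (x + t *: d)) - h (x + t *: d))).
  apply/funext => k; congr (_ *: (h _ - _)).
  by rewrite scalerDl addrCA; congr (_ *: _ + _); rewrite /GRing.scale /= mulr1.
by apply: DeriveDef; rewrite /derivable /derive /= E.
Qed.

Lemma derive_partials (h : 'cV[R]_n -> R) x d : differentiable h x ->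
  'D_d h x = \sum_i d i 0 * 'D_(delta_mx i 0 : 'cV[R]_n) h x.
Proof.
move=> hd; rewrite deriveE // {1}[d]matrix_sum_delta linear_sum.
apply: eq_bigr => i _; rewrite big_ord1 linearZ /= -deriveE //.
Qed.

Lemma derive_grad (f : 'cV[R]_n -> R) x d : differentiable f x ->
  'D_d f x = dot (grad f x) d.
Proof.
move=> /derive_partials ->; rewrite dotE; apply: eq_bigr => i _.
by rewrite mxE mulrC.
Qed.

Lemma differentiable_entry (G : 'cV[R]_n -> 'cV[R]_n) x i : differentiable G x ->
  differentiable (fun y => G y i 0) x.
Proof.
move=> hG; apply: (@differentiable_comp _ _ _ _ G (fun y : 'cV[R]_n => y i 0)) => //.
exact: differentiable_coord.
Qed.

Lemma derive_hess (f : 'cV[R]_n -> R) x d i : differentiable (grad f) x ->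
  'D_d (fun y => grad f y i 0) x = (hess f x *m d) i 0.
Proof.
move=> /differentiable_entry hG; rewrite derive_partials // mxE.
by apply: eq_bigr => j _; rewrite !mxE mulrC.
Qed.

Lemma is_derive_grad_line (f : 'cV[R]_n -> R) x d u t :
  differentiable (grad f) (x + t *: d) ->
  is_derive t 1 (fun s => dot u (grad f (x + s *: d))) (dot u (hess f (x + t *: d) *m d)).
Proof.
move=> hG.
have -> : (fun s => dot u (grad f (x + s *: d))) =
    \sum_i (u i 0 *: (fun s => grad f (x + s *: d) i 0)).
  apply/funext => s; rewrite fct_sumE dotE; apply: eq_bigr => i _.
  by [].
rewrite dotE; apply: is_derive_sum => i; apply: is_deriveZ.
rewrite -(derive_hess d i hG).
apply: (@is_derive_line (fun y => grad f y i 0)); apply: diff_derivable.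
exact: differentiable_entry.
Qed.

End Lines.

(** * Functions with Lipschitz continuous Hessian *)

(* Reification would compare values of grad and hess by unfolding them, which is
   prohibitively slow. *)
Ltac abstract_values :=
  repeat match goal with
  | |- context [dot ?u ?v] => generalize (dot u v); intro
  | |- context [quad ?A ?u] => generalize (quad A u); intro
  | |- context [enorm ?u] => generalize (enorm u); intro
  end.

Lemma addrBl (V : zmodType) (x w : V) : x + w - x = w.
Proof. by rewrite addrAC subrr add0r. Qed.

Section LipschitzHessian.
Local Opaque grad hess dot enorm quad opnorm.
Context (R : realType) (n : nat) (f : 'cV[R]_n -> R) (N : set 'cV[R]_n) (LH : R).
Implicit Types (x y d u v w : 'cV[R]_n) (s t : R).

Definition lipschitz_hessian :=
  [/\ open N, forall x, N x -> differentiable f x,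
      forall x, N x -> differentiable (grad f) x &
      forall x y, N x -> N y -> opnorm (hess f x - hess f y) <= LH * enorm (x - y)].

Hypothesis smooth : lipschitz_hessian.

Let oN : open N. Proof. by case: smooth. Qed.
Let df x : N x -> differentiable f x. Proof. by case: smooth => _ h _ _; apply: h. Qed.
Let dg x : N x -> differentiable (grad f) x.
Proof. by case: smooth => _ _ h _; apply: h. Qed.

Lemma lipschitz_ge0 x : (0 < n)%N -> N x -> 0 <= LH.
Proof.
move=> n0 Nx; have [e e0 he] := open_enorm oN Nx.
pose w : 'cV[R]_n := delta_mx (Ordinal n0) 0.
have w0 : 0 < enorm w.
  rewrite enorm_gt0; apply/eqP => /matrixP /(_ (Ordinal n0) 0).
  by rewrite !mxE !eqxx /= => /eqP; rewrite oner_eq0.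
have [k [k0 _ ke]] := small_step (@ltr01 R) (ltW w0) e0.
have kw0 : 0 < enorm (k *: w) by rewrite enormZ gtr0_norm // mulr_gt0.
have Nkw : N (x + k *: w) by apply: he; rewrite enormZ gtr0_norm.
case: smooth => _ _ _ /(_ _ _ Nkw Nx); rewrite (addrBl x (k *: w)) => h.
by rewrite -(pmulr_lge0 _ kw0); apply: le_trans h; exact: opnorm_ge0.
Qed.

Lemma hess_lipschitz x w d u : N x -> N (x + w) ->
  `|dot u (hess f (x + w) *m d) - dot u (hess f x *m d)| <=
    LH * enorm w * enorm d * enorm u.
Proof.
move=> Nx Ny; rewrite -dotNr -dotDr -mulmxBl.
apply: le_trans (dot_abs_le _ _) _; rewrite mulrC ler_wpM2r ?enorm_ge0 //.
apply: le_trans (opnorm_ub _ _) _; rewrite ler_wpM2r ?enorm_ge0 //.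
case: smooth => _ _ _ /(_ _ _ Ny Nx) h; apply: le_trans h _.
by rewrite (addrBl x w).
Qed.

Lemma hess_lipschitz_quad x w d : N x -> N (x + w) ->
  `|quad (hess f (x + w)) d - quad (hess f x) d| <= LH * enorm w * enorm d ^+ 2.
Proof.
move=> Nx Nxw; have E A B c : `|dot d (A *m d) - dot d (B *m d)| <= c ->
  `|quad A d - quad B d| <= c by rewrite !quadE.
by rewrite expr2 mulrA; apply/E/hess_lipschitz.
Qed.

Let segment x d := forall t, 0 <= t <= 1 -> N (x + t *: d).

Let segment_l x d : segment x d -> N x.
Proof. by move=> /(_ 0); rewrite lexx ler01 scale0r addr0; apply. Qed.

Lemma taylor_grad x d u s : segment x d -> 0 <= s <= 1 ->
  dot u (grad f (x + s *: d)) <=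
    dot u (grad f x) + s * dot u (hess f x *m d) +
    LH / 2 * s ^+ 2 * (enorm d ^+ 2 * enorm u).
Proof.
move=> sd /andP[s0 s1].
have := @deriv_quadratic_le R (fun t => dot u (grad f (x + t *: d)))
  (fun t => dot u (hess f (x + t *: d) *m d)) (dot u (hess f x *m d))
  (LH * (enorm d ^+ 2 * enorm u)) 0 s s0.
rewrite scale0r addr0 => h.
apply: le_trans (h _ _) _; last by lra.
- move=> t /andP[t0 ts]; apply: is_derive_grad_line; apply: dg; apply: sd.
  by rewrite t0 (le_trans ts).
- move=> t /andP[t0 ts].
  have Nt : N (x + t *: d) by apply: sd; rewrite t0 (le_trans ts).
  have := hess_lipschitz d u (segment_l sd) Nt.
  rewrite enormZ (ger0_norm t0) ler_distl => /andP[_].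
  by abstract_values; lra.
Qed.

Lemma taylor_grad1 x d u : segment x d ->
  dot u (grad f (x + d)) <=
    dot u (grad f x) + dot u (hess f x *m d) + LH / 2 * (enorm d ^+ 2 * enorm u).
Proof.
move=> sd; have := @taylor_grad x d u 1 sd.
by rewrite scale1r mul1r expr1n mulr1 ler01 lexx; apply.
Qed.

Lemma taylor_grad1_lower x d u : segment x d ->
  dot u (grad f x) + dot u (hess f x *m d) - LH / 2 * (enorm d ^+ 2 * enorm u) <=
    dot u (grad f (x + d)).
Proof.
move=> /(@taylor_grad1 _ _ (- u)); rewrite enormN !dotNl.
by abstract_values; lra.
Qed.

Lemma taylor_grad_norm x d : (0 < n)%N -> segment x d ->
  enorm (grad f (x + d) - grad f x - hess f x *m d) <= LH / 2 * enorm d ^+ 2.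
Proof.
move=> n0 sd; set u := _ - _ - _.
have h := @taylor_grad1 x d u sd.
have [->|u0] := eqVneq u 0.
  have L0 := lipschitz_ge0 n0 (segment_l sd).
  by rewrite enorm0 mulr_ge0 ?sqr_ge0 // divr_ge0.
have un : 0 < enorm u by rewrite enorm_gt0.
have uE : dot u u =
    dot u (grad f (x + d)) - dot u (grad f x) - dot u (hess f x *m d).
  by rewrite -!dotNr -!dotDr.
rewrite -(ler_pM2r un) -expr2 (enorm_sqr u) uE.
by move: h; clear; abstract_values; lra.
Qed.

Lemma taylor_upper x d : segment x d ->
  f (x + d) <= f x + dot (grad f x) d + quad (hess f x) d / 2 + LH / 6 * enorm d ^+ 3.
Proof.
move=> sd.
have := @deriv_quadratic_le R (fun t => f (x + t *: d))
  (fun t => dot (grad f (x + t *: d)) d) (dot (grad f x) d)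
  (quad (hess f x) d) (LH / 2 * enorm d ^+ 3) 1 ler01.
rewrite scale0r addr0 scale1r => h.
apply: le_trans (h _ _) _; last by lra.
- move=> t t01; rewrite -derive_grad; last exact/df/sd.
  apply: is_derive_line; apply: diff_derivable; exact/df/sd.
- move=> t t01; have := taylor_grad d sd t01.
  by rewrite (dotC d (grad f (x + t *: d))) (dotC d (grad f x)) -quadE; abstract_values; lra.
Qed.

Lemma taylor_lower x d : segment x d ->
  f x + dot (grad f x) d + quad (hess f x) d / 2 - LH / 6 * enorm d ^+ 3 <= f (x + d).
Proof.
move=> sd.
have := @deriv_quadratic_le R (fun t => - f (x + t *: d))
  (fun t => - dot (grad f (x + t *: d)) d) (- dot (grad f x) d)
  (- quad (hess f x) d) (LH / 2 * enorm d ^+ 3) 1 ler01.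
rewrite scale0r addr0 scale1r => h.
rewrite -lerN2; apply: le_trans (h _ _) _; last by lra.
- move=> t t01; rewrite -derive_grad; last exact/df/sd.
  apply: is_deriveN.
  apply: is_derive_line; apply: diff_derivable; exact/df/sd.
- move=> t t01; have := taylor_grad (- d) sd t01.
  rewrite enormN !dotNl (dotC d (grad f (x + t *: d))) (dotC d (grad f x)) -quadE.
  by abstract_values; lra.
Qed.

(** Expanding f (x + s u + s v) along both sides of the parallelogram, the
    mixed terms must agree up to order s ^ 3. *)
Lemma hess_mixed_le x u v : (0 < n)%N -> N x ->
  dot v (hess f x *m u) >= dot u (hess f x *m v).
Proof.
move=> n0 Nx; have L0 := lipschitz_ge0 n0 Nx.
have [e e0 he] := open_enorm oN Nx.
rewrite leNgt; apply/negP => lt.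
set D := dot u (hess f x *m v) - dot v (hess f x *m u).
have D0 : 0 < D by rewrite subr_gt0.
set a := enorm u; set b := enorm v.
have a0 : 0 <= a by exact: enorm_ge0.
have b0 : 0 <= b by exact: enorm_ge0.
have c0 : 0 <= 2 * LH * (a + b) ^+ 3.
  by apply: mulr_ge0; [rewrite mulr_ge0 | rewrite exprn_ge0 // addr_ge0].
have [k1 [k10 _ k1e]] := small_step (@ltr01 R) (addr_ge0 a0 b0) e0.
have [k [k0 kk1 kD]] := small_step k10 c0 D0.
have ke : k * (a + b) < e.
  by apply: le_lt_trans k1e; rewrite ler_wpM2r // addr_ge0.
have Nab s t : 0 <= s <= 1 -> 0 <= t <= 1 -> N (x + s *: (k *: u) + t *: (k *: v)).
  move=> /andP[s0 s1] /andP[t0 t1]; rewrite -addrA; apply: he.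
  apply: le_lt_trans (enormD _ _) _; rewrite !enormZ !ger0_norm ?(ltW k0) //.
  rewrite -/a -/b; apply: le_lt_trans ke.
  have : s * (k * a) <= k * a by rewrite ler_piMl // mulr_ge0 // ltW.
  have : t * (k * b) <= k * b by rewrite ler_piMl // mulr_ge0 // ltW.
  lra.
have z01 : 0 <= (0 : R) <= 1 by rewrite lexx ler01.
have o01 : 0 <= (1 : R) <= 1 by rewrite ler01 lexx.
have su : segment x (k *: u) by move=> t t01; have := Nab t 0 t01 z01; rewrite scale0r addr0.
have sv : segment x (k *: v) by move=> t t01; have := Nab 0 t z01 t01; rewrite scale0r addr0.
have suv : segment (x + k *: u) (k *: v).
  by move=> t t01; have := Nab 1 t o01 t01; rewrite scale1r.
have svu : segment (x + k *: v) (k *: u).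
  by move=> t t01; have := Nab t 1 t01 o01; rewrite scale1r addrAC.
have h1 := taylor_upper suv; have h2 := taylor_upper su.
have h3 := taylor_lower svu; have h4 := taylor_lower sv.
have g1 := taylor_grad1 (k *: v) su.
have g2 := taylor_grad1_lower (k *: u) sv.
have := hess_lipschitz_quad (k *: v) (segment_l su) (segment_l suv).
rewrite ler_distl => /andP[_ q1].
have := hess_lipschitz_quad (k *: u) (segment_l sv) (segment_l svu).
rewrite ler_distl => /andP[q2 _].
rewrite (dotC (grad f x)) (dotC (grad f (x + k *: u))) in h1 h2.
rewrite (dotC (grad f x)) (dotC (grad f (x + k *: v))) in h3 h4.
have fE : f (x + k *: v + k *: u) = f (x + k *: u + k *: v) by rewrite addrAC.
rewrite fE in h3.
rewrite !enormZ !(gtr0_norm k0) -/a -/b in h1 h2 h3 h4 g1 g2 q1 q2.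
have D2 : dot (k *: u) (hess f x *m (k *: v)) - dot (k *: v) (hess f x *m (k *: u)) = k ^+ 2 * D.
  by rewrite -!scalemxAr !dotZl !dotZr /D; ring.
have C : LH / 3 * (k * a) ^+ 3 + LH / 3 * (k * b) ^+ 3 + LH * (k * a) ^+ 2 * (k * b) +
  LH * (k * b) ^+ 2 * (k * a) <= k ^+ 3 * (2 * LH * (a + b) ^+ 3).
  rewrite -subr_ge0.
  have -> : k ^+ 3 * (2 * LH * (a + b) ^+ 3) -
     (LH / 3 * (k * a) ^+ 3 + LH / 3 * (k * b) ^+ 3 +
      LH * (k * a) ^+ 2 * (k * b) + LH * (k * b) ^+ 2 * (k * a)) =
   k ^+ 3 * LH * (5 / 3 * a ^+ 3 + 5 / 3 * b ^+ 3 + 5 * a ^+ 2 * b + 5 * b ^+ 2 * a) by field.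
  by rewrite !(mulr_ge0, addr_ge0, exprn_ge0) // ltW.
have : k ^+ 2 * D <= k ^+ 2 * (k * (2 * LH * (a + b) ^+ 3)).
  rewrite -D2; move: C h1 h2 h3 h4 g1 g2 q1 q2; clear.
  abstract_values.
  repeat match goal with |- context [f ?y] => generalize (f y); intro end.
  by move=> *; lra.
rewrite ler_pM2l ?exprn_gt0 // leNgt => /negP; apply.
exact: kD.
Qed.

Lemma hess_sym x : (0 < n)%N -> N x -> (hess f x)^T = hess f x.
Proof.
move=> n0 Nx; apply/matrixP => i j; rewrite mxE.
have E (A : 'M[R]_n) k l : A k l = dot (delta_mx k 0) (A *m delta_mx l 0).
  by rewrite dot_delta -colE mxE.
by apply/eqP; rewrite eq_le !E !hess_mixed_le.
Qed.

End LipschitzHessian.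

(** * The smallest eigenvalue of a symmetric matrix *)

Section SmallestEigenvalue.
Context (R : realType) (n : nat) (A : 'M[R]_n).
Hypotheses (n_gt0 : (0 < n)%N) (Asym : A^T = A).

Lemma quad_shift a (u : 'cV[R]_n) : quad (A - a%:M) u = quad A u - a * dot u u.
Proof. by rewrite quad_subM quad_scalar. Qed.

Lemma psd_shift a : psd (A - a%:M) <-> forall u, a * dot u u <= quad A u.
Proof. by split=> h u; move: (h u); rewrite quad_shift subr_ge0. Qed.

Lemma eigenvalueP_sym a : reflect (exists2 u : 'cV[R]_n, u != 0 & A *m u = a *: u)
  (eigenvalue A a).
Proof.
apply: (iffP eigenvalueP) => [[v hv v0]|[u u0 hu]].
  exists v^T; first by rewrite -trmx0 (inj_eq trmx_inj).
  by rewrite -[in LHS]Asym -trmx_mul hv linearZ.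
exists u^T; last by rewrite -trmx0 (inj_eq trmx_inj).
by rewrite -[in LHS]Asym -trmx_mul hu linearZ.
Qed.

(** The largest shift m for which A - m is positive semidefinite makes A - m
    singular: with an inverse B of A - m, positivity at u - t B u for small t
    bounds the form of A - m below by t times the squared norm. *)
Lemma min_eigenvalue_exists : exists2 m, eigenvalue A m & psd (A - m%:M).
Proof.
pose S := [set m : R | psd (A - m%:M)].
have [c c0 hc] := enorm_mulmx_bounded A.
have S0 : S (- c).
  apply/psd_shift => u; rewrite mulNr -enorm_sqr lerNl quadE -dotNl.
  apply: le_trans (dot_le_enorm _ _) _; rewrite enormN mulrC expr2 mulrA.
  by rewrite ler_wpM2r ?enorm_ge0.
pose e : 'cV[R]_n := delta_mx (Ordinal n_gt0) 0.
have e1 : dot e e = 1 by rewrite dot_delta mxE !eqxx.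
have ubS : has_ubound S.
  by exists (quad A e) => m /psd_shift /(_ e); rewrite e1 mulr1.
have Sne : S !=set0 by exists (- c).
have psdS : psd (A - (sup S)%:M).
  apply/psd_shift => u.
  have [->|u0] := eqVneq u 0; first by rewrite dot0r mulr0 quadE dot0l.
  rewrite -ler_pdivlMr ?dot_gt0 //; apply: ge_sup => // m /psd_shift /(_ u).
  by rewrite ler_pdivlMr ?dot_gt0.
exists (sup S) => //; apply: contraT => neig.
set B := A - (sup S)%:M in psdS.
have Bsym : B^T = B by rewrite /B raddfB /= Asym tr_scalar_mx.
have Bu : B \in unitmx.
  by move: neig; rewrite /eigenvalue /eigenspace negbK -/B kermx_eq0 row_free_unit.
have [K K0 hK] := enorm_mulmx_bounded (invmx B).
have K1 : 0 < K + 1 by rewrite ltr_wpDl.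
pose t := (K + 1)^-1.
have t0 : 0 < t by rewrite invr_gt0.
have : S (sup S + t).
  apply/psd_shift => u; rewrite mulrDl -lerBrDl -quad_shift -/B.
  have := psdS (u - t *: (invmx B *m u)).
  set w := invmx B *m u.
  have Bw : B *m w = u by rewrite /w mulKVmx.
  have hw : dot w u <= K * dot u u.
    apply: le_trans (dot_le_enorm _ _) _; rewrite -enorm_sqr expr2 mulrA.
    by rewrite ler_wpM2r ?enorm_ge0 //; exact: hK.
  rewrite !quadE mulmxBr -scalemxAr Bw !dot_lin.
  rewrite (dot_sym w u) // Bw => h.
  have h2 : t * (t * dot w u) <= t * dot u u.
    rewrite ler_pM2l //; apply: (@le_trans _ _ (t * (K * dot u u))).
      by rewrite ler_pM2l.
    rewrite mulrA ler_piMl ?dot_ge0 // /t mulrC ler_pdivrMr //; lra.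
  lra.
by move=> /(ub_le_sup ubS); rewrite gerDl leNgt t0.
Qed.

Lemma lambda_min_psd e : - e <= lambda_min A <-> psd (A + e%:M).
Proof.
have [m meig mpsd] := min_eigenvalue_exists.
have mP : forall u, m * dot u u <= quad A u by apply/psd_shift.
have lb : lbound [set a : R | eigenvalue A a] m.
  move=> a /= /eigenvalueP_sym[u u0 hu].
  by have := mP u; rewrite quadE hu dotZr ler_pM2r ?dot_gt0.
have -> : lambda_min A = m.
  apply/eqP; rewrite eq_le; apply/andP; split.
    by apply: ge_inf => //; exists m.
  by apply: lb_le_inf => //; exists m.
have -> : A + e%:M = A - (- e)%:M by rewrite raddfN /= opprK.
split=> [em|/psd_shift h].
  apply/psd_shift => u; apply: le_trans (mP u).
  by rewrite ler_wpM2r ?dot_ge0.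
have /eigenvalueP_sym[u u0 hu] := meig.
by have := h u; rewrite quadE hu dotZr ler_pM2r ?dot_gt0.
Qed.

End SmallestEigenvalue.

(** * Decrease of the objective in one iteration *)

Lemma geometric_small (R : realType) (th a : R) : 0 < th < 1 -> 0 < a ->
  exists j, th ^+ j < a.
Proof.
move=> /andP[th0 th1] a0.
have h : (GRing.exp th : R^nat) @ \oo --> (0 : R).
  by apply: cvg_expr; rewrite gtr0_norm.
have /cvgr0_norm_lt /(_ a a0) [j _ /(_ j (leqnn _))] := h.
by rewrite /= gtr0_norm ?exprn_gt0 // => ?; exists j.
Qed.

Section RealInequalities.
Context (R : realType).
Implicit Types (L eta eps epsg zeta b D Q s : R).

(** The left-hand sides here and in nc_model_le are the cubic Taylor models
    along d, with D the norm of d and Q its curvature for the damped Hessian. *)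
Lemma sol_model_le L eps D Q s : 0 <= L -> 0 < eps -> 0 <= D ->
  0 <= s <= 1 -> eps * D ^+ 2 <= Q ->
  s * - Q + s ^+ 2 * (Q - 2 * eps * D ^+ 2) / 2 + L / 6 * (s * D) ^+ 3 <=
  s * D ^+ 2 * (L / 6 * (s ^+ 2 * D) - eps * (1 + s / 2)).
Proof.
move=> L0 e0 D0 /andP[s0 s1] hQ.
have : 0 <= s * (1 - s / 2) * (Q - eps * D ^+ 2) by rewrite !mulr_ge0 //; lra.
lra.
Qed.

Lemma nc_model_le L D s b : 0 <= L -> 0 <= D -> 0 <= s -> b <= 0 ->
  s * b + s ^+ 2 * - D ^+ 3 / 2 + L / 6 * (s * D) ^+ 3 <=
  s ^+ 2 * D ^+ 3 * (L / 6 * s - 1 / 2).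
Proof.
by move=> L0 D0 s0 b0; have := mulr_ge0_le0 s0 b0; lra.
Qed.

(** With v the minimum on the left-hand side, the bound on D is the positive root
    of L t ^ 2 + (4 + zeta) v t - 2 v ^ 2. *)
Lemma sol_unit_step_length L zeta eps epsg D :
  0 <= L -> 0 < zeta -> 0 < eps -> 0 < epsg -> 0 <= D ->
  epsg <= L / 2 * D ^+ 2 + (zeta / 2 + 2) * eps * D ->
  4 / (Num.sqrt ((4 + zeta) ^+ 2 + 8 * L) + 4 + zeta) * Num.min (epsg / eps) eps <= D.
Proof.
move=> L0 z0 e0 eg0 D0 h.
set v : R := Num.min _ _.
have v0 : 0 < v by rewrite lt_min divr_gt0.
have ve : v <= eps by rewrite ge_min lexx orbT.
have vg : eps * v <= epsg by rewrite mulrC -ler_pdivlMr // ge_min lexx.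
set a : R := 4 + zeta; set S : R := Num.sqrt _.
have a0 : 0 < a by rewrite addr_gt0.
have S2 : S ^+ 2 = a ^+ 2 + 8 * L.
  by rewrite sqr_sqrtr // addr_ge0 ?sqr_ge0 ?mulr_ge0.
have S0 : 0 <= S by exact: sqrtr_ge0.
have Sa : 0 < S + a by rewrite ltr_wpDl.
have -> : S + 4 + zeta = S + a by rewrite -addrA.
set c : R := 4 / (S + a).
have c0 : 0 < c by rewrite divr_gt0.
have cE : c * (S + a) = 4 by rewrite divfK ?gt_eqF.
have quadr : L * c ^+ 2 + a * c = 2.
  have : (c * S) ^+ 2 = (4 - c * a) ^+ 2 by rewrite -cE; ring.
  rewrite exprMn S2; lra.
rewrite leNgt; apply/negP => Dv.
have h1 : D ^+ 2 <= c * v * (c * v) by rewrite expr2 ler_pM // ltW.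
have h2 : L * D ^+ 2 <= L * (c * v * (c * v)) by rewrite ler_wpM2l.
have h3 : a * eps * D < a * eps * (c * v) by rewrite ltr_pM2l // mulr_gt0.
have h4 : L * c ^+ 2 * v * v <= L * c ^+ 2 * v * eps.
  by rewrite ler_wpM2l // mulr_ge0 ?(ltW v0) // mulr_ge0 // sqr_ge0.
have h5 : (L * c ^+ 2 + a * c) * (v * eps) = 2 * (v * eps) by rewrite quadr.
rewrite /a in h3 h5; lra.
Qed.

End RealInequalities.

Section Step.
Context (R : realType) (n : nat) (f : 'cV[R]_n -> R) (N : set 'cV[R]_n) (LH : R).
Context (n_gt0 : (0 < n)%N) (smooth : lipschitz_hessian f N LH).
Context (x0 : 'cV[R]_n).
Hypotheses (level_closed : closed [set x | f x <= f x0])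
  (level_N : [set x | f x <= f x0] `<=` N).
Context (pr : dncg_params R).
Let epsg := par_epsg pr.
Let eps := par_epsH pr.
Let th := par_theta pr.
Let zeta := par_zeta pr.
Let eta := par_eta pr.
Hypotheses (epsg0 : 0 < epsg) (eps0 : 0 < eps) (th01 : 0 < th < 1)
  (zeta01 : 0 < zeta < 1) (eta0 : 0 < eta).
Implicit Types (x d : 'cV[R]_n) (s b : R).
Local Opaque grad hess dot enorm quad opnorm.

Let level x := f x <= f x0.

Lemma level_LH_ge0 x : level x -> 0 <= LH.
Proof. by move=> lx; have Nx := level_N lx; have := lipschitz_ge0 smooth n_gt0 Nx. Qed.

Let model x d s := s * dot (grad f x) d + s ^+ 2 * quad (hess f x) d / 2 +
  LH / 6 * (s * enorm d) ^+ 3.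

(** As long as the Taylor model predicts no increase, the segment stays in the
    level set, hence in the region where the model is an upper bound. *)
Lemma model_upper_bound x d b : level x -> 0 <= b ->
  (forall s, 0 <= s <= b -> model x d s <= 0) ->
  forall s, 0 <= s <= b -> level (x + s *: d) /\ f (x + s *: d) <= f x + model x d s.
Proof.
move=> lx b0 hm.
have upper s : 0 <= s -> (forall t, 0 <= t <= s -> N (x + t *: d)) ->
    f (x + s *: d) <= f x + model x d s.
  move=> s0 hN.
  have sd : forall t, 0 <= t <= 1 -> N (x + t *: (s *: d)).
    move=> t /andP[t0 t1]; rewrite scalerA; apply: hN.
    by rewrite mulr_ge0 //= ler_piMl.
  have := taylor_upper smooth sd.
  by rewrite /model dotZr quadZ enormZ (ger0_norm s0) !addrA.
have stay := @segment_stays R n _ N x d b level_closed (let: And4 h _ _ _ := smooth in h)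
  level_N lx.
have stay' : forall s, 0 <= s <= b -> level (x + s *: d).
  apply: stay => s sb hN /=; have /andP[s0 _] := sb.
  apply: le_trans (upper s s0 hN) _; apply: le_trans lx.
  by rewrite gerDl hm.
move=> s /andP[s0 sb]; split; first by apply: stay'; rewrite s0.
apply: upper => // t /andP[t0 ts]; apply/level_N/stay'.
by rewrite t0 (le_trans ts).
Qed.

Definition sol_direction x d :=
  [/\ d != 0, dot (grad f x) d = - quad (damped (hess f x) eps) d,
      eps * dot d d <= quad (damped (hess f x) eps) d &
      enorm (damped (hess f x) eps *m d + grad f x) <= zeta / 2 * eps * enorm d].

Definition nc_step x d :=
  [/\ d != 0, dot (grad f x) d <= 0 & quad (hess f x) d = - enorm d ^+ 3].

Lemma sol_model x d s : level x -> sol_direction x d -> 0 <= s <= 1 ->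
  model x d s <=
  s * enorm d ^+ 2 * (LH / 6 * (s ^+ 2 * enorm d) - eps * (1 + s / 2)).
Proof.
move=> /level_LH_ge0 L0 [d0 gd hQ _] s01.
have HE : quad (hess f x) d = quad (damped (hess f x) eps) d - 2 * eps * enorm d ^+ 2.
  by rewrite /damped quad_addM quad_scalar enorm_sqr addrK.
rewrite /model gd HE; apply: sol_model_le => //; last by rewrite enorm_sqr.
Qed.

Lemma sol_region x d b : level x -> sol_direction x d -> 0 < b <= 1 ->
  (LH + eta) * (b ^+ 2 * enorm d) <= 6 * eps ->
  (forall s, 0 <= s <= b -> level (x + s *: d)) /\
  f (x + b *: d) < f x - eta / 6 * b ^+ 3 * enorm d ^+ 3.
Proof.
move=> lx sol /andP[b0 b1] hb.
have L0 := level_LH_ge0 lx.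
have D0 : 0 < enorm d by rewrite enorm_gt0; case: sol.
have hm s : 0 <= s <= b -> model x d s <= 0.
  move=> /andP[s0 sb]; apply: le_trans (sol_model lx sol _) _.
    by rewrite s0 (le_trans sb).
  apply: mulr_ge0_le0; first by rewrite mulr_ge0 ?sqr_ge0.
  rewrite subr_le0.
  apply: (@le_trans _ _ eps); last by rewrite ler_peMr ?(ltW eps0) // lerDl divr_ge0.
  have : LH * (s ^+ 2 * enorm d) <= (LH + eta) * (b ^+ 2 * enorm d).
    apply: ler_pM => //; rewrite ?mulr_ge0 ?sqr_ge0 ?enorm_ge0 ?lerDl ?(ltW eta0) //.
    by rewrite ler_wpM2r ?enorm_ge0 // lerXn2r ?nnegrE // ltW.
  by lra.
have reg := model_upper_bound lx (ltW b0) hm.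
split; first by move=> s /reg[].
have [_ hf] : level (x + b *: d) /\ f (x + b *: d) <= f x + model x d b.
  by apply: reg; rewrite (ltW b0) lexx.
apply: le_lt_trans hf _; rewrite ltrD2l.
apply: le_lt_trans (sol_model lx sol _) _; first by rewrite (ltW b0).
have E : b * enorm d ^+ 2 * (LH / 6 * (b ^+ 2 * enorm d) - eps * (1 + b / 2)) +
   eta / 6 * b ^+ 3 * enorm d ^+ 3 =
   b * enorm d ^+ 2 * ((LH + eta) * (b ^+ 2 * enorm d) / 6 - eps * (1 + b / 2)) by ring.
rewrite -subr_lt0 opprK E pmulr_rlt0 ?mulr_gt0 ?exprn_gt0 //.
have : 0 < eps * b by rewrite mulr_gt0.
by lra.
Qed.

Lemma nc_region x d b : level x -> nc_step x d -> 0 < b ->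
  (LH + eta) * b < 3 ->
  f (x + b *: d) < f x - eta / 6 * b ^+ 3 * enorm d ^+ 3.
Proof.
move=> lx [d0 gd qd] b0 hb.
have L0 := level_LH_ge0 lx.
have D0 : 0 < enorm d by rewrite enorm_gt0.
have model_le s : 0 <= s -> model x d s <= s ^+ 2 * enorm d ^+ 3 * (LH / 6 * s - 1 / 2).
  by move=> s0; rewrite /model qd; apply: nc_model_le; rewrite ?enorm_ge0.
have hm s : 0 <= s <= b -> model x d s <= 0.
  move=> /andP[s0 sb]; apply: le_trans (model_le s s0) _.
  apply: mulr_ge0_le0; first by rewrite mulr_ge0 ?sqr_ge0 // exprn_ge0 // enorm_ge0.
  have : LH * s <= (LH + eta) * b by apply: ler_pM; rewrite // lerDl ltW.
  by lra.
have [_ hf] : level (x + b *: d) /\ f (x + b *: d) <= f x + model x d b.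
  by apply: (model_upper_bound lx (ltW b0) hm); rewrite (ltW b0) lexx.
apply: le_lt_trans hf _; rewrite ltrD2l.
apply: le_lt_trans (model_le b (ltW b0)) _.
have E : b ^+ 2 * enorm d ^+ 3 * (LH / 6 * b - 1 / 2) + eta / 6 * b ^+ 3 * enorm d ^+ 3 =
   b ^+ 2 * enorm d ^+ 3 * ((LH + eta) * b / 6 - 1 / 2) by ring.
rewrite -subr_lt0 opprK E pmulr_rlt0 ?mulr_gt0 ?exprn_gt0 //.
by lra.
Qed.

Let th_gt0 j : 0 < th ^+ j. Proof. by rewrite exprn_gt0 //; case/andP: th01. Qed.
Let th_le1 j : th ^+ j <= 1.
Proof. by case/andP: th01 => t0 t1; rewrite exprn_ile1 // ltW. Qed.

Lemma sol_accepts x d : level x -> sol_direction x d -> exists j, accepts pr f x d j.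
Proof.
move=> lx sol; have L0 := level_LH_ge0 lx; have Le : 0 < LH + eta by rewrite ltr_wpDl.
have D0 : 0 < enorm d by rewrite enorm_gt0; case: sol.
have q0 : 0 < 6 * eps / ((LH + eta) * enorm d) by rewrite !(divr_gt0, mulr_gt0).
have [j hj] := geometric_small th01 q0; exists j.
have [] // := @sol_region x d (th ^+ j) lx sol; first by rewrite th_gt0 th_le1.
apply: (@le_trans _ _ ((LH + eta) * enorm d * th ^+ j)).
  rewrite expr2 -mulrA [th ^+ j * (th ^+ j * enorm d)]mulrC -!mulrA ler_pM2l //.
  rewrite [th ^+ j * (_ * _)]mulrC -mulrA ler_pM2l //.
  by rewrite -[leRHS]mulr1 ler_pM2l.
by rewrite ltr_pdivlMr ?mulr_gt0 // mulrC in hj; exact: ltW.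
Qed.

Lemma nc_accepts x d : level x -> nc_step x d -> exists j, accepts pr f x d j.
Proof.
move=> lx nc; have L0 := level_LH_ge0 lx; have Le : 0 < LH + eta by rewrite ltr_wpDl.
have q0 : 0 < 3 / (LH + eta) by rewrite divr_gt0.
have [j hj] := geometric_small th01 q0; exists j.
by apply: nc_region => //; rewrite mulrC -ltr_pdivlMr.
Qed.

(** By nc_region the last rejected step length is at least 3 / (LH + eta). *)
Lemma nc_decrease x d j : level x -> nc_step x d -> accepts pr f x d j ->
  (forall i, (i < j)%N -> ~ accepts pr f x d i) ->
  f (trial pr x d j) < f x - c_nc th eta LH * enorm d ^+ 3.
Proof.
move=> lx nc acc rej; apply: lt_le_trans acc _.
have L0 := level_LH_ge0 lx; have Le : 0 < LH + eta by rewrite ltr_wpDl.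
have D0 : 0 < enorm d by rewrite enorm_gt0; case: nc.
rewrite lerD2l lerN2 ler_pM2r ?exprn_gt0 // /c_nc ler_pM2l ?divr_gt0 //.
case: j rej => [|j] rej; first by rewrite expr0 expr1n ge_min lexx.
rewrite ge_min; apply/orP; right.
have h : 3 / (LH + eta) <= th ^+ j.
  rewrite leNgt; apply/negP => h; apply: (rej j) => //.
  by apply: nc_region => //; rewrite mulrC -ltr_pdivlMr.
have [t0 _] := andP th01.
have -> : 27 * th ^+ 3 / (LH + eta) ^+ 3 = (th * (3 / (LH + eta))) ^+ 3.
  by field; rewrite gt_eqF.
have q0 : 0 <= 3 / (LH + eta) by apply: divr_ge0; rewrite // ltW.
rewrite [th ^+ j.+1]exprS; apply: lerXn2r; rewrite ?nnegrE.
- by rewrite mulr_ge0 // ltW.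
- by rewrite mulr_ge0 // ltW.
- by rewrite ler_pM2l.
Qed.

(** If a trial was rejected, sol_region makes the step long; this applies to the
    unit step and to the last rejected step, whose bounds are multiplied. If the
    unit step was accepted and is not long by itself, its segment stays in N, and
    the first-order Taylor formula for the gradient shows that a large gradient at
    the new point requires a long step. *)
Lemma sol_decrease x d j : level x -> sol_direction x d -> accepts pr f x d j ->
  (forall i, (i < j)%N -> ~ accepts pr f x d i) ->
  epsg < enorm (grad f (trial pr x d j)) ->
  f (trial pr x d j) < f x - c_sol th zeta eta LH * Num.min (epsg / eps) eps ^+ 3.
Proof.
move=> lx sol acc rej hg; apply: lt_le_trans acc _.
have L0 := level_LH_ge0 lx; have Le : 0 < LH + eta by rewrite ltr_wpDl.
have [t0 t1] := andP th01; have [z0 z1] := andP zeta01.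
have D0 : 0 < enorm d by rewrite enorm_gt0; case: sol.
have m0 : 0 < Num.min (epsg / eps) eps by rewrite lt_min divr_gt0.
have me : Num.min (epsg / eps) eps <= eps by rewrite ge_min lexx orbT.
set m := Num.min _ _ in m0 me *; set al := th ^+ j.
have al0 : 0 < al by exact: th_gt0.
rewrite lerD2l lerN2 /c_sol -[leRHS]mulrA -[leLHS]mulrA ler_pM2l ?divr_gt0 // -exprMn.
have long : 6 * th * eps / (LH + eta) <= al * enorm d ->
   Num.min ((4 / (Num.sqrt ((4 + zeta) ^+ 2 + 8 * LH) + 4 + zeta)) ^+ 3)
     ((3 * th ^+ 2 * (1 - zeta) / (LH + eta)) ^+ 3) * m ^+ 3 <= (al * enorm d) ^+ 3.
  move=> h; apply: (@le_trans _ _ ((3 * th ^+ 2 * (1 - zeta) / (LH + eta)) ^+ 3 * m ^+ 3)).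
    by rewrite ler_pM2r ?exprn_gt0 // ge_min lexx orbT.
  have z1' : 0 <= 1 - zeta by rewrite subr_ge0 ltW.
  have a0 : 0 <= th ^+ 2 * (1 - zeta) by apply: mulr_ge0; rewrite ?sqr_ge0.
  have a1 : th ^+ 2 * (1 - zeta) <= th.
    apply: (@le_trans _ _ (th ^+ 2)); first by rewrite ler_piMr ?sqr_ge0 // gerBl ltW.
    by rewrite expr2 ler_piMl // ltW.
  have p0 : 0 <= 3 * th ^+ 2 * (1 - zeta) / (LH + eta).
    by apply: divr_ge0; [rewrite -mulrA mulr_ge0 | exact: ltW].
  rewrite -exprMn; apply: lerXn2r; rewrite ?nnegrE.
  - by apply: mulr_ge0 => //; exact: ltW.
  - by apply: mulr_ge0; exact: ltW.
  apply: le_trans h; rewrite mulrAC ler_pM2r ?invr_gt0 //.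
  have : th ^+ 2 * (1 - zeta) * m <= th * eps by apply: ler_pM => //; exact: ltW.
  by have := mulr_gt0 t0 eps0; lra.
have unit_rejected : 6 * eps < (LH + eta) * enorm d -> 6 * eps / (LH + eta) < enorm d.
  by rewrite ltr_pdivrMr // [enorm d * _]mulrC.
have short_step : forall i, (i < j)%N -> 6 * eps < (LH + eta) * ((th ^+ i) ^+ 2 * enorm d).
  move=> i ij; rewrite ltNge; apply/negP => h; apply: (rej i ij).
  by have [] := sol_region lx sol _ h; first by rewrite th_gt0 th_le1.
case: (posnP j) => [j0|j0]; last first.
  apply: long.
  have h0 : 6 * eps / (LH + eta) < enorm d.
    by apply: unit_rejected; have := short_step 0%N j0; rewrite expr0 expr1n mul1r.
  have h1 : 6 * eps / (LH + eta) < (th ^+ j.-1) ^+ 2 * enorm d.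
    rewrite ltr_pdivrMr // [_ * (LH + eta)]mulrC.
    by apply: short_step; rewrite ltn_predL.
  have alE : al = th * th ^+ j.-1 by rewrite -exprS prednK.
  have q0 : 0 <= 6 * eps / (LH + eta) by rewrite divr_ge0 ?mulr_ge0 ?ltW.
  have q1 : 0 <= 6 * th * eps / (LH + eta).
    by apply: divr_ge0; [apply: mulr_ge0; [apply: mulr_ge0 => //|]|]; exact: ltW.
  rewrite -ler_sqr ?nnegrE ?q1 ?mulr_ge0 ?(ltW al0) ?(ltW D0) //.
  have -> : (6 * th * eps / (LH + eta)) ^+ 2 =
      th ^+ 2 * (6 * eps / (LH + eta) * (6 * eps / (LH + eta))) by field; rewrite gt_eqF.
  have -> : (al * enorm d) ^+ 2 = th ^+ 2 * ((th ^+ j.-1) ^+ 2 * enorm d * enorm d).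
    by rewrite alE; ring.
  by rewrite ler_pM2l ?exprn_gt0 // ler_pM // ltW.
have al1 : al = 1 by rewrite /al j0.
have [hl|hs] := ltP (6 * eps) ((LH + eta) * enorm d).
  apply: long; rewrite al1 mul1r; apply: le_trans (ltW (unit_rejected hl)).
  rewrite ler_pM2r ?invr_gt0 // mulrAC ler_piMr ?mulr_ge0 ?ltW //.
have [reg _] : (forall s, 0 <= s <= 1 -> level (x + s *: d)) /\
    f (x + 1 *: d) < f x - eta / 6 * 1 ^+ 3 * enorm d ^+ 3.
  by apply: sol_region => //; rewrite ?ltr01 ?lexx // expr1n mul1r.
have seg : forall s, 0 <= s <= 1 -> N (x + s *: d) by move=> s /reg/level_N.
have tg := taylor_grad_norm smooth n_gt0 seg.
have yE : trial pr x d j = x + d by rewrite /trial -/th j0 expr0 scale1r.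
have [_ _ _ hr] := sol.
have gy : enorm (grad f (x + d)) <=
    LH / 2 * enorm d ^+ 2 + (zeta / 2 * eps * enorm d + 2 * eps * enorm d).
  have -> : grad f (x + d) = (grad f (x + d) - grad f x - hess f x *m d) +
     ((damped (hess f x) eps *m d + grad f x) + - ((2 * eps) *: d)).
    rewrite /damped mulmxDl mul_scalar_mx.
    move: (grad f (x + d)) (grad f x) (hess f x *m d) ((2 * eps) *: d) => a b c e.
    by apply/matrixP => k l; rewrite !mxE; ring.
  apply: le_trans (enormD _ _) _; apply: lerD => //.
  apply: le_trans (enormD _ _) _; apply: lerD => //.
  by rewrite enormN enormZ gtr0_norm // mulr_gt0.
have hD : 4 / (Num.sqrt ((4 + zeta) ^+ 2 + 8 * LH) + 4 + zeta) * m <= enorm d.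
  apply: sol_unit_step_length => //.
  by rewrite yE in hg; move: (lt_le_trans hg gy); move: (enorm d) => *; lra.
have p0 : 0 < 4 / (Num.sqrt ((4 + zeta) ^+ 2 + 8 * LH) + 4 + zeta).
  by rewrite divr_gt0 // -addrA ltr_wpDl ?sqrtr_ge0 // addr_gt0.
rewrite al1 mul1r.
apply: (@le_trans _ _ ((4 / (Num.sqrt ((4 + zeta) ^+ 2 + 8 * LH) + 4 + zeta)) ^+ 3 * m ^+ 3)).
  by rewrite ler_pM2r ?exprn_gt0 // ge_min lexx.
rewrite -exprMn; apply: lerXn2r; rewrite ?nnegrE //; last exact: ltW.
by apply: mulr_ge0; exact: ltW.
Qed.

End Step.

(** * Executions of Damped Newton-CG *)

Section NegativeCurvature.
Context (R : realType) (n : nat).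
Implicit Types (H : 'M[R]_n) (g d : 'cV[R]_n).

Lemma eig_direction_unit H g d : enorm d = 1 -> eig_direction H g d = nc_direction H g d.
Proof. by move=> d1; rewrite /nc_direction d1 invr1 scale1r /eig_direction d1. Qed.

(** The length is chosen so that the cubic and the quadratic term of the
    Taylor model along the direction are comparable. *)
Lemma nc_directionP H g d : d != 0 -> quad H d < 0 ->
  [/\ enorm (nc_direction H g d) = - quad H d / enorm d ^+ 2,
      dot g (nc_direction H g d) <= 0 &
      quad H (nc_direction H g d) = - enorm (nc_direction H g d) ^+ 3].
Proof.
move=> d0 qd; have D0 : 0 < enorm d by rewrite enorm_gt0.
set l := - quad H d / enorm d ^+ 2.
have l0 : 0 < l by rewrite divr_gt0 ?exprn_gt0 // oppr_gt0.
have E : nc_direction H g d = (- (sgn1 (dot d g) * l / enorm d)) *: d.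
  by rewrite /nc_direction scalerA ltr0_norm // mulNr.
have sg : `|sgn1 (dot d g)| = 1.
  by rewrite /sgn1; case: ifP => _; rewrite ?normrN1 ?normr1.
have s2 : sgn1 (dot d g) ^+ 2 = 1.
  by rewrite /sgn1; case: ifP => _; rewrite ?sqrrN expr1n.
have nE : enorm (nc_direction H g d) = l.
  rewrite E enormZ normrN normrM normrM sg mul1r normfV !gtr0_norm // divfK ?gt_eqF //.
split=> //.
  rewrite E dotZr dotC mulNr oppr_le0 mulrAC mulr_ge0 ?invr_ge0 ?(ltW D0) //.
  rewrite mulrAC mulr_ge0 ?(ltW l0) // /sgn1; case: ltP => h; last by rewrite mul1r.
  by rewrite mulN1r oppr_ge0 ltW.
have qE : quad H d = - (l * enorm d ^+ 2).
  by rewrite /l divfK ?opprK // expf_eq0 gt_eqF.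
rewrite nE E quadZ qE; move: s2 D0; clear.
move: (sgn1 _) (enorm d) l => s D l s2 D0.
have -> : - l ^+ 3 = - (s ^+ 2 * l ^+ 3) by rewrite s2 mul1r.
by field; rewrite gt_eqF.
Qed.

End NegativeCurvature.

(** An iteration that calls the oracle may cost m + 1, because m only covers the
    products; at most q + 1 iterations do so, and the slack between their total
    number k + 1 <= 2 q + 2 and K pays for them. *)
Lemma total_cost_le (m c k q h K : nat) : (1 < m)%N -> (c <= m * k + q)%N ->
  (h <= m)%N -> (k <= 2 * q + 1)%N -> (3 * q + 2 <= K)%N ->
  ((0 < k)%N -> (3 <= K)%N) -> (c + (h + 1) <= m * K)%N.
Proof.
move=> m2 hc hh kq qK kK.
have [k0|k0] := posnP k; first by move: kK => _; nia.
have {}kK := kK k0.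
have [q0|q0] := posnP q; nia.
Qed.

Lemma step_cost_le (m c k q h b : nat) : (c <= m * k + q)%N -> (h <= m + b)%N ->
  (c + h <= m * k.+1 + (q + b))%N.
Proof. by move=> hc hh; nia. Qed.

Lemma two_steps_le (k q : nat) (b b' : bool) :
  (k <= 2 * q + b)%N -> (k.+1 <= 2 * q.+1 + b')%N.
Proof. by case: b; case: b'; lia. Qed.

Lemma two_steps_lt (k q K : nat) (b : bool) :
  (k <= 2 * q + b)%N -> (3 * q + 2 <= K)%N -> (k < K)%N.
Proof. by case: b; lia. Qed.

Section Constants.
Context (R : realType) (theta zeta eta LH : R).
Hypotheses (theta01 : 0 < theta < 1) (zeta01 : 0 < zeta < 1) (eta0 : 0 < eta).
Hypothesis (LH0 : 0 <= LH).

Let Le : 0 < LH + eta. Proof. by rewrite ltr_wpDl. Qed.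

Lemma c_sol_gt0 : 0 < c_sol theta zeta eta LH.
Proof.
have [t0 _] := andP theta01; have [z0 z1] := andP zeta01.
rewrite /c_sol mulr_gt0 ?divr_gt0 // lt_min !exprn_gt0 //.
  by rewrite !(divr_gt0, mulr_gt0) // ?exprn_gt0 // subr_gt0.
by rewrite divr_gt0 // -addrA ltr_wpDl ?sqrtr_ge0 // addr_gt0.
Qed.

Lemma c_nc_gt0 : 0 < c_nc theta eta LH.
Proof.
have [t0 _] := andP theta01.
by rewrite /c_nc mulr_gt0 ?divr_gt0 // lt_min ltr01 divr_gt0 ?mulr_gt0 ?exprn_gt0.
Qed.

Lemma decrease_constant_gt0 :
  0 < Num.min (c_sol theta zeta eta LH) (c_nc theta eta LH / 8).
Proof. by rewrite lt_min c_sol_gt0 divr_gt0 ?c_nc_gt0. Qed.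

End Constants.

Section Execution.
Context (R : realType) (n : nat) (f : 'cV[R]_n -> R) (N : set 'cV[R]_n) (LH : R).
Context (n_gt0 : (0 < n)%N) (smooth : lipschitz_hessian f N LH).
Context (x0 : 'cV[R]_n).
Hypotheses (level_closed : closed [set x | f x <= f x0])
  (level_N : [set x | f x <= f x0] `<=` N).
Context (pr : dncg_params R).
Let epsg := par_epsg pr.
Let eps := par_epsH pr.
Let th := par_theta pr.
Let zeta := par_zeta pr.
Let eta := par_eta pr.
Hypotheses (epsg0 : 0 < epsg) (eps0 : 0 < eps) (th01 : 0 < th < 1)
  (zeta01 : 0 < zeta < 1) (eta0 : 0 < eta) (M_ge0 : 0 <= start_M pr).
Context (UH flow : R) (Nmeo : nat).
Hypotheses (UH0 : 0 <= UH) (flow_le : forall x, f x <= f x0 -> flow <= f x).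
Implicit Types (x d y : 'cV[R]_n).
Local Opaque grad hess dot enorm quad opnorm.

Let level x := f x <= f x0.
Let scale := Num.min (epsg / eps) eps.

(** The decrease that is guaranteed except in steps to points of small
    gradient. *)
Definition unit_decrease :=
  Num.min (c_sol th zeta eta LH) (c_nc th eta LH / 8) * scale ^+ 3.

Let LH0 : 0 <= LH.
Proof. exact: (level_LH_ge0 n_gt0 smooth level_N (lexx (f x0))). Qed.

Let scale0 : 0 < scale. Proof. by rewrite lt_min divr_gt0. Qed.

Let cmin0 : 0 < Num.min (c_sol th zeta eta LH) (c_nc th eta LH / 8).
Proof. exact: decrease_constant_gt0. Qed.

Lemma unit_decrease_gt0 : 0 < unit_decrease.
Proof. by rewrite mulr_gt0 ?exprn_gt0. Qed.

Lemma sol_unit_decrease : unit_decrease <= c_sol th zeta eta LH * scale ^+ 3.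
Proof. by rewrite ler_pM2r ?exprn_gt0 // ge_min lexx. Qed.

Lemma nc_unit_decrease (l : R) : eps / 2 <= l -> unit_decrease <= c_nc th eta LH * l ^+ 3.
Proof.
move=> hl; apply: (@le_trans _ _ (c_nc th eta LH / 8 * eps ^+ 3)).
  apply: ler_pM; rewrite ?ge_min ?lexx ?orbT ?(ltW cmin0) ?exprn_ge0 ?(ltW scale0) //.
  by rewrite lerXn2r ?nnegrE ?(ltW scale0) ?(ltW eps0) // ge_min lexx orbT.
have -> : c_nc th eta LH / 8 * eps ^+ 3 = c_nc th eta LH * (eps / 2) ^+ 3 by field.
rewrite ler_pM2l; last exact: c_nc_gt0.
rewrite lerXn2r ?nnegrE ?divr_ge0 ?(ltW eps0) //.
by apply: le_trans hl; rewrite divr_ge0 // ltW.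
Qed.

Let J := J_cap UH eps zeta.
Let K2 := K2_bar th zeta eta LH (f x0 - flow) epsg eps.
Let iter_cost := maxn (2 * minn n J + 2) Nmeo.

Lemma K2_bound q x : level x -> f x + q%:R * unit_decrease <= f x0 ->
  (3 * q + 2 <= K2)%N /\ (f x < f x0 -> (3 <= K2)%N).
Proof.
move=> lx hq; rewrite /K2 /K2_bar.
set X := _ / _ * _.
have D0 := unit_decrease_gt0.
have maxE : Num.max (epsg ^- 3 * eps ^+ 3) (eps ^- 3) = scale ^- 3.
  have -> : epsg ^- 3 * eps ^+ 3 = (epsg / eps) ^- 3 by field; rewrite !gt_eqF.
  have r0 : 0 < epsg / eps by rewrite divr_gt0.
  rewrite /scale; case: (leP (epsg / eps) eps) => h.
    apply/max_l; rewrite lef_pV2 ?posrE ?exprn_gt0 ?divr_gt0 //.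
    by apply: lerXn2r; rewrite ?nnegrE ?(ltW eps0) ?(ltW r0).
  apply/max_r; rewrite lef_pV2 ?posrE ?exprn_gt0 ?divr_gt0 //.
  by apply: lerXn2r; rewrite ?nnegrE ?(ltW eps0) ?(ltW r0) ?(ltW h).
have XE : X = 3 * (f x0 - flow) / unit_decrease.
  rewrite /X maxE /unit_decrease; move: scale0 cmin0; move: scale (Num.min _ _) => s c s0 c0.
  by field; rewrite !gt_eqF.
have gap : flow <= f x by exact: flow_le.
have X0 : 0 <= X.
  by rewrite XE divr_ge0 ?(ltW D0) // mulr_ge0 // subr_ge0; apply: flow_le.
have Xc : X <= (absz (Num.ceil X))%:R.
  by rewrite natr_absz ger0_norm ?ceil_ge // ceil_ge0 (lt_le_trans _ X0) // ltrN10.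
split=> [|fx].
  rewrite leq_add2r -(ler_nat R); apply: le_trans Xc.
  by rewrite XE ler_pdivlMr // natrM -mulrA ler_pM2l //; lra.
rewrite -[3%N]/(1 + 2)%N leq_add2r -(ltr_nat R); apply: lt_le_trans Xc.
rewrite XE divr_gt0 // mulr_gt0 // subr_gt0; lra.
Qed.

Definition values_bounded x := forall M,
  cg_M_value (hess f x) (grad f x) eps zeta (start_M pr) M -> M <= UH.

(** Only a step with d_type SOL can achieve less than the full decrease, and only
    if the new gradient is so small that the oracle is called next. *)
Lemma iteration_spec x c h s : level x -> (calls_cg pr f x -> values_bounded x) ->
  decides pr f x c h -> successor pr f x c s ->
  [/\ (h + 1 <= 2 * minn n J + 2)%N \/ calls_oracle pr f x &
   [/\ c = Certify _ _, s = Stopped x & calls_oracle pr f x] \/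
   exists y, [/\ s = Running y, f y < f x &
     f y + unit_decrease <= f x \/ calls_cg pr f x /\ calls_oracle pr f y]].
Proof.
move=> lx hM hdec hsucc.
have Nx : N x := level_N lx.
have Hsym := hess_sym smooth n_gt0 Nx.
have step d : successor pr f x (Move d) s -> (exists j, accepts pr f x d j) ->
    exists j, [/\ s = Running (trial pr x d j), accepts pr f x d j &
      forall i, (i < j)%N -> ~ accepts pr f x d i].
  move E : (Move d) => c' hs; case: hs E => // d'.
    by move=> j acc rej [->] _; exists j.
  by move=> no [->] [j /no].
have acc_lt d j : d != 0 -> accepts pr f x d j -> f (trial pr x d j) < f x.
  move=> d0 /lt_le_trans; apply; rewrite gerBl.
  have [t0 _] := andP th01.
  by rewrite !mulr_ge0 ?exprn_ge0 ?invr_ge0 ?enorm_ge0 ?exprn_ge0 ?ltW.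
have nc d : enorm d >= eps / 2 -> nc_step f x d -> successor pr f x (Move d) s ->
    exists y, [/\ s = Running y, f y < f x & f y + unit_decrease <= f x].
  move=> hd ncd hs; have [j [sE acc rej]] := step d hs
    (nc_accepts n_gt0 smooth level_closed level_N th01 eta0 lx ncd).
  exists (trial pr x d j); split=> //; first by apply: acc_lt => //; case: ncd.
  have := nc_decrease n_gt0 smooth level_closed level_N th01 eta0 lx ncd acc rej.
  have := nc_unit_decrease hd; rewrite -/th -/eta; lra.
have reached_M j : calls_cg pr f x -> cg_reaches (hess f x) (grad f x) eps zeta (start_M pr) j ->
    cg_M (hess f x) (grad f x) eps (start_M pr) j <= UH.
  by move=> cx hr; apply: (hM cx); apply: Or33; exists j.
have g0 : calls_cg pr f x -> grad f x != 0.
  by rewrite -enorm_gt0; apply: lt_trans.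
have cost d t k : calls_cg pr f x -> cg_call pr f x d t k -> (k + 1 <= 2 * minn n J + 2)%N.
  move=> cx hk; have hMr i := reached_M i cx.
  have := capped_cg_cost Hsym (g0 cx) eps0 zeta01 M_ge0 n_gt0 hMr UH0 hk.
  by rewrite -(leq_add2r 1) -addnA.
case: hdec hsucc => {c h} [d h cx hd|d h cx hd|h cx hd|v h ox v1 hv|h ox] hs.
- split; first by left; exact: cost hd.
  have sol : sol_direction f pr x d by exact: (capped_cg_SOL Hsym (g0 cx) eps0 zeta01 M_ge0 hd).
  have [j [sE acc rej]] := step d hs
    (sol_accepts n_gt0 smooth level_closed level_N eps0 th01 eta0 lx sol).
  right; exists (trial pr x d j); split=> //; first by apply: acc_lt => //; case: sol.
  have [og|gg] := leP (enorm (grad f (trial pr x d j))) epsg; first by right.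
  left; have := sol_decrease n_gt0 smooth level_closed level_N epsg0 eps0 th01 zeta01
    eta0 lx sol acc rej gg.
  have := sol_unit_decrease; rewrite /scale -/th -/zeta -/eta -/epsg -/eps; lra.
- split; first by left; exact: cost hd.
  have := capped_cg_NC hd; rewrite /neg_curv /damped quad_addM quad_scalar.
  rewrite enorm_sqr => hneg.
  have d0 : d != 0.
    by apply/eqP => d0; move: hneg; rewrite d0 dot0r !mulr0 quadE dot0l add0r ltxx.
  have D0 : 0 < dot d d by rewrite dot_gt0.
  have hneg' : quad (hess f x) d < - (eps * dot d d).
    by move: hneg; rewrite -/eps; lra.
  have eD : 0 < eps * dot d d by rewrite mulr_gt0.
  have qneg : quad (hess f x) d < 0 by lra.
  have [nE gd qd] := nc_directionP (grad f x) d0 qneg.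
  have len : eps / 2 <= enorm (nc_direction (hess f x) (grad f x) d).
    rewrite nE enorm_sqr ler_pdivlMr //; lra.
  have [|y [sE fy dy]] := nc _ len _ hs.
    by split=> //; rewrite -enorm_gt0; apply: lt_le_trans len; rewrite divr_gt0.
  by right; exists y; split=> //; left.
- have [d [t [k hk]]] := capped_cg_returns Hsym (g0 cx) eps0 zeta01 M_ge0.
  by case: (hd d t k).
- split; first by right.
  have v0 : v != 0 by rewrite -enorm_gt0 v1.
  have qneg : quad (hess f x) v < 0 by apply: le_lt_trans hv _; rewrite oppr_lt0 divr_gt0.
  rewrite eig_direction_unit // in hs.
  have [nE gd qd] := nc_directionP (grad f x) v0 qneg.
  have len : eps / 2 <= enorm (nc_direction (hess f x) (grad f x) v).
    by rewrite nE v1 expr1n divr1 lerNr.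
  have [|y [sE fy dy]] := nc _ len _ hs.
    by split=> //; rewrite -enorm_gt0; apply: lt_le_trans len; rewrite divr_gt0.
  by right; exists y; split=> //; left.
- split; first by right.
  left; split=> //.
  by move E : (Certify _ _) hs => c' hs; case: hs E.
Qed.

Section OneExecution.
Context (w : history R n).
Hypothesis exec : is_execution pr f x0 w.
Hypothesis bounded : forall k x, state_at w k = Running x -> calls_cg pr f x ->
  values_bounded x.

Let running_before k := forall i, (i < k)%N -> exists y, state_at w i = Running y.
Let cost k := (\sum_(i < k) (hvp_at w i + 1))%N.

Lemma running_level k x : state_at w k = Running x -> level x.
Proof.
elim: k x => [|k IH] x.
  by have [-> _] := exec => -[<-]; exact: lexx.
move=> hx; have := exec.2 k; case hk : (state_at w k) => [z|z|]; last 2 first.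
- by rewrite hx.
- by rewrite hx.
move=> [hd hs]; have lz := IH z hk.
have [_ [[_ sE _]|[y [sE fy _]]]] := iteration_spec lz (bounded hk) hd hs.
  by rewrite hx in sE.
by move: sE; rewrite hx => -[->]; exact: ltW (lt_le_trans fy lz).
Qed.

Definition stops_by k x :=
  [/\ state_at w k.+1 = Stopped x, state_at w k = Running x,
      decision_at w k = Certify _ _, running_before k.+1 & calls_oracle pr f x].

(** q counts the iterations with a full decrease; a step without one leads to a
    call of the oracle, so that k <= 2 q + 1. The q at the end of the cost is
    for the gradients evaluated along with calls of the oracle. *)
Definition progress k := exists x q,
  [/\ state_at w k = Running x, running_before k,
      f x + q%:R * unit_decrease <= f x0,
      (0 < k)%N -> f x < f x0 &
      (k <= 2 * q + `[< calls_oracle pr f x >])%N /\ (cost k <= iter_cost * k + q)%N].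

Lemma progressS k : progress k ->
  (oracle_called pr f w k -> (hvp_at w k <= Nmeo)%N) ->
  progress k.+1 \/ exists2 x, stops_by k x & (cost k.+1 <= iter_cost * K2)%N.
Proof.
move=> [x [q [hx run hq f0 [kq ck]]]] hN.
have lx := running_level hx.
have := exec.2 k; rewrite hx => -[hd hs].
have [hcost hstep] := iteration_spec lx (bounded hx) hd hs.
have [K2q K2f] := K2_bound lx hq.
have m2 : (2 * minn n J + 2 <= iter_cost)%N by rewrite leq_maxl.
have mN : (Nmeo <= iter_cost)%N by rewrite leq_maxr.
have run' : running_before k.+1.
  by move=> i; rewrite ltnS leq_eqVlt => /orP[/eqP ->|/run //]; exists x.
have costS : cost k.+1 = (cost k + (hvp_at w k + 1))%N by rewrite /cost big_ord_recr.
have oracle_cost : calls_oracle pr f x -> (hvp_at w k <= iter_cost)%N.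
  by move=> ox; apply: leq_trans mN; apply: hN; exists x.
case: hstep => [[cE sE ox]|[y [sE fy dy]]].
  right; exists x; first by split.
  rewrite costS; apply: (@total_cost_le _ _ k q) => //.
  - by apply: leq_trans m2; rewrite addn2.
  - exact: oracle_cost.
  - by apply: leq_trans kq _; rewrite leq_add2l leq_b1.
  - by move=> k0; exact: K2f (f0 k0).
left.
have cond : calls_oracle pr f x -> f y + unit_decrease <= f x.
  by move=> ox; case: dy => // -[cx _]; move: cx; rewrite /calls_cg ltNge ox.
have cx' : ~ calls_oracle pr f x -> (hvp_at w k + 1 <= iter_cost)%N.
  by case: hcost => // h _; exact: leq_trans h m2.
have [full|part] : f y + unit_decrease <= f x \/
    (~ calls_oracle pr f x /\ calls_oracle pr f y).
  case: dy; [by left | move=> [cx oy]; right; split=> // ox].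
  by move: cx; rewrite /calls_cg ltNge ox.
- exists y, q.+1; split; [exact: sE | exact: run' | | |].
  + by rewrite -natr1 mulrDl mul1r; lra.
  + by move=> _; apply: lt_le_trans fy lx.
  split; first exact: two_steps_le kq.
  have : (hvp_at w k <= iter_cost)%N.
    have [/oracle_cost //|/cx' h] := pselect (calls_oracle pr f x).
    by apply: leq_trans h; rewrite leq_addr.
  by rewrite costS -[q.+1]addn1 => h; apply: step_cost_le; rewrite // leq_add2r.
- have [nox oy] := part.
  exists y, q; split; [exact: sE | exact: run' | | |].
  + by apply: le_trans hq; rewrite lerD2r ltW.
  + by move=> _; apply: lt_le_trans fy lx.
  split.
    rewrite (asboolT oy) addn1 ltnS; move: kq.
    by rewrite (asboolF nox) addn0.
  rewrite costS -[q in leqRHS]addn0; apply: step_cost_le; rewrite // addn0.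
  exact: cx'.
Qed.

(** As progress k entails k < K2, progress must end, and it only ends in a
    stop. *)
Lemma execution_terminates :
  (forall k, (k < K2)%N -> oracle_called pr f w k -> (hvp_at w k <= Nmeo)%N) ->
  exists k x, [/\ (k < K2)%N, stops_by k x & (cost k.+1 <= iter_cost * K2)%N].
Proof.
move=> hN.
have progress_lt k : progress k -> (k < K2)%N.
  move=> [x [q [hx _ hq _ [kq _]]]]; have [K2q _] := K2_bound (running_level hx) hq.
  exact: two_steps_lt kq K2q.
apply: contrapT => no.
have all k : progress k.
  elim: k => [|k IH].
    exists x0, 0%N; split=> //; first by case: exec.
    - by rewrite mul0r addr0.
    - by split; rewrite // /cost big_ord0.
  have kK := progress_lt k IH.
  have [//|[x st ck]] := progressS IH (hN k kK).
  by case: no; exists k, x.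
by have := progress_lt K2 (all K2); rewrite ltnn.
Qed.

End OneExecution.

End Execution.

(** * Events and their probabilities *)

Section SigmaAlgebra.
Context (T : Type) (G : set (set T)).
Hypothesis sG : sigma_algebra setT G.

Lemma sigma_setC (A : set T) : G A -> G (~` A).
Proof. by move=> GA; rewrite -setTD; case: sG => _ /(_ _ GA). Qed.

Lemma sigma_setT : G setT.
Proof. by rewrite -setC0; apply: sigma_setC; case: sG. Qed.

Lemma sigma_setU (A B : set T) : G A -> G B -> G (A `|` B).
Proof.
move=> GA GB; rewrite -bigcup2E; case: sG => G0 _; apply.
by case=> [//|[//|k]].
Qed.

Lemma sigma_setI (A B : set T) : G A -> G B -> G (A `&` B).
Proof.
move=> GA GB; rewrite -[A `&` B]setCK setCI.
by apply: sigma_setC; apply: sigma_setU; exact: sigma_setC.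
Qed.

Lemma sigma_setD (A B : set T) : G A -> G B -> G (A `\` B).
Proof. by move=> GA GB; rewrite setDE; apply: sigma_setI => //; exact: sigma_setC. Qed.

Lemma sigma_bigcup_cond (P : nat -> Prop) (A : nat -> set T) :
  (forall k, P k -> G (A k)) -> G [set t | exists2 k, P k & A k t].
Proof.
move=> GA; have [G0 _ GU] := sG.
have -> : [set t | exists2 k, P k & A k t] =
    \bigcup_k (if `[< P k >] then A k else set0).
  apply/seteqP; split=> [t [k Pk At]|t [k _]].
    by exists k => //; rewrite asboolT.
  by case: ifPn => // /asboolP Pk At; exists k.
by apply: GU => k; case: ifPn => // /asboolP; exact: GA.
Qed.

End SigmaAlgebra.

Section Success.
Context (d : measure_display) (T : measurableType d) (R : realType).
Context (P : probability T R) (G : nat -> set (set T)) (delta : R).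
Hypotheses (delta01 : 0 <= delta < 1).
Hypotheses (sG : forall k, sigma_algebra setT (G k)).
Hypotheses (mG : forall k A, G k A -> measurable A).
Hypotheses (G_mono : forall k, G k `<=` G k.+1).
Context (C S : nat -> set T).
Hypothesis GC : forall k, G k (C k).
Hypothesis GCS : forall k, G k.+1 (C k `&` S k).
Hypothesis reliable : forall k A, G k A -> A `<=` C k ->
  ((1 - delta)%:E * P A <= P (A `&` S k))%E.

Definition successes K := [set t | forall k, (k < K)%N -> C k t -> S k t].

Let successesS K : successes K.+1 =
  (successes K `\` C K) `|` (successes K `&` C K `&` S K).
Proof.
apply/seteqP; split=> t.
  move=> h; have hK : successes K t by move=> k kK; apply: h; exact: ltnW.
  by have [c|c] := pselect (C K t); [right; split=> //; exact: h | left].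
case=> [[h nc]|[[h c] s]] k; rewrite ltnS leq_eqVlt => /orP[/eqP ->|] //; exact: h.
Qed.

Lemma successes_measurable K : G K (successes K).
Proof.
elim: K => [|K IH].
  have -> : successes 0 = setT by apply/seteqP; split.
  exact: sigma_setT.
rewrite successesS; apply: sigma_setU => //.
  by apply: G_mono; apply: sigma_setD.
by rewrite -setIA; apply: sigma_setI => //; exact: G_mono.
Qed.

(** Whatever happened before, call K succeeds with conditional probability at
    least 1 - delta, and on the part of successes K where the oracle is not called
    nothing is lost. *)
Lemma successes_probability K : (((1 - delta) ^+ K)%:E <= P (successes K))%E.
Proof.
have [d0 d1] := andP delta01.
have e0 : 0 <= 1 - delta by rewrite subr_ge0 ltW.
elim: K => [|K IH].
  have -> : successes 0 = setT by apply/seteqP; split.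
  by rewrite expr0 probability_setT.
have GK := successes_measurable K.
have GCK := GC K.
have mA : measurable (successes K `\` C K) by apply: (@mG K); apply: sigma_setD.
have GB : G K (successes K `&` C K) by apply: sigma_setI.
have mB : measurable (successes K `&` C K `&` S K).
  apply: (@mG K.+1); rewrite -setIA; apply: sigma_setI => //; exact: G_mono.
rewrite successesS measureU //; last first.
  by apply/seteqP; split=> // t [[_ nc] [[_ c] _]].
have rel := reliable GB (@subIsetr _ _ _).
apply: (@le_trans _ _ ((1 - delta)%:E * P (successes K))%E).
  by rewrite exprS EFinM lee_wpmul2l ?lee_fin.
rewrite (measureDI P (mG GK) (mG GCK)) ge0_muleDr ?measure_ge0 //.
apply: leeD => //.
rewrite -[leRHS]mul1e lee_wpmul2r ?measure_ge0 // lee_fin.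
by rewrite gerBl.
Qed.

End Success.

Section OpenConditions.
Context (R : realType) (n : nat) (f : 'cV[R]_n -> R) (N : set 'cV[R]_n) (LH : R).
Context (n_gt0 : (0 < n)%N) (smooth : lipschitz_hessian f N LH).
Implicit Types (x w v : 'cV[R]_n) (c : R).
Local Opaque grad hess dot enorm quad opnorm.

Let oN : open N. Proof. by case: smooth. Qed.

(** The filtration knows the events that an iterate lies in an open set; the calls
    of the oracle and its errors are expressed by this set and the next one. *)
Lemma open_large_grad c : open [set x | N x /\ c < enorm (grad f x)].
Proof.
apply: enorm_open => x [Nx cx].
have L0 := lipschitz_ge0 smooth n_gt0 Nx.
have [e e0 he] := open_enorm oN Nx.
have [b b0 hb] := enorm_mulmx_bounded (hess f x).
have q0 : 0 <= b + LH / 2 by rewrite addr_ge0 // divr_ge0.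
have gap0 : 0 < enorm (grad f x) - c by rewrite subr_gt0.
have [k [k0 k1 kq]] := small_step (@ltr01 R) q0 gap0.
exists (Num.min e k); first by rewrite lt_min e0 k0.
move=> w; rewrite lt_min => /andP[we wk].
have seg t : 0 <= t <= 1 -> N (x + t *: w).
  move=> /andP[t0 t1]; apply: he; rewrite enormZ ger0_norm //.
  by apply: le_lt_trans we; rewrite ler_piMl ?enorm_ge0.
split; first by have := seg 1; rewrite ler01 lexx scale1r; apply.
have := taylor_grad_norm smooth n_gt0 seg.
have := hb w; set g := grad f (x + w); set h := hess f x *m w.
have gE : enorm (grad f x) <= enorm g + (enorm h + enorm (g - grad f x - h)).
  have {1}-> : grad f x = g - (h + (g - grad f x - h)).
    by apply/matrixP => i j; rewrite !mxE; ring.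
  apply: le_trans (enormD _ _) _; rewrite lerD2l enormN; exact: enormD.
have w0 : 0 <= enorm w by exact: enorm_ge0.
have w2 : LH / 2 * enorm w ^+ 2 <= LH / 2 * enorm w.
  rewrite ler_wpM2l ?divr_ge0 // expr2 ler_piMl //.
  by apply: le_trans (ltW wk) k1.
have wq : enorm w * (b + LH / 2) <= k * (b + LH / 2) by rewrite ler_wpM2r // ltW.
by move: gE w2 wq kq; clear; abstract_values; lra.
Qed.

Lemma open_not_psd c : open [set x | N x /\ ~ psd (hess f x + c%:M)].
Proof.
apply: enorm_open => x [Nx npsd].
have L0 := lipschitz_ge0 smooth n_gt0 Nx.
have [e e0 he] := open_enorm oN Nx.
have [v hv] : exists v, quad (hess f x + c%:M) v < 0.
  apply: contrapT => no; apply: npsd => v; rewrite leNgt; apply/negP => h.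
  by apply: no; exists v.
have gap0 : 0 < - quad (hess f x + c%:M) v by rewrite oppr_gt0.
have q0 : 0 <= LH * enorm v ^+ 2 by rewrite mulr_ge0 // sqr_ge0.
have [k [k0 _ kq]] := small_step (@ltr01 R) q0 gap0.
exists (Num.min e k); first by rewrite lt_min e0 k0.
move=> w; rewrite lt_min => /andP[we wk].
have Nw := he w we; split; first exact: Nw.
move=> /(_ v).
have := hess_lipschitz_quad smooth v Nx Nw; rewrite ler_distl => /andP[_ hq].
have wq : enorm w * (LH * enorm v ^+ 2) <= k * (LH * enorm v ^+ 2).
  by rewrite ler_wpM2r // ltW.
have e1 := quad_addM (hess f x) c%:M v.
have e2 := quad_addM (hess f (x + w)) c%:M v.
by move: e1 e2 hq wq kq; clear; abstract_values; lra.
Qed.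

End OpenConditions.

Lemma successor_stopped (R : realType) (n : nat) (pr : dncg_params R) f
    (x : 'cV[R]_n) c y :
  successor pr f x c (Stopped y) -> c = Certify _ _ /\ y = x.
Proof. by move E : (Stopped y) => s hs; case: hs E => // -[->]. Qed.

Lemma decides_certify_oracle (R : realType) (n : nat) (pr : dncg_params R) f
    (x : 'cV[R]_n) h :
  decides pr f x (Certify _ _) h -> calls_oracle pr f x.
Proof. by move E : (Certify _ _) => c hd; case: hd E. Qed.

(** * Random executions *)

Section RandomExecution.
Context (R : realType) (n : nat) (f : 'cV[R]_n -> R) (N : set 'cV[R]_n) (LH : R).
Context (n_gt0 : (0 < n)%N) (smooth : lipschitz_hessian f N LH).
Context (x0 : 'cV[R]_n).
Hypotheses (level_closed : closed [set x | f x <= f x0])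
  (level_N : [set x | f x <= f x0] `<=` N).
Context (pr : dncg_params R).
Let eps := par_epsH pr.
Hypotheses (epsg0 : 0 < par_epsg pr) (eps0 : 0 < eps) (th01 : 0 < par_theta pr < 1)
  (zeta01 : 0 < par_zeta pr < 1) (eta0 : 0 < par_eta pr) (M_ge0 : 0 <= start_M pr).
Context (UH flow : R) (Nmeo : nat).
Hypotheses (UH0 : 0 <= UH) (flow_le : forall x, f x <= f x0 -> flow <= f x).
Context (d : measure_display) (T : measurableType d) (P : probability T R).
Context (G : nat -> set (set T)) (run : T -> history R n).
Hypotheses (exec : forall t, is_execution pr f x0 (run t)) (adG : adapted G run).
Hypothesis bounded : forall t k x, state_at (run t) k = Running x ->
  calls_cg pr f x -> values_bounded f pr UH x.
Implicit Types (x y : 'cV[R]_n) (t : T).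
Local Opaque grad hess dot enorm quad opnorm.

Let sG k : sigma_algebra setT (G k). Proof. by case: adG. Qed.
Let mG k (A : set T) : G k A -> measurable A. Proof. by case: adG => _ + _ _ _ _; apply. Qed.
Let G_mono k : G k `<=` G k.+1. Proof. by case: adG. Qed.

Let running_in k (U : set 'cV[R]_n) :=
  [set t | exists2 x, state_at (run t) k = Running x & U x].
Let stopped_in k (U : set 'cV[R]_n) :=
  [set t | exists2 x, state_at (run t) k = Stopped x & U x].
Let large_grad := [set x | N x /\ par_epsg pr < enorm (grad f x)].
Let not_psd := [set x | N x /\ ~ psd (hess f x + eps%:M)].

Let G_running k (U : set 'cV[R]_n) : open U -> G k (running_in k U).
Proof. by case: adG => _ _ _ + _ _; apply. Qed.
Let G_stopped k (U : set 'cV[R]_n) : open U -> G k (stopped_in k U).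
Proof. by case: adG => _ _ _ _ + _; apply. Qed.
Let o_large_grad : open large_grad. Proof. exact: open_large_grad n_gt0 smooth _. Qed.
Let o_not_psd : open not_psd. Proof. exact: open_not_psd n_gt0 smooth _. Qed.

Let running_N t k x : state_at (run t) k = Running x -> N x.
Proof.
move=> hx; apply: level_N.
exact: (running_level n_gt0 smooth level_closed level_N epsg0 eps0 th01 zeta01
  eta0 M_ge0 UH0 (exec t) (@bounded t) hx).
Qed.

Lemma stopped_from t k y : state_at (run t) k = Stopped y ->
  exists i, [/\ state_at (run t) i = Running y, decision_at (run t) i = Certify _ _ &
    calls_oracle pr f y].
Proof.
have [r0 rS] := exec t.
elim: k y => [|k IH] y; first by rewrite r0.
move=> hy; have := rS k; case hk : (state_at (run t) k) => [x|x|].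
- rewrite hy => -[hd /successor_stopped[cE ->]].
  exists k; split=> //; rewrite cE in hd; exact: decides_certify_oracle hd.
- by rewrite hy => -[->]; exact: IH hk.
- by rewrite hy.
Qed.

Let called k := [set t | oracle_called pr f (run t) k].
Let succeeds k := [set t | oracle_succeeds pr f Nmeo (run t) k].

Let GC k : G k (called k).
Proof.
have -> : called k = running_in k setT `\` running_in k large_grad.
  apply/seteqP; split=> t.
    move=> [x hx ox]; split; first by exists x.
    by move=> [y]; rewrite hx => -[<-] [_]; rewrite ltNge => /negP; apply.
  move=> [[x hx _] nl]; exists x => //; rewrite /calls_oracle leNgt; apply/negP => h.
  by apply: nl; exists x => //; split=> //; exact: running_N hx.
by apply: sigma_setD; [exact: sG | apply: G_running; exact: openT | exact: G_running].
Qed.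

Let G_hvp k m : G k.+1 [set t | hvp_at (run t) k = m].
Proof. by case: adG. Qed.

(* A certificate shows up as a stop in the next state. *)
Let GCS k : G k.+1 (called k `&` succeeds k).
Proof.
have -> : called k `&` succeeds k =
    (called k `&` [set t | exists2 m, (m <= Nmeo)%N & hvp_at (run t) k = m]) `\`
    stopped_in k.+1 not_psd.
  apply/seteqP; split=> t.
    move=> [[x hx ox] [hN hcert]]; split.
      by split; [exists x | exists (hvp_at (run t) k)].
    move=> [y hy [_ npsd]]; apply: npsd.
    have := (exec t).2 k; rewrite hx hy => -[_ /successor_stopped[cE yx]].
    by rewrite yx; exact: hcert.
  move=> [[[x hx ox] [m hm mE]] ns]; split; first by exists x.
  split; first by rewrite mE.
  move=> y hy cE; apply: contrapT => npsd; apply: ns; exists y; last first.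
    by split=> //; exact: running_N hy.
  have := (exec t).2 k; rewrite hy cE => -[_ hs].
  by move: hs; move E : (Certify _ _) => c hs; case: hs E.
apply: sigma_setD; [exact: sG | | exact: G_stopped].
apply: sigma_setI; [exact: sG | by apply: G_mono; exact: GC |].
apply: (sigma_bigcup_cond (sG k.+1) (A := fun m => [set t | hvp_at (run t) k = m])).
by move=> m _; exact: G_hvp.
Qed.

Let m_running k : measurable (running_in k setT).
Proof. by apply: (@mG k); apply: G_running; exact: openT. Qed.

Let m_cost K m : measurable [set t | (\sum_(i < K) (hvp_at (run t) i + 1))%N = m].
Proof.
elim: K m => [|K IH] m.
  have [m0|m0] := eqVneq m 0%N.
    have -> : [set t | (\sum_(i < 0) (hvp_at (run t) i + 1))%N = m] = setT.
      by apply/seteqP; split=> // t _ /=; rewrite big_ord0 m0.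
    exact: measurableT.
  have -> : [set t | (\sum_(i < 0) (hvp_at (run t) i + 1))%N = m] = set0.
    by apply/seteqP; split=> // t /=; rewrite big_ord0 => m0'; rewrite -m0' eqxx in m0.
  exact: measurable0.
have -> : [set t | (\sum_(i < K.+1) (hvp_at (run t) i + 1))%N = m] =
    [set t | exists2 a, (a < m)%N &
      ([set t | (\sum_(i < K) (hvp_at (run t) i + 1))%N = a] `&`
       [set t | hvp_at (run t) K = (m - a.+1)%N]) t].
  apply/seteqP; split=> t /=.
    rewrite big_ord_recr /=; set s := (\sum_(i < K) _)%N => sm.
    exists s; first by rewrite -sm addn1 addnS ltnS leq_addr.
    by split=> //; rewrite -sm addn1 addnS subSS addKn.
  by move=> [a am [sa hK]]; rewrite big_ord_recr /= sa hK addn1 -subSn // subSS subnKC // ltnW.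
apply: (@sigma_bigcup_cond _ _ (@sigma_algebra_measurable _ T) (fun a => (a < m)%N)
  (fun a => [set t | (\sum_(i < K) (hvp_at (run t) i + 1))%N = a] `&`
       [set t | hvp_at (run t) K = (m - a.+1)%N])) => a _.
 apply: measurableI; first exact: IH.
by apply: (@mG K.+1); exact: G_hvp.
Qed.

Lemma measurable_terminates B (Q : 'cV[R]_n -> Prop) (W : nat -> set T) :
  (forall k, measurable (W k)) ->
  (forall t k, W k t <-> exists2 x, state_at (run t) k = Stopped x & Q x) ->
  measurable [set t | terminates_within B Q (run t)].
Proof.
move=> mW WE.
have -> : [set t | terminates_within B Q (run t)] =
    [set t | exists2 K, True & (W K `&` \bigcap_(k in `I_K) running_in k setT `&`
      [set t | exists2 m, (m <= B)%N &
        (\sum_(k < K) (hvp_at (run t) k + 1))%N = m]) t].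
  apply/seteqP; split=> t /=.
    move=> [K [x [hK hrun hB Qx]]]; exists K => //.
    split; last by exists (\sum_(k < K) (hvp_at (run t) k + 1))%N.
    split; first by apply/WE; exists x.
    by move=> k /= /hrun[y hy]; exists y.
  move=> [K _ [[/WE[x hx Qx] hrun] [m mB sm]]]; exists K, x; split=> //; last by rewrite sm.
  by move=> k /hrun[y hy _]; exists y.
have sT := @sigma_algebra_measurable _ T.
apply: (@sigma_bigcup_cond _ _ sT (fun=> True)
  (fun K => W K `&` \bigcap_(k in `I_K) running_in k setT `&`
      [set t | exists2 m, (m <= B)%N &
        (\sum_(k < K) (hvp_at (run t) k + 1))%N = m])) => K _.
apply: measurableI; first apply: measurableI => //.
  by apply: bigcap_measurableType => k _; exact: m_running.
apply: (@sigma_bigcup_cond _ _ sT (fun m => (m <= B)%N)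
  (fun m => [set t | (\sum_(k < K) (hvp_at (run t) k + 1))%N = m])) => m _.
exact: m_cost.
Qed.

Let K2 := K2_bar (par_theta pr) (par_zeta pr) (par_eta pr) LH (f x0 - flow) (par_epsg pr) eps.
Let B := (maxn (2 * minn n (J_cap UH eps (par_zeta pr)) + 2) Nmeo * K2)%N.

Let good := [set t | terminates_within B (correct_point pr f) (run t)].
Let bad := [set t | terminates_within B (incorrect_point pr f) (run t)].

Let stopped_spec t k x : state_at (run t) k = Stopped x ->
  calls_oracle pr f x /\ N x /\
  (- eps <= lambda_min (hess f x) <-> psd (hess f x + eps%:M)).
Proof.
move=> /stopped_from[i [hx _ ox]]; have Nx := running_N hx; split=> //; split=> //.
have Hsym := hess_sym smooth n_gt0 Nx; have := lambda_min_psd n_gt0 Hsym eps.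
exact.
Qed.

Lemma measurable_good : measurable good.
Proof.
apply: (@measurable_terminates B _ (fun k => stopped_in k setT `\` stopped_in k not_psd)).
  move=> k; apply: (@mG k); apply: sigma_setD; first exact: sG.
    by apply: G_stopped; exact: openT.
  exact: G_stopped.
move=> t k; split.
  move=> [[x hx _] np]; have [ox [Nx lp]] := stopped_spec hx.
  exists x => //; split=> //; apply/lp; apply: contrapT => h; apply: np.
  by exists x.
move=> [x hx [_ le]]; have [_ [_ lp]] := stopped_spec hx.
split; first by exists x.
by move=> [y]; rewrite hx => -[<-] [_]; apply; apply/lp.
Qed.

Lemma measurable_bad : measurable bad.
Proof.
apply: (@measurable_terminates B _ (fun k => stopped_in k not_psd)).
  by move=> k; apply: (@mG k); exact: G_stopped.
move=> t k; split.
  move=> [x hx [Nx np]]; have [ox [_ lp]] := stopped_spec hx.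
  exists x => //; split=> //; rewrite ltNge; apply/negP => h; apply: np.
  exact/lp.
move=> [x hx [_ le]]; have [_ [Nx lp]] := stopped_spec hx.
by exists x => //; split=> // /lp; rewrite leNgt le.
Qed.

Lemma good_bad_disjoint t : good t -> ~ bad t.
Proof.
move=> [K [x [hK rK _ [_ ex]]]] [K' [x' [hK' rK' _ [_ ex']]]].
have KK : K = K'.
  case: (ltngtP K K') => // [/rK'|/rK] [y]; first by rewrite hK.
  by rewrite hK'.
by move: hK' ex'; rewrite -KK hK => -[<-]; rewrite ltNge ex.
Qed.

Lemma terminates_good_or_bad t :
  (forall k, (k < K2)%N -> called k t -> (hvp_at (run t) k <= Nmeo)%N) ->
  exists k x, [/\ (k < K2)%N, state_at (run t) k = Running x,
     decision_at (run t) k = Certify _ _, called k t &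
     if `[< psd (hess f x + eps%:M) >] then good t else bad t].
Proof.
move=> hN.
have [k [x [kK st ck]]] := execution_terminates n_gt0 smooth level_closed level_N
  epsg0 eps0 th01 zeta01 eta0 M_ge0 UH0 flow_le (exec t) (@bounded t) hN.
have [sS sR dE rb ox] := st.
have [_ [_ lp]] := stopped_spec sS.
exists k, x; split=> //; first by exists x.
case: ifPn => /asboolP hp; exists k.+1, x; split=> //; split=> //; first exact/lp.
by rewrite ltNge; apply/negP => /lp.
Qed.

Context (delta : R) (delta01 : 0 <= delta < 1).
Hypothesis reliable : oracle_reliable pr f Nmeo delta P G run.

Lemma good_probability : (((1 - delta) ^+ K2)%:E <= P good)%E.
Proof.
apply: le_trans (successes_probability delta01 sG mG G_mono GC GCS reliable K2) _.
apply: le_measure; rewrite ?inE.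
- apply: (@mG K2); exact: (successes_measurable sG G_mono GC GCS).
- exact: measurable_good.
move=> t succ.
have [|k [x [kK hx cE ck]]] := @terminates_good_or_bad t.
  by move=> k kK ck; have [] := succ k kK ck.
case: ifPn => // /asboolP np _; case: np.
by have [_] := succ k kK ck; apply.
Qed.

Lemma bad_probability : (P bad <= (1 - (1 - delta) ^+ K2)%:E)%E.
Proof.
apply: (@le_trans _ _ (P (~` good))).
  apply: le_measure; rewrite ?inE; first exact: measurable_bad.
    by apply: measurableC; exact: measurable_good.
  by move=> t bt gt; exact: good_bad_disjoint gt bt.
rewrite probability_setC; last exact: measurable_good.
by rewrite EFinB leeB //; exact: good_probability.
Qed.

End RandomExecution.

(** * Asymptotic complexity *)

Section SoftO.
Context (R : realType).
Implicit Types (x y M C eps zeta epsg epsH : R).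

Lemma absz_ceil_le x : 0 <= x -> (absz (Num.ceil x))%:R <= x + 1.
Proof.
move=> x0; rewrite natr_absz ger0_norm; last first.
  by rewrite ceil_ge0 (lt_le_trans _ x0) // ltrN10.
have := ceilB1_lt x; rewrite intrD mulrN1z; lra.
Qed.

Lemma powR_oppr_half eps : 0 < eps -> eps `^ (- 2^-1) = (Num.sqrt eps)^-1.
Proof. by move=> e0; rewrite powRN powR12_sqrt // ltW. Qed.

Lemma powR_oppr_half_ge1 eps : 0 < eps < 1 -> 1 <= eps `^ (- 2^-1).
Proof.
move=> /andP[e0 e1]; rewrite powR_oppr_half // invf_ge1 ?sqrtr_gt0 //.
by rewrite -[leRHS](@sqrtr1 R) ler_wsqrtr // ltW.
Qed.

(** Uses 1 - sqrt tau >= (1 - tau) / 2 = 1 / (2 (sqrt kappa + 1)). *)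
Lemma ratio_le_kappa M eps zeta : 0 < eps -> 0 <= M -> 0 < zeta ->
  Num.sqrt (capT M eps) / zeta_hat M eps zeta <= 24 * kappa M eps ^+ 4 / zeta.
Proof.
move=> e0 M0 z0; have k2 := kappa_ge2 e0 M0.
have t0 := tau_gt0 e0 M0; have t1 := tau_lt1 e0 M0.
have u0 := sqrt_tau_lt1 e0 M0; have s0 := sqrt_kappa_gt0 e0 M0.
have hT := one_sub_tau e0 M0.
have tS : Num.sqrt (tau M eps) ^+ 2 = tau M eps by rewrite sqr_sqrtr // ltW.
have kS : Num.sqrt (kappa M eps) ^+ 2 = kappa M eps by rewrite sqr_sqrtr //; lra.
have v0 : 0 <= Num.sqrt (tau M eps) by exact: sqrtr_ge0.
have sT : Num.sqrt (capT M eps) = 2 * kappa M eps ^+ 2 / (1 - Num.sqrt (tau M eps)).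
  have -> : capT M eps = (2 * kappa M eps ^+ 2 / (1 - Num.sqrt (tau M eps))) ^+ 2.
    by rewrite /capT; field; rewrite gt_eqF.
  rewrite sqrtr_sqr ger0_norm //; apply: divr_ge0; last exact: ltW.
  by apply: mulr_ge0; rewrite ?sqr_ge0.
rewrite sT /zeta_hat.
set v : R := Num.sqrt (tau M eps) in tS u0 v0 *; set t : R := tau M eps in tS hT.
set s : R := Num.sqrt (kappa M eps) in hT kS s0; set k : R := kappa M eps in kS k2 *.
clear sT t0 t1; clearbody v t s k.
have hv : (1 - v)^-1 <= 2 * (s + 1).
  have s1 : 0 < s + 1 by lra.
  have E : (1 - v) * (1 + v) * (s + 1) = 1.
    have -> : (1 - v) * (1 + v) = 1 - v ^+ 2 by ring.
    by rewrite tS hT mulVf // gt_eqF.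
  rewrite -[leLHS]mulr1 mulrC ler_pdivrMr //.
  have : (1 - v) * (1 + v) * (s + 1) <= (1 - v) * 2 * (s + 1).
    by rewrite ler_pM2r // ler_pM2l //; lra.
  lra.
have sk : s + 1 <= 2 * k.
  have : s <= s ^+ 2.
    rewrite expr2 ler_peMr ?(ltW s0) // leNgt; apply/negP => s1.
    have : s ^+ 2 < 1 by rewrite expr_lt1 // ltW.
    by rewrite kS; lra.
  by rewrite kS; lra.
have -> : 2 * k ^+ 2 / (1 - v) / (zeta / (3 * k)) = 6 * k ^+ 3 / zeta * (1 - v)^-1.
  by field; rewrite !gt_eqF //; lra.
have -> : 24 * k ^+ 4 / zeta = 6 * k ^+ 3 / zeta * (4 * k) by field; rewrite gt_eqF.
rewrite ler_wpM2l //; last lra.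
by rewrite divr_ge0 ?(ltW z0) // mulr_ge0 // exprn_ge0 //; lra.
Qed.

(** J is at most of order sqrt kappa * ln kappa by J_cond_large, and kappa is at most
    (M + 2) / eps. *)
Lemma J_cap_le M eps zeta : 0 < eps < 1 -> 0 <= M -> 0 < zeta < 1 ->
  (J_cap M eps zeta)%:R <=
  (1 + 2 * (Num.sqrt (M + 2) + 1) * (ln (24 / zeta) + 4 * ln (M + 2) + 4)) *
   (1 + `|ln eps|) * eps `^ (- 2^-1).
Proof.
move=> e01 M0 z01; have [e0 e1] := andP e01; have [z0 z1] := andP z01.
have s1 := powR_oppr_half_ge1 e01; rewrite powR_oppr_half // in s1 *.
have k2 := kappa_ge2 e0 M0.
have hk : kappa M eps <= (M + 2) / eps.
  by rewrite /kappa ler_pM2r ?invr_gt0 //; lra.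
have sq : Num.sqrt (kappa M eps) <= Num.sqrt (M + 2) * (Num.sqrt eps)^-1.
  by rewrite -sqrtrV ?(ltW e0) // -sqrtrM ?ler_wsqrtr //; lra.
set X := 2 * (Num.sqrt (kappa M eps) + 1) *
  ln (Num.sqrt (capT M eps) / zeta_hat M eps zeta).
have zh0 := zeta_hat_gt0 e0 M0 z0; have zh1 := zeta_hat_lt1 e0 M0 z01.
have sT0 : 0 < Num.sqrt (capT M eps) by rewrite sqrtr_gt0 capT_gt0.
have sT1 : 1 <= Num.sqrt (capT M eps).
  rewrite -[leLHS](@sqrtr1 R) ler_wsqrtr //.
  have := capT_ge_kappa e0 M0; lra.
have r1 : 1 <= Num.sqrt (capT M eps) / zeta_hat M eps zeta.
  by rewrite ler_pdivlMr //; lra.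
have l0 := ln_ge0 r1.
have sk0 := sqrtr_ge0 (kappa M eps).
have X0 : 0 <= X by rewrite /X !mulr_ge0 // addr_ge0.
have hJ : (J_cap M eps zeta)%:R <= X + 1.
  have [_ Jmin] := J_cap_spec e0 M0 z0.
  apply: le_trans (absz_ceil_le X0); rewrite ler_nat; apply: Jmin.
  apply: J_cond_large => //; rewrite -/X natr_absz ger0_norm ?ceil_ge //.
  by rewrite ceil_ge0 (lt_le_trans _ X0) // ltrN10.
have z24 : 1 <= 24 / zeta by rewrite ler_pdivlMr //; lra.
have lz := ln_ge0 z24.
have M2 : 1 <= M + 2 by lra.
have lM := ln_ge0 M2.
have hl : ln (Num.sqrt (capT M eps) / zeta_hat M eps zeta) <=
    (ln (24 / zeta) + 4 * ln (M + 2) + 4) * (1 + `|ln eps|).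
  have k0 : 0 < kappa M eps by lra.
  have K4 : 24 * kappa M eps ^+ 4 / zeta = (24 / zeta) * kappa M eps ^+ 4 by field; rewrite gt_eqF.
  have lk : ln (kappa M eps) <= ln (M + 2) + `|ln eps|.
    apply: (@le_trans _ _ (ln ((M + 2) / eps))).
      by rewrite ler_ln ?posrE // divr_gt0 //; lra.
    rewrite ln_div ?posrE //; last lra.
    by rewrite lerD2l -normrN ler_norm.
  apply: (@le_trans _ _ (ln (24 / zeta * kappa M eps ^+ 4))).
    rewrite -K4 ler_ln ?posrE; first exact: ratio_le_kappa.
      exact: lt_le_trans ltr01 r1.
    by apply: divr_gt0 => //; apply: mulr_gt0 => //; exact: exprn_gt0.
  have -> : ln (24 / zeta * kappa M eps ^+ 4) = ln (24 / zeta) + 4 * ln (kappa M eps).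
    transitivity (ln (24 / zeta) + ln (kappa M eps ^+ 4)).
      by apply: lnM; rewrite posrE; [exact: divr_gt0 | exact: exprn_gt0].
    by rewrite lnXn // [4 * _]mulr_natl.
  have le0 : 0 <= `|ln eps| by exact: normr_ge0.
  have := mulr_ge0 lz le0; have := mulr_ge0 lM le0; lra.
apply: le_trans hJ _.
set L := 1 + `|ln eps|; set s := (Num.sqrt eps)^-1 in s1 sq *.
set A := ln (24 / zeta) + 4 * ln (M + 2) + 4 in hl *.
have A0 : 0 <= A by rewrite /A; lra.
have L1 : 1 <= L by rewrite lerDl.
have S0 := sqrtr_ge0 (M + 2).
have Ls : 1 <= L * s by rewrite -[leLHS]mulr1 ler_pM.
have hX : X <= 2 * ((Num.sqrt (M + 2) + 1) * s) * (A * L).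
  apply: ler_pM; [by move: sk0; lra | exact: l0 | | exact: hl].
  by rewrite ler_pM2l // mulrDl mul1r lerD.
have -> : (1 + 2 * (Num.sqrt (M + 2) + 1) * A) * L * s =
  L * s + 2 * ((Num.sqrt (M + 2) + 1) * s) * (A * L) by ring.
by rewrite addrC lerD.
Qed.

Lemma K2_bar_le (theta zeta eta LH gap epsg epsH : R) :
  0 < Num.min (c_sol theta zeta eta LH) (c_nc theta eta LH / 8) -> 0 <= gap ->
  0 < epsg -> 0 < epsH < 1 ->
  (K2_bar theta zeta eta LH gap epsg epsH)%:R <=
    (3 * gap / Num.min (c_sol theta zeta eta LH) (c_nc theta eta LH / 8) + 3) *
    Num.max (epsg ^- 3 * epsH ^+ 3) (epsH ^- 3).
Proof.
rewrite /K2_bar; set c := Num.min _ _; set mx := Num.max _ _ => c0 g0 eg0 /andP[e0 e1].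
have mx1 : 1 <= mx.
  rewrite le_max; apply/orP; right.
  by rewrite invf_ge1 ?exprn_gt0 // exprn_ile1 // ltW.
have X0 : 0 <= 3 * gap / c * mx.
  by rewrite mulr_ge0 ?divr_ge0 ?mulr_ge0 ?(ltW c0) //; lra.
rewrite natrD; have := absz_ceil_le X0; lra.
Qed.

Lemma N_meo_le n C epsH : 0 <= C -> 0 < epsH < 1 ->
  (N_meo n C epsH)%:R <= (2 + C) * epsH `^ (- 2^-1).
Proof.
move=> C0 e01; have s1 := powR_oppr_half_ge1 e01; have s0 := le_trans ler01 s1.
have CS := mulr_ge0 C0 s0.
apply: (@le_trans _ _ (1 + absz (Num.ceil (C * epsH `^ (- 2^-1))))%N%:R).
  by rewrite ler_nat geq_minr.
by rewrite natrD; have := absz_ceil_le CS; lra.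
Qed.

Lemma max_rate epsg epsH : 0 < epsg -> 0 < epsH ->
  Num.max (epsg ^- 3 * epsH ^+ 3) (epsH ^- 3) * epsH `^ (- 2^-1) =
  Num.max (epsg ^- 3 * epsH `^ (5 / 2)) (epsH `^ (- (7 / 2))).
Proof.
move=> eg0 e0; rewrite maxr_pMl ?powR_ge0 //; congr Num.max.
  rewrite -mulrA -(powR_mulrn 3 (ltW e0)) -powRD; last by rewrite (gt_eqF e0) implybT.
  by congr (_ * _ `^ _); field.
rewrite -(powR_invn 3 (ltW e0)) -powRD; last by rewrite (gt_eqF e0) implybT.
by congr (_ `^ _); field.
Qed.

Lemma work_bound_soft_O (theta zeta eta LH UH gap : R) (Cmeo : R -> R -> R)
  (D : R -> R -> R -> Prop) :
  0 < zeta < 1 -> 0 <= UH -> 0 <= gap ->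
  0 < Num.min (c_sol theta zeta eta LH) (c_nc theta eta LH / 8) ->
  at_most_logarithmic Cmeo ->
  (forall epsg epsH delta, D epsg epsH delta ->
     [/\ 0 < epsg, 0 < epsH < 1 & 0 <= delta < 1]) ->
  soft_O_large_n D
    (fun n epsg epsH delta =>
       work_bound n theta zeta eta LH UH gap (Cmeo delta epsH) epsg epsH)
    (fun epsg epsH =>
       Num.max (epsg ^- 3 * epsH `^ (5 / 2)) (epsH `^ (- (7 / 2)))).
Proof.
move=> z01 U0 g0 c0 [a ha] hD; have [z0 z1] := andP z01.
pose A1 := 1 + 2 * (Num.sqrt (UH + 2) + 1) * (ln (24 / zeta) + 4 * ln (UH + 2) + 4).
pose A3 := 3 * gap / Num.min (c_sol theta zeta eta LH) (c_nc theta eta LH / 8) + 3.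
exists ((2 * A1 + 2 + (2 + `|a|)) * A3), 2%N => epsg epsH delta /hD[eg0 e01 d01].
exists 0%N => n _; have [e0 e1] := andP e01.
have s1 := powR_oppr_half_ge1 e01.
have hJ := J_cap_le e01 U0 z01; rewrite -/A1 in hJ.
have hK := K2_bar_le c0 g0 eg0 e01; rewrite -/A3 in hK.
have /andP[C0 hC] := ha delta epsH d01 e01.
have hN := N_meo_le n C0 e01.
rewrite -max_rate // /work_bound natrM.
set s := epsH `^ _ in s1 hJ hN *.
set mx := Num.max _ _ in hK *.
set Lg := 1 + `|ln epsg| + `|ln epsH| + `|ln delta|.
have ng := normr_ge0 (ln epsg); have nH := normr_ge0 (ln epsH).
have nd := normr_ge0 (ln delta).
have Lg1 : 1 <= Lg by rewrite /Lg; lra.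
have Lg2 : Lg <= Lg ^+ 2 by rewrite expr2 ler_peMr //; lra.
have A10 : 0 <= A1.
  have lz : 0 <= ln (24 / zeta) by rewrite ln_ge0 // ler_pdivlMr //; lra.
  have lU : 0 <= ln (UH + 2) by rewrite ln_ge0 //; lra.
  by rewrite /A1 !(addr_ge0, mulr_ge0) // sqrtr_ge0.
have A30 : 0 <= A3 by rewrite /A3 addr_ge0 // divr_ge0 ?mulr_ge0 // ltW.
have s0 : 0 <= s by lra.
have hJ' : (2 * minn n (J_cap UH epsH zeta) + 2)%N%:R <= (2 * A1 + 2) * Lg ^+ 2 * s.
  apply: (@le_trans _ _ (2 * (A1 * (1 + `|ln epsH|) * s) + 2)).
    rewrite natrD natrM lerD2r ler_pM2l //; apply: le_trans hJ.
    by rewrite ler_nat geq_minr.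
  have h1 : A1 * (1 + `|ln epsH|) * s <= A1 * Lg ^+ 2 * s.
    by rewrite ler_wpM2r // ler_wpM2l // (le_trans _ Lg2) // /Lg; lra.
  have h2 : 1 <= Lg ^+ 2 * s by rewrite -[leLHS]mulr1 ler_pM //; lra.
  lra.
have hN' : (N_meo n (Cmeo delta epsH) epsH)%:R <= (2 + `|a|) * Lg ^+ 2 * s.
  apply: le_trans hN _; rewrite ler_wpM2r // mulrDl lerD //; first lra.
  apply: le_trans hC _; rewrite -mulrA.
  apply: (@le_trans _ _ (`|a| * ((1 + `|ln delta|) * (1 + `|ln epsH|)))).
    by rewrite ler_wpM2r ?ler_norm // mulr_ge0 //; lra.
  by rewrite ler_wpM2l ?normr_ge0 // expr2 ler_pM //; rewrite /Lg; lra.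
have hm : (maxn (2 * minn n (J_cap UH epsH zeta) + 2) (N_meo n (Cmeo delta epsH) epsH))%:R <=
    (2 * A1 + 2 + (2 + `|a|)) * Lg ^+ 2 * s.
  have p1 : 0 <= Lg ^+ 2 * s by rewrite mulr_ge0 // sqr_ge0.
  have p2 : 0 <= (2 * A1 + 2) * Lg ^+ 2 * s by rewrite -mulrA mulr_ge0 //; lra.
  have p3 : 0 <= (2 + `|a|) * Lg ^+ 2 * s.
    by rewrite -mulrA mulr_ge0 //; have := normr_ge0 a; lra.
  case: (leqP (2 * minn n (J_cap UH epsH zeta) + 2) (N_meo n (Cmeo delta epsH) epsH)) => _; lra.
apply: (@le_trans _ _ ((2 * A1 + 2 + (2 + `|a|)) * Lg ^+ 2 * s * (A3 * mx))).
  exact: ler_pM.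
by rewrite le_eqVlt; apply/orP; left; apply/eqP; ring.
Qed.

End SoftO.

(** * The complexity theorem *)

Lemma bernoulli_le (R : realType) (delta : R) K : 0 <= delta <= 1 ->
  1 - K%:R * delta <= (1 - delta) ^+ K.
Proof.
move=> /andP[d0 d1]; elim: K => [|K IH]; first by rewrite mul0r subr0 expr0.
rewrite exprS; apply: (@le_trans _ _ ((1 - delta) * (1 - K%:R * delta))).
  have : 0 <= delta * (K%:R * delta) by rewrite !mulr_ge0.
  by rewrite -natr1; lra.
by rewrite ler_wpM2l // subr_ge0.
Qed.

Theorem corollary2 (R : realType) (n : nat) (n_gt0 : (0 < n)%N)
  (f : 'cV[R]_n -> R) (x0 : 'cV[R]_n)
  (epsg epsH theta zeta eta : R) (Mopt : option R)
  (epsg_gt0 : 0 < epsg) (epsH_01 : 0 < epsH < 1)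
  (theta_01 : 0 < theta < 1) (zeta_01 : 0 < zeta < 1) (eta_gt0 : 0 < eta)
  (Mopt_gt0 : forall M, Mopt = Some M -> 0 < M)
  (LH UH flow delta : R) (UH_gt0 : 0 < UH) (delta_01 : 0 <= delta < 1)
  (Cmeo : R -> R -> R) (Cmeo_log : at_most_logarithmic Cmeo)
  (d : measure_display) (T : measurableType d) (P : probability T R)
  (G : nat -> set (set T)) (run : T -> history R n)
  (N : set 'cV[R]_n) :
  let pr := DNCGParams epsg epsH theta zeta eta Mopt in
  let level := [set x | f x <= f x0] in
  let Nmeo := N_meo n (Cmeo delta epsH) epsH in
  let gap := f x0 - flow in
  let K2 := K2_bar theta zeta eta LH gap epsg epsH in
  let B := work_bound n theta zeta eta LH UH gap (Cmeo delta epsH) epsg epsH in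
  let good := [set t | terminates_within B (correct_point pr f) (run t)] in
  let bad := [set t | terminates_within B (incorrect_point pr f) (run t)] in
  (* the random execution of the algorithm *)
  (forall t, is_execution pr f x0 (run t)) ->
  adapted G run ->
  (* assumptions on f *)
  compact level ->
  open N ->
  level `<=` N ->
  (forall t k x dir, state_at (run t) k = Running x ->
     decision_at (run t) k = Move dir -> is_trial pr f x dir `<=` N) ->
  (forall x, N x -> differentiable f x) ->
  (forall x, N x -> differentiable (grad f) x) ->
  (forall x y, N x -> N y ->
     opnorm (hess f x - hess f y) <= LH * enorm (x - y)) ->
  (forall x, level x -> flow <= f x) ->
  (forall x, level x -> opnorm (hess f x) <= UH) ->
  (* assumption on the oracle *)
  oracle_reliable pr f Nmeo delta P G run ->
  (* assumption on the values of M in Capped CG *)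
  (forall t k x M, state_at (run t) k = Running x -> calls_cg pr f x ->
     cg_M_value (hess f x) (grad f x) epsH zeta (start_M pr) M -> M <= UH) ->
  [/\ measurable good /\ (((1 - delta) ^+ K2)%:E <= P good)%E,
      measurable bad /\ (P bad <= (1 - (1 - delta) ^+ K2)%:E)%E,
      (forall t, (forall k, oracle_called pr f (run t) k ->
                    (hvp_at (run t) k <= Nmeo)%N) -> good t \/ bad t),
      soft_O_large_n
        (fun epsg' epsH' delta' =>
           [/\ 0 < epsg', 0 < epsH' < 1, 0 <= delta' < 1 &
               delta' < 1 / (K2_bar theta zeta eta LH gap epsg' epsH')%:R])
        (fun n' epsg' epsH' delta' =>
           work_bound n' theta zeta eta LH UH gap (Cmeo delta' epsH') epsg' epsH')
        (fun epsg' epsH' =>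
           Num.max (epsg' ^- 3 * epsH' `^ (5 / 2)) (epsH' `^ (- (7 / 2)))) &
      delta < 1 / K2%:R -> ((1 - K2%:R * delta)%:E <= P good)%E].
Proof.
move=> pr level Nmeo gap K2 B good bad exec adG clevel oN levelN _ df dg lip hflow _ rel hM.
have smooth : lipschitz_hessian f N LH by split.
have level_closed : closed level by apply: compact_closed clevel; exact: norm_hausdorff.
have [e0 e1] := andP epsH_01.
have M_ge0 : 0 <= start_M pr.
  rewrite /start_M /=; move: Mopt_gt0; clear; case: Mopt => //= M h.
  exact: ltW (h M erefl).
have bounded t k x : state_at (run t) k = Running x -> calls_cg pr f x ->
    values_bounded f pr UH x.
  by move=> hx cx M; exact: hM hx cx.
have L0 : 0 <= LH by exact: (level_LH_ge0 n_gt0 smooth levelN (lexx (f x0))).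
have gap0 : 0 <= gap by rewrite subr_ge0; apply: hflow; exact: lexx.
have mgood := measurable_good n_gt0 smooth level_closed levelN (pr := pr) epsg_gt0 e0
  theta_01 zeta_01 eta_gt0 M_ge0 flow Nmeo (ltW UH_gt0) exec adG bounded.
have mbad := measurable_bad n_gt0 smooth level_closed levelN (pr := pr) epsg_gt0 e0
  theta_01 zeta_01 eta_gt0 M_ge0 flow Nmeo (ltW UH_gt0) exec adG bounded.
have pgood := good_probability n_gt0 smooth level_closed levelN (pr := pr) epsg_gt0 e0
  theta_01 zeta_01 eta_gt0 M_ge0 (ltW UH_gt0) hflow exec adG bounded delta_01 rel.
have pbad := bad_probability n_gt0 smooth level_closed levelN (pr := pr) epsg_gt0 e0
  theta_01 zeta_01 eta_gt0 M_ge0 (ltW UH_gt0) hflow exec adG bounded delta_01 rel.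
split; [by split | by split | | | ].
- move=> t hN.
  have [|k [x [_ _ _ _]]] := terminates_good_or_bad n_gt0 smooth level_closed levelN
    (pr := pr) epsg_gt0 e0 theta_01 zeta_01 eta_gt0 M_ge0 (ltW UH_gt0) hflow exec
    bounded (t := t) (Nmeo := Nmeo).
  + by move=> k _; exact: hN.
  + by case: ifP => _; [left | right].
- apply: work_bound_soft_O => //; first exact: ltW.
    exact: decrease_constant_gt0.
  by move=> eg eH dl [].
- move=> _; apply: le_trans pgood; rewrite lee_fin; apply: bernoulli_le.
  by case/andP: delta_01 => -> /ltW ->.
Qed.
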